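(* Let $\Omega\subset\mathbb{R}^3$ be a bounded connected open set with $C^{1,1}$ boundary $\Gamma$, let $\theta>0$, $\alpha<A_1$ and $\eta\ge c_{\alpha,\theta}$, and let $\lambda_n,u_n^\Omega,u_n^\Gamma$ ($n\in\mathbb{N}$) be the Steklov eigenvalues, eigenfunctions and normalized traces described in the context. Assume that $0\notin\Sigma=\{\lambda_n:n\in\mathbb{N}\}$. Let $f\in TL^2(\Gamma)$ be represented as $$f=\sum_{n=1}^\infty c_nu_n^\Gamma,$$ where $(c_n)_{n\in\mathbb{N}}\in\ell^2$. Then the solution $u\in X_T(\Omega)$ of the problem $\operatorname{curl}\operatorname{curl}u-\alpha u-\theta\operatorname{grad}\operatorname{div}u=0$ in $\Omega$, $\nu\times\operatorname{curl}u=f$ on $\Gamma$, i.e. of $$\int_\Omega\operatorname{curl}u\cdot\operatorname{curl}\varphi\,dx-\alpha\int_\Omega u\cdot\varphi\,dx+\theta\int_\Omega\operatorname{div}u\,\operatorname{div}\varphi\,dx=-\int_\Gamma f\cdot\varphi\,d\sigma\qquad\text{for all }\varphi\in X_T(\Omega),$$ is given by $$u=\sum_{n=1}^\infty\left(\frac{\sqrt{|\lambda_n-\eta|}}{\lambda_n}c_n\right)u_n^\Omega.$$ Moreover, the corresponding interior Calderón operator $\mathcal{C}$ can be represented as $$\mathcal{C}(f)=\nu\times\sum_{n=1}^\infty\frac{c_n}{\lambda_n}u_n^\Gamma.$$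
   Context: Functions are complex-valued; $a\cdot b=\sum_i a_ib_i$ (no conjugation); $\nu$ is the unit outer normal to $\Gamma$, $d\sigma$ the surface measure; $\mathbb{N}=\{1,2,\dots\}$. $X_T(\Omega)=\{u\in(L^2(\Omega))^3:\operatorname{curl}u\in(L^2(\Omega))^3,\ \operatorname{div}u\in L^2(\Omega),\ \nu\cdot u=0\text{ on }\Gamma\}$ with norm $\|u\|^2=\|u\|^2_{L^2}+\|\operatorname{curl}u\|^2_{L^2}+\|\operatorname{div}u\|^2_{L^2}$; for $C^{1,1}$ boundary it equals $\{u\in(H^1(\Omega))^3:\nu\cdot u=0\text{ on }\Gamma\}$ with continuous embedding into $(H^1(\Omega))^3$. $TL^2(\Gamma)=\{f\in(L^2(\Gamma))^3:\nu\cdot f=0\text{ on }\Gamma\}$. $\pi_Tu=\nu\times(u\times\nu)$ is the tangential components trace on $\Gamma$, which coincides with the usual trace for $u\in X_T(\Omega)$. $A_1=\inf\left\{\frac{\int_\Omega|\operatorname{curl}u|^2dx+\theta\int_\Omega|\operatorname{div}u|^2dx}{\int_\Omega|u|^2dx}:u\in(H^1_0(\Omega))^3,u\ne0\right\}$. For $\eta\ge0$ let $\langle u,v\rangle^{\eta}_{\alpha,\theta}=\int_\Omega\operatorname{curl}u\cdot\operatorname{curl}\bar v\,dx-\alpha\int_\Omega u\cdot\bar v\,dx+\theta\int_\Omega\operatorname{div}u\operatorname{div}\bar v\,dx+\eta\int_\Gamma u\cdot\bar v\,d\sigma$. $c_{\alpha,\theta}\ge0$ is a fixed constant such that for every $\eta\ge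 c_{\alpha,\theta}$ the form $\langle u,u\rangle^\eta_{\alpha,\theta}$ is coercive on $X_T(\Omega)$ (it exists when $\alpha<A_1$); then $\langle\cdot,\cdot\rangle^\eta_{\alpha,\theta}$ is a scalar product on $X_T(\Omega)$. $\eta\ge c_{\alpha,\theta}$ is fixed. $\mathcal{H}(\Omega)$ is the orthogonal complement of $(H^1_0(\Omega))^3$ in $X_T(\Omega)$ with respect to $\langle\cdot,\cdot\rangle^\eta_{\alpha,\theta}$; equivalently, the set of $u\in X_T(\Omega)$ that are weak solutions of $\operatorname{curl}\operatorname{curl}u-\alpha u-\theta\operatorname{grad}\operatorname{div}u=0$ in $\Omega$. The Steklov eigenvalues are the $\lambda\in\mathbb{R}$ for which there is $u\in X_T(\Omega)\setminus\{0\}$ with $\int_\Omega\operatorname{curl}u\cdot\operatorname{curl}\varphi\,dx-\alpha\int_\Omega u\cdot\varphi\,dx+\theta\int_\Omega\operatorname{div}u\operatorname{div}\varphi\,dx=-\lambda\int_\Gamma u\cdot\varphi\,d\sigma$ for all $\varphi\in X_T(\Omega)$. They have finite multiplicity and form a sequence $\lambda_n$, $n\in\mathbb{N}$ (repeated according to multiplicity), with $\lambda_n<\eta$ and $\lambda_n\to-\infty$. $u_n^\Omega$, $n\in\mathbb{N}$, is a Hilbert basis of $\mathcal{H}(\Omega)$ consisting of corresponding eigenfunctions, normalized by $\langle u_n^\Omega,u_m^\Omega\rangle^\eta_{\alpha,\theta}=\delta_{nm}$. Set $u_n^\Gamma:=\sqrt{|\lambda_n-\eta|}\,\pi_Tu_n^\Omega$;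 then $u_n^\Gamma$, $n\in\mathbb{N}$, is an orthonormal basis of $TL^2(\Gamma)$ (with scalar product $\int_\Gamma f\cdot\bar g\,d\sigma$). When $0\notin\Sigma$, the weak problem in the claim is uniquely solvable for every $f\in TL^2(\Gamma)$, and the interior Calderón operator $\mathcal{C}:TL^2(\Gamma)\to TL^2(\Gamma)$ is defined by $\mathcal{C}(f):=\nu\times u$ on $\Gamma$, where $u$ is that solution. *)

(* Defs.v *)
From HB Require Import structures.
From mathcomp Require Import all_boot all_order all_algebra.
From mathcomp Require Import complex.
From mathcomp Require Import all_classical all_reals all_analysis.

Set Implicit Arguments.
Unset Strict Implicit.
Unset Printing Implicit Defensive.

Import Order.TTheory GRing.Theory Num.Theory.
Import numFieldNormedType.Exports.

Local Open Scope classical_set_scope.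
Local Open Scope ring_scope.

(* Points of R^3 form the product R * R * R, which carries the topology and the
   product measure; values of vector fields are row vectors. *)
Notation space3 R := (R * R * R)%type.
(* The same type, as the library's measurable type carrying Lebesgue measure. *)
Notation mspace3 R :=
  (measurableTypeR R * measurableTypeR R * measurableTypeR R)%type.
Notation cfield R := (space3 R -> 'rV[R[i]]_3).

Section VectorAlgebra.
Context {K : comNzRingType}.
Implicit Types a b : 'rV[K]_3.

Definition dot a b : K := \sum_i a 0 i * b 0 i.

(* Indices are taken in 'I_3 = Z/3. *)
Definition cross a b : 'rV[K]_3 :=
  \row_i (a 0 (i + 1) * b 0 (i + 2) - a 0 (i + 2) * b 0 (i + 1)).

End VectorAlgebra.

Section Basics.
Context {R : realType}.

Definition vec (x : space3 R) : 'rV[R]_3 :=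
  \row_i (if i == 0 then x.1.1 else if i == 1 then x.1.2 else x.2).

Definition basis (i : 'I_3) : space3 R :=
  ((i == 0)%:R, (i == 1)%:R, (i == 2)%:R).

Definition toC (a : 'rV[R]_3) : 'rV[R[i]]_3 := map_mx (real_complex R) a.

Definition conj_field (u : cfield R) : cfield R := fun x => map_mx conjc (u x).

Definition leb2 : {measure set (measurableTypeR R * measurableTypeR R) -> \bar R} :=
  (@lebesgue_measure R \x @lebesgue_measure R)%E.

Definition leb3 : {measure set (mspace3 R) -> \bar R} :=
  (leb2 \x @lebesgue_measure R)%E.

Definition absq (z : R[i]) : R := complex.Re z ^+ 2 + complex.Im z ^+ 2.

Definition cint (mu : {measure set (mspace3 R) -> \bar R}) (D : set (space3 R))
    (f : space3 R -> R[i]) : R[i] :=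
  Complex (Rintegral mu D (fun x => complex.Re (f x)))
          (Rintegral mu D (fun x => complex.Im (f x))).

Definition sqL2 (mu : {measure set (mspace3 R) -> \bar R}) (D : set (space3 R))
    (f : space3 R -> R[i]) : \bar R :=
  (\int[mu]_(x in D) (absq (f x))%:E)%E.

Definition sqL2v (mu : {measure set (mspace3 R) -> \bar R}) (D : set (space3 R))
    (u : cfield R) : \bar R :=
  (\int[mu]_(x in D) (\sum_i absq (u x 0 i))%:E)%E.

Definition L2 (mu : {measure set (mspace3 R) -> \bar R}) (D : set (space3 R))
    (f : space3 R -> R[i]) : Prop :=
  [/\ measurable_fun (D : set (mspace3 R)) (fun x => complex.Re (f x)),
      measurable_fun (D : set (mspace3 R)) (fun x => complex.Im (f x)) &
      (sqL2 mu D f < +oo)%E].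

Definition L2v (mu : {measure set (mspace3 R) -> \bar R}) (D : set (space3 R))
    (u : cfield R) : Prop :=
  forall i, L2 mu D (fun x => u x 0 i).

(* Smooth functions and classical differential operators. *)

Definition pd (i : 'I_3) (phi : space3 R -> R) : space3 R -> R :=
  fun x => 'D_(basis i) phi x.

Definition smooth (phi : space3 R -> R) : Prop :=
  forall s : seq 'I_3, let psi := foldr pd phi s in
    continuous psi /\ forall i x, derivable psi x (basis i).

Definition smoothv (psi : space3 R -> 'rV[R]_3) : Prop :=
  forall i, smooth (fun x => psi x 0 i).

Definition supported_in (V : nmodType) (Omega : set (space3 R))
    (phi : space3 R -> V) : Prop :=
  exists K : set (space3 R),
    [/\ compact K, K `<=` Omega & forall x, ~ K x -> phi x = 0].

Definition grad_cl (phi : space3 R -> R) (x : space3 R) : 'rV[R]_3 :=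
  \row_i pd i phi x.

Definition curl_cl (psi : space3 R -> 'rV[R]_3) (x : space3 R) : 'rV[R]_3 :=
  \row_i (pd (i + 1) (fun y => psi y 0 (i + 2)) x
          - pd (i + 2) (fun y => psi y 0 (i + 1)) x).

Definition pdv (i : 'I_3) (psi : space3 R -> 'rV[R]_3) (x : space3 R) : 'rV[R]_3 :=
  \row_j pd i (fun y => psi y 0 j) x.

Definition complexify (psi1 psi2 : space3 R -> 'rV[R]_3) : cfield R :=
  fun x => toC (psi1 x) + 'i%C *: toC (psi2 x).

(* Domains with C^{1,1} boundary. *)

Definition bdry (Omega : set (space3 R)) : set (space3 R) :=
  closure Omega `\` Omega°.

(* Local coordinates: origin ctr, axes frame, and the boundary as the graph of
   gfun over the square of half-side rad, inside a box of half-height hgt. *)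
Record chart := Chart {
  ctr : space3 R;
  frame : 'I_3 -> space3 R;
  rad : R;
  hgt : R;
  gfun : R * R -> R }.

Definition chart_pt (k : chart) (y : R * R) (z : R) : space3 R :=
  ctr k + y.1 *: frame k 0 + y.2 *: frame k 1 + z *: frame k 2.

Definition square (k : chart) : set (R * R) := [set y | `|y| < rad k].

Definition box (k : chart) : set (space3 R) :=
  [set x | exists y z, [/\ square k y, `|z| < hgt k & x = chart_pt k y z]].

Definition dg1 (k : chart) (y : R * R) : R := 'D_((1, 0) : R * R) (gfun k) y.
Definition dg2 (k : chart) (y : R * R) : R := 'D_((0, 1) : R * R) (gfun k) y.

Definition area_elt (k : chart) (y : R * R) : R :=
  Num.sqrt (1 + dg1 k y ^+ 2 + dg2 k y ^+ 2).

Definition C11_chart (Omega : set (space3 R)) (k : chart) : Prop :=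
  [/\ 0 < rad k /\ 0 < hgt k,
      forall i j, dot (vec (frame k i)) (vec (frame k j)) = (i == j)%:R,
      [/\ forall y, square k y ->
            derivable (gfun k) y (1, 0) /\ derivable (gfun k) y (0, 1),
          [lipschitz dg1 k y | y in square k] &
          [lipschitz dg2 k y | y in square k]],
      forall y, square k y -> `|gfun k y| < hgt k &
      forall y z, square k y -> `|z| < hgt k ->
        Omega (chart_pt k y z) <-> z < gfun k y].

Definition C11_boundary (Omega : set (space3 R)) : Prop :=
  forall p, bdry Omega p -> exists k, ctr k = p /\ C11_chart Omega k.

(* These two conditions determine the measure uniquely. *)
Definition is_surface_measure (Omega : set (space3 R))
    (sigma : {measure set (mspace3 R) -> \bar R}) : Prop :=
  sigma (~` bdry Omega) = 0%E /\
  forall k, C11_chart Omega k ->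
  forall A : set (mspace3 R), measurable A -> A `<=` box k ->
    sigma A = (\int[leb2]_(y in square k `&`
                           [set y | A (chart_pt k y (gfun k y))])
                 (area_elt k y)%:E)%E.

(* Omega lies below the graph, so the outer normal points upwards. *)
Definition is_outer_normal (Omega : set (space3 R))
    (nu : space3 R -> 'rV[R]_3) : Prop :=
  forall k, C11_chart Omega k -> forall y, square k y ->
    nu (chart_pt k y (gfun k y)) =
    vec ((area_elt k y)^-1 *:
           (frame k 2 - dg1 k y *: frame k 0 - dg2 k y *: frame k 1)).

End Basics.

Section WeakOperators.
Context {R : realType} (Omega : set (space3 R)).
Implicit Types (u w : cfield R) (d : space3 R -> R[i]).

Local Notation int_Omega := (cint leb3 Omega).

Definition weak_curl u w : Prop :=
  forall psi : space3 R -> 'rV[R]_3, smoothv psi -> supported_in Omega psi ->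
    int_Omega (fun x => dot (w x) (toC (psi x))) =
    int_Omega (fun x => dot (u x) (toC (curl_cl psi x))).

Definition weak_div u d : Prop :=
  forall phi : space3 R -> R, smooth phi -> supported_in Omega phi ->
    int_Omega (fun x => d x * (phi x)%:C%C) =
    - int_Omega (fun x => dot (u x) (toC (grad_cl phi x))).

Definition weak_pd (i : 'I_3) u w : Prop :=
  forall phi : space3 R -> R, smooth phi -> supported_in Omega phi -> forall j,
    int_Omega (fun x => w x 0 j * (phi x)%:C%C) =
    - int_Omega (fun x => u x 0 j * (pd i phi x)%:C%C).

(* The weak curl and divergence are unique up to null sets; the value is 0 when
   they do not exist in L^2. *)
Definition curl u : cfield R :=
  xget 0 [set w | L2v leb3 Omega w /\ weak_curl u w].

Definition div u : space3 R -> R[i] :=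
  xget 0 [set d | L2 leb3 Omega d /\ weak_div u d].

(* nu . u = 0 on the boundary, for u and div u in L^2, in the sense of the
   normal trace in H^{-1/2}, i.e. through Green's formula against
   C^infty(closure Omega). *)
Definition normal_trace0 u : Prop :=
  forall phi : space3 R -> R, smooth phi ->
    int_Omega (fun x => dot (u x) (toC (grad_cl phi x))) +
    int_Omega (fun x => div u x * (phi x)%:C%C) = 0.

Definition XT u : Prop :=
  [/\ L2v leb3 Omega u,
      exists w, L2v leb3 Omega w /\ weak_curl u w,
      exists d, L2 leb3 Omega d /\ weak_div u d &
      normal_trace0 u].

Definition sqXT u : \bar R :=
  (sqL2v leb3 Omega u + sqL2v leb3 Omega (curl u) + sqL2 leb3 Omega (div u))%E.

(* Closure of the complex test fields psi1 + i psi2 in the H^1 norm. *)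
Definition H10 u : Prop :=
  L2v leb3 Omega u /\
  exists G : 'I_3 -> cfield R,
    (forall i, L2v leb3 Omega (G i) /\ weak_pd i u (G i)) /\
    forall e : R, 0 < e ->
    exists psi1 psi2 : space3 R -> 'rV[R]_3,
      [/\ smoothv psi1 /\ supported_in Omega psi1,
          smoothv psi2 /\ supported_in Omega psi2 &
          (sqL2v leb3 Omega (u - complexify psi1 psi2)%R
           + \sum_i sqL2v leb3 Omega
               (G i - complexify (pdv i psi1) (pdv i psi2))%R < e%:E)%E].

Definition A1 (theta : R) : \bar R :=
  ereal_inf
    [set ((fine (sqL2v leb3 Omega (curl u))
           + theta * fine (sqL2 leb3 Omega (div u)))
          / fine (sqL2v leb3 Omega u))%:E
    | u in [set u | H10 u /\ sqL2v leb3 Omega u != 0%E]].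

(* a(u, phi), without complex conjugation *)
Definition form_a (alpha theta : R) u (phi : cfield R) : R[i] :=
  int_Omega (fun x => dot (curl u x) (curl phi x))
  - alpha%:C%C * int_Omega (fun x => dot (u x) (phi x))
  + theta%:C%C * int_Omega (fun x => div u x * div phi x).

End WeakOperators.

Section Steklov.
Context {R : realType} (Omega : set (space3 R)).
Context (nu : space3 R -> 'rV[R]_3) (sigma : {measure set (mspace3 R) -> \bar R}).
Implicit Types (u v f g : cfield R).

Definition TL2 g : Prop :=
  L2v sigma (bdry Omega) g /\
  {ae sigma, forall x, bdry Omega x -> dot (toC (nu x)) (g x) = 0}.

(* The tangential components trace nu x (u x nu) of u with u, curl u in L^2: the
   g in TL^2 for which nu x g is the tangential trace nu x u, the latter being
   given by Green's formula for the curl (as for traces of H(curl)).  For u in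
   X_T this is the usual trace, since nu . u = 0. *)
Definition is_tangential_trace u g : Prop :=
  TL2 g /\
  forall psi : space3 R -> 'rV[R]_3, smoothv psi ->
    cint leb3 Omega (fun x => dot (curl Omega u x) (toC (psi x)))
    - cint leb3 Omega (fun x => dot (u x) (toC (curl_cl psi x)))
    = cint sigma (bdry Omega)
        (fun x => dot (cross (toC (nu x)) (g x)) (toC (psi x))).

Definition pi_T u : cfield R := xget 0 [set g | is_tangential_trace u g].

Definition int_Gamma f g : R[i] :=
  cint sigma (bdry Omega) (fun x => dot (f x) (g x)).

Definition inner (alpha theta eta : R) u v : R[i] :=
  form_a Omega alpha theta u (conj_field v)
  + eta%:C%C * int_Gamma (pi_T u) (pi_T (conj_field v)).

Definition coercive_XT (alpha theta eta : R) : Prop :=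
  exists2 k : R, 0 < k &
    forall u, XT Omega u ->
      (k%:E * sqXT Omega u <= (complex.Re (inner alpha theta eta u u))%:E)%E.

Definition calH (alpha theta eta : R) u : Prop :=
  XT Omega u /\ forall v, H10 Omega v -> inner alpha theta eta u v = 0.

Definition steklov_eigenfunction (alpha theta lambda : R) u : Prop :=
  [/\ XT Omega u, sqL2v leb3 Omega u != 0%E &
      forall phi, XT Omega phi ->
        form_a Omega alpha theta u phi
        = - (lambda%:C%C * int_Gamma (pi_T u) (pi_T phi))].

Definition steklov_spectrum (alpha theta : R) : set R :=
  [set lambda | exists u, steklov_eigenfunction alpha theta lambda u].

(* The indices start from 0. *)
Record steklov_system (alpha theta eta : R) (lambda : nat -> R)
    (uO : nat -> cfield R) : Prop := {
  steklov_range : range lambda = steklov_spectrum alpha theta;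
  (* repetition according to (finite) multiplicity *)
  steklov_mult : forall l v, steklov_eigenfunction alpha theta l v ->
    exists N (a : nat -> R[i]),
      sqL2v leb3 Omega (v - \sum_(n < N | lambda n == l) a n *: uO n) = 0%E;
  steklov_lt : forall n, lambda n < eta;
  steklov_ninfty : lambda n @[n --> \oo] --> -oo;
  steklov_eig : forall n, steklov_eigenfunction alpha theta (lambda n) (uO n);
  steklov_calH : forall n, calH alpha theta eta (uO n);
  steklov_orthonormal : forall n m,
    inner alpha theta eta (uO n) (uO m) = (n == m)%:R;
  steklov_total : forall v, calH alpha theta eta v -> forall e : R, 0 < e ->
    exists N (a : nat -> R[i]),
      let r := v - \sum_(n < N) a n *: uO n in
      complex.Re (inner alpha theta eta r r) < e }.

Definition uGamma (eta : R) (lambda : nat -> R) (uO : nat -> cfield R) (n : nat)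
    : cfield R :=
  (Num.sqrt `|lambda n - eta|)%:C%C *: pi_T (uO n).

(* The weak form of curl curl u - alpha u - theta grad div u = 0 in Omega,
   nu x curl u = f on the boundary. *)
Definition weak_solution (alpha theta : R) f u : Prop :=
  XT Omega u /\
  forall phi, XT Omega phi ->
    form_a Omega alpha theta u phi = - int_Gamma f (pi_T phi).

(* nu x u = nu x pi_T u on the boundary. *)
Definition calderon (alpha theta : R) f : cfield R :=
  fun x => cross (toC (nu x))
    (pi_T (xget 0 [set u | weak_solution alpha theta f u]) x).

(* u is the sum of the series w_0 + w_1 + ... in X_T(Omega), resp. in L^2 of
   the boundary. *)
Definition XT_sum (w : nat -> cfield R) u : Prop :=
  sqXT Omega (u - \sum_(n < N) w n) @[N --> \oo] --> 0%E.

Definition bdry_sum (w : nat -> cfield R) g : Prop :=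
  sqL2v sigma (bdry Omega) (g - \sum_(n < N) w n) @[N --> \oo] --> 0%E.

Definition ell2 (c : nat -> R[i]) : Prop :=
  (\sum_(0 <= n <oo) (absq (c n))%:E < +oo)%E.

End Steklov.

(* Main.v *)
(* The coefficients of the expansion make the eigenvalue equations
   a(u_n, phi) = - lambda_n <u_n, phi> on the boundary add up to
   a(u, phi) = - <f, phi>, so everything reduces to convergence of the series.
   Orthonormality with respect to the coercive form turns its tails into tails of
   sum |c_n|^2, since the factors (eta - lambda_n) / lambda_n^2 are bounded, and
   the traces are controlled in the same way by the orthonormality of the
   u_n^Gamma on the boundary.  Two solutions differ by a Steklov eigenfunction for
   the eigenvalue 0, hence agree.  No trace theorem is needed: the
   eigenfunctions have a tangential trace because their norm is 1, and having
   trace g passes to linear combinations and to joint L2-limits of field,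
   curl, div and g.  The uniqueness of weak curls, weak divergences and traces
   rests on the fundamental lemma of the calculus of variations, applied to the
   Lebesgue measure on the domain and to the surface measure, which is finite by
   compactness of the boundary. *)
Require Import Defs.
From mathcomp Require Import finmap.
From mathcomp Require Import all_boot all_order all_algebra.
From mathcomp Require Import complex.
From mathcomp Require Import all_classical all_reals all_analysis.
From mathcomp Require Import measurable_realfun ring lra.

Set Implicit Arguments.
Unset Strict Implicit.
Unset Printing Implicit Defensive.

Import Order.TTheory GRing.Theory Num.Theory.
Import numFieldNormedType.Exports.

Local Open Scope classical_set_scope.
Local Open Scope ring_scope.

(** The coefficients are forced: if u is the sum of a_n u_n, the eigenvalue equations make a(u, phi)
    minus the sum of a_n lambda_n times the pairing of pi_T u_n with pi_T phi, and matching this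
    with f requires a_n lambda_n = c_n sqrt |lambda_n - eta|. The obstacle that shapes the proof is
    that fields are functions and not classes. [curl], [div] and [pi_T] are selected among
    candidates that agree almost everywhere, with default 0 if there is none, so none of them is
    linear as a map. The argument is carried instead by the relations [XTw] and [Tr] between a field
    and explicit representatives: their defining identities pair with fixed test fields, which makes
    them linear, closed and stable under conjugation. The selected values enter only through
    uniqueness up to null sets. Conjugation has to be followed because [form_a] is bilinear while
    [inner] is sesquilinear. All estimates concern squared seminorms, with |x + y|^2 <= 2 |x|^2 + 2
    |y|^2 as triangle inequality; numerical constants such as 4, 5 and 20 below are the price of
    this and mean nothing more. *)

Section ComplexParts.
Context {R : realType}.
Implicit Types (x y : R[i]) (r : R).

Lemma ReD x y : complex.Re (x + y) = complex.Re x + complex.Re y.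
Proof. by case: x; case: y. Qed.

Lemma ImD x y : complex.Im (x + y) = complex.Im x + complex.Im y.
Proof. by case: x; case: y. Qed.

Lemma ReN x : complex.Re (- x) = - complex.Re x.
Proof. by case: x. Qed.

Lemma ImN x : complex.Im (- x) = - complex.Im x.
Proof. by case: x. Qed.

Lemma ReM x y : complex.Re (x * y) =
  complex.Re x * complex.Re y - complex.Im x * complex.Im y.
Proof. by case: x; case: y. Qed.

Lemma ImM x y : complex.Im (x * y) =
  complex.Re x * complex.Im y + complex.Im x * complex.Re y.
Proof. by case: x => a b; case: y => a' b'; rewrite /= [b * a']mulrC. Qed.

Lemma ReConj x : complex.Re (conjc x) = complex.Re x.
Proof. by case: x. Qed.

Lemma ImConj x : complex.Im (conjc x) = - complex.Im x.
Proof. by case: x. Qed.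

Lemma complexP x y :
  complex.Re x = complex.Re y -> complex.Im x = complex.Im y -> x = y.
Proof. by case: x => a b; case: y => a' b' /= -> ->. Qed.

Lemma absq_ge0 x : 0 <= absq x.
Proof. by rewrite /absq addr_ge0 ?sqr_ge0. Qed.

Lemma absq0 : absq (0 : R[i]) = 0.
Proof. by rewrite /absq /= expr0n addr0. Qed.

Lemma absq_eq0 x : absq x = 0 -> x = 0.
Proof.
move/eqP; rewrite /absq paddr_eq0 ?sqr_ge0// !sqrf_eq0 => /andP[/eqP a /eqP b].
exact: complexP.
Qed.

Lemma absqM x y : absq (x * y) = absq x * absq y.
Proof. by rewrite /absq ReM ImM; ring. Qed.

Lemma absqN x : absq (- x) = absq x.
Proof. by rewrite /absq ReN ImN !sqrrN. Qed.

(** This takes the place of the triangle inequality and avoids square roots; it amounts to |x - y|^2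
    >= 0. *)
Lemma absqD_le x y : absq (x + y) <= 2 * absq x + 2 * absq y.
Proof.
rewrite /absq ReD ImD.
have := sqr_ge0 (complex.Re x - complex.Re y).
have := sqr_ge0 (complex.Im x - complex.Im y).
by nra.
Qed.

Lemma absq_real r : absq r%:C%C = r ^+ 2.
Proof. by rewrite /absq /= expr0n addr0. Qed.

Lemma mulc_conj x : x * conjc x = (absq x)%:C%C.
Proof. by case: x => a b; apply: complexP => /=; rewrite /absq /=; ring. Qed.

Lemma absq_small_eq x y :
  (forall e : R, 0 < e -> absq (x - y) <= e) -> x = y.
Proof.
move=> h; apply/eqP; rewrite -subr_eq0; apply/eqP/absq_eq0.
apply/eqP; rewrite eq_le absq_ge0 andbT.
by apply/ler_addgt0Pl => e e0; rewrite addr0 h.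
Qed.

End ComplexParts.

(** * Real square-integrable functions and the Cauchy-Schwarz inequality *)

Section RealL2.
Context d {T : measurableType d} {R : realType}.
Variables (mu : {measure set T -> \bar R}) (D : set T).
Hypothesis mD : measurable D.
Implicit Types f g : T -> R.

(** Measurability of [f] is a separate clause because integrability of the square only gives that of
    f^2. *)
Definition sqi f := measurable_fun D f /\
  mu.-integrable D (fun x => (f x ^+ 2)%:E).

Lemma sqi_mul f g : sqi f -> sqi g -> mu.-integrable D (fun x => (f x * g x)%:E).
Proof.
move=> [mf If] [mg Ig].
apply: (@le_integrable _ _ _ _ _ mD _ (fun x => (f x ^+ 2)%:E + (g x ^+ 2)%:E)%E).
- by apply/measurable_EFinP; exact: measurable_funM.
- move=> x _; rewrite -EFinD !abse_EFin lee_fin.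
  have h : 0 <= f x ^+ 2 + g x ^+ 2 by rewrite addr_ge0 ?sqr_ge0.
  rewrite (ger0_norm h) ler_norml.
  have := sqr_ge0 (f x - g x); have := sqr_ge0 (f x + g x).
  by nra.
- exact: integrableD.
Qed.

Lemma sqiD f g : sqi f -> sqi g -> sqi (fun x => f x + g x).
Proof.
move=> hf hg; have hfg := sqi_mul hf hg.
case: hf => mf If; case: hg => mg Ig; split; first exact: measurable_funD.
have -> : (fun x => ((f x + g x) ^+ 2)%:E) =
  ((fun x => (f x ^+ 2)%:E) \+ ((fun x => (g x ^+ 2)%:E) \+
   (fun x => 2%:E * (f x * g x)%:E)))%E.
  by apply/funext => x /=; rewrite -EFinM -!EFinD; congr EFin; ring.
by apply: integrableD => //; apply: integrableD => //; apply: integrableZl.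
Qed.

Lemma sqiZ (k : R) f : sqi f -> sqi (fun x => k * f x).
Proof.
case=> mf If; split.
  by apply: measurable_funM => //; exact: measurable_cst.
have -> : (fun x => ((k * f x) ^+ 2)%:E) = (fun x => (k ^+ 2)%:E * (f x ^+ 2)%:E)%E.
  by apply/funext => x; rewrite -EFinM exprMn.
exact: integrableZl.
Qed.

(** Cauchy-Schwarz, from the polynomial in t given by the integral of (f + t g)^2, which is
    nonnegative for every t. *)
Lemma sqr_Rintegral_mul f g : sqi f -> sqi g ->
  Rintegral mu D (fun x => f x * g x) ^+ 2 <=
  Rintegral mu D (fun x => f x ^+ 2) * Rintegral mu D (fun x => g x ^+ 2).
Proof.
move=> hf hg.
set A := Rintegral _ _ (fun x => f x ^+ 2).
set B := Rintegral _ _ (fun x => f x * g x).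
set C := Rintegral _ _ (fun x => g x ^+ 2).
have C0 : 0 <= C by apply: Rintegral_ge0 => x _; exact: sqr_ge0.
have P t : 0 <= A + 2 * t * B + t ^+ 2 * C.
  have : 0 <= Rintegral mu D (fun x => (f x + t * g x) ^+ 2).
    by apply: Rintegral_ge0 => x _; exact: sqr_ge0.
  rewrite (_ : Rintegral _ _ _ = A + 2 * t * B + t ^+ 2 * C)//.
  rewrite -!RintegralZl//; [|by case: hg|exact: sqi_mul].
  have hfg : mu.-integrable D (EFin \o (fun x => 2 * t * (f x * g x))).
    have := integrableZl mD (2 * t) (sqi_mul hf hg).
    by apply: eq_integrable => // x _ /=; rewrite -EFinM.
  have hgg : mu.-integrable D (EFin \o (fun x => t ^+ 2 * g x ^+ 2)).
    have := integrableZl mD (t ^+ 2) hg.2.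
    by apply: eq_integrable => // x _ /=; rewrite -EFinM.
  rewrite -RintegralD//; last by case: hf.
  rewrite -RintegralD//; last first.
    by have := integrableD mD hf.2 hfg; apply: eq_integrable.
  by apply: eq_Rintegral => x _; ring.
have [C_0|C_gt0] := eqVneq C 0.
  rewrite C_0 mulr0; have [->|Bn0] := eqVneq B 0; first by rewrite expr0n.
  (* For C = 0 the polynomial is affine; if B were nonzero, this t would give it the value -1. *)
  have := P (- (A + 1) / (2 * B)).
  rewrite C_0 mulr0 addr0 (_ : _ + _ = -1); last by field.
  by rewrite ler0N1.
(* The minimum of the parabola, where its value is (A C - B^2) / C. *)
have := P (- B / C).
rewrite (_ : _ + _ = (A * C - B ^+ 2) / C); last by field.
by rewrite pmulr_lge0 ?invr_gt0 ?lt_def ?C_gt0// subr_ge0.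
Qed.

End RealL2.

(** * Square-integrable fields and their bilinear pairings *)

Section AlmostEverywhere.
Context d {T : measurableType d} {R : realType} (mu : {measure set T -> \bar R}).

Lemma aeS (P Q : T -> Prop) : (forall x, P x -> Q x) ->
  {ae mu, forall x, P x} -> {ae mu, forall x, Q x}.
Proof. by move=> PQ; apply: filterS => x; exact: PQ. Qed.

Lemma aeS2 (P Q S : T -> Prop) : (forall x, P x -> Q x -> S x) ->
  {ae mu, forall x, P x} -> {ae mu, forall x, Q x} -> {ae mu, forall x, S x}.
Proof. by move=> PQ; apply: filterS2 => x; exact: PQ. Qed.

End AlmostEverywhere.

Section ScalarL2.
Context {R : realType}.
Variables (mu : {measure set (mspace3 R) -> \bar R}) (D : set (space3 R)).
Hypothesis mD : measurable (D : set (mspace3 R)).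
Implicit Types (f g h : space3 R -> R[i]) (a : R[i]).

Local Notation nsq f := (fine (sqL2 mu D f)).

Definition cintegrable f :=
  mu.-integrable (D : set (mspace3 R)) (fun x => (complex.Re (f x))%:E) /\
  mu.-integrable (D : set (mspace3 R)) (fun x => (complex.Im (f x))%:E).

Lemma cintD f g : cintegrable f -> cintegrable g ->
  cint mu D (fun x => f x + g x) = cint mu D f + cint mu D g.
Proof.
move=> [f1 f2] [g1 g2]; apply: complexP; rewrite /cint /=.
  by rewrite -RintegralD//; apply: eq_Rintegral => x _; rewrite ReD.
by rewrite -RintegralD//; apply: eq_Rintegral => x _; rewrite ImD.
Qed.

Lemma integrableZ_fin (k : R) (r : mspace3 R -> R) :
  mu.-integrable (D : set (mspace3 R)) (EFin \o r) ->
  mu.-integrable (D : set (mspace3 R)) (EFin \o (fun x => k * r x)).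
Proof. by move=> h; have := integrableZl mD k h; apply: eq_integrable. Qed.

Lemma cintegrableD f g : cintegrable f -> cintegrable g ->
  cintegrable (fun x => f x + g x).
Proof.
move=> [f1 f2] [g1 g2]; split.
  by have := integrableD mD f1 g1; apply: eq_integrable => // x _ /=; rewrite ReD.
by have := integrableD mD f2 g2; apply: eq_integrable => // x _ /=; rewrite ImD.
Qed.

Lemma cintZ a f : cintegrable f ->
  cint mu D (fun x => a * f x) = a * cint mu D f.
Proof.
move=> [f1 f2]; apply: complexP; rewrite /cint ?ReM ?ImM /=.
  rewrite -!RintegralZl// -RintegralB//; try exact: integrableZ_fin.
  by apply: eq_Rintegral => x _; rewrite ReM.
rewrite -!RintegralZl// -RintegralD//; try exact: integrableZ_fin.
by apply: eq_Rintegral => x _; rewrite ImM.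
Qed.

Lemma cint_conj f : cintegrable f ->
  cint mu D (fun x => conjc (f x)) = conjc (cint mu D f).
Proof.
move=> [f1 f2]; apply: complexP; rewrite ?ReConj ?ImConj /cint /=.
  by apply: eq_Rintegral => x _; rewrite ReConj.
rewrite -mulN1r -RintegralZl//; apply: eq_Rintegral => x _.
by rewrite ImConj mulN1r.
Qed.

Lemma eq_cint f g : (forall x, D x -> f x = g x) -> cint mu D f = cint mu D g.
Proof.
move=> fg; rewrite /cint; congr Complex; apply: eq_Rintegral => x;
  by rewrite inE => /fg ->.
Qed.

Lemma L2P f : L2 mu D f <->
  sqi mu D (fun x => complex.Re (f x)) /\ sqi mu D (fun x => complex.Im (f x)).
Proof.
split=> [[m1 m2 fin]|[[m1 i1] [m2 i2]]]; last first.
  split=> //; have := integrable_lty mD (integrableD mD i1 i2).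
  by congr (_ < _)%E; apply: eq_integral => x _.
have I : mu.-integrable (D : set (mspace3 R)) (fun x => (absq (f x))%:E).
  apply/integrableP; split.
    by apply/measurable_EFinP; apply: measurable_funD; apply: measurable_funX.
  move: fin; congr (_ < _)%E; apply: eq_integral => x _.
  by rewrite /= ger0_norm// absq_ge0.
split; split=> //; apply: (le_integrable mD) I.
- by apply/measurable_EFinP; exact: measurable_funX.
- move=> x _; rewrite !abse_EFin lee_fin !ger0_norm ?absq_ge0 ?sqr_ge0//.
  by rewrite /absq lerDl sqr_ge0.
- by apply/measurable_EFinP; exact: measurable_funX.
- move=> x _; rewrite !abse_EFin lee_fin !ger0_norm ?absq_ge0 ?sqr_ge0//.
  by rewrite /absq lerDr sqr_ge0.
Qed.

Lemma L2D f g : L2 mu D f -> L2 mu D g -> L2 mu D (fun x => f x + g x).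
Proof.
move=> /L2P[f1 f2] /L2P[g1 g2]; apply/L2P; split.
  under eq_fun do rewrite ReD; exact: sqiD.
under eq_fun do rewrite ImD; exact: sqiD.
Qed.

Lemma L2Z a f : L2 mu D f -> L2 mu D (fun x => a * f x).
Proof.
move=> /L2P[f1 f2]; apply/L2P; split.
  under eq_fun do rewrite ReM -mulNr.
  by apply: sqiD => //; exact: sqiZ.
under eq_fun do rewrite ImM.
by apply: sqiD => //; exact: sqiZ.
Qed.

Lemma L2_0 : L2 mu D (fun=> 0).
Proof.
split; [exact: measurable_cst|exact: measurable_cst|].
by rewrite /sqL2 integral0_eq// => x _; rewrite absq0.
Qed.

Lemma L2N f : L2 mu D f -> L2 mu D (fun x => - f x).
Proof.
move=> hf; have := L2Z (-1) hf; congr (L2 _ _ _).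
by apply/funext => x; rewrite mulN1r.
Qed.

Lemma L2B f g : L2 mu D f -> L2 mu D g -> L2 mu D (fun x => f x - g x).
Proof. by move=> hf hg; apply: L2D => //; exact: L2N. Qed.

Lemma L2_conj f : L2 mu D f -> L2 mu D (fun x => conjc (f x)).
Proof.
move=> /L2P[f1 f2]; apply/L2P; split.
  by under eq_fun do rewrite ReConj.
under eq_fun do rewrite ImConj -mulN1r; exact: sqiZ.
Qed.

Lemma sqL2E f : L2 mu D f -> sqL2 mu D f =
  (Rintegral mu D (fun x => complex.Re (f x) ^+ 2) +
   Rintegral mu D (fun x => complex.Im (f x) ^+ 2))%:E.
Proof.
move=> /L2P[[m1 i1] [m2 i2]]; rewrite -RintegralD//.
rewrite /Rintegral fineK//; apply: integrable_fin_num => //.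
by have := integrableD mD i1 i2; apply: eq_integrable.
Qed.

Lemma sqL2_ge0 f : (0 <= sqL2 mu D f)%E.
Proof. by apply: integral_ge0 => x _; rewrite lee_fin absq_ge0. Qed.

Lemma sqL2_fineK f : L2 mu D f -> sqL2 mu D f = (nsq f)%:E.
Proof. by move=> hf; rewrite sqL2E. Qed.

Lemma measurable_absq f : L2 mu D f ->
  measurable_fun (D : set (mspace3 R)) (fun x => (absq (f x))%:E).
Proof.
case=> m1 m2 _; apply/measurable_EFinP.
by apply: measurable_funD; apply: measurable_funX.
Qed.

Lemma L2_mul f g : L2 mu D f -> L2 mu D g -> cintegrable (fun x => f x * g x).
Proof.
move=> /L2P[f1 f2] /L2P[g1 g2]; split.
  have := integrableB mD (sqi_mul mD f1 g1) (sqi_mul mD f2 g2).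
  by apply: eq_integrable => // x _ /=; rewrite ReM EFinB.
have := integrableD mD (sqi_mul mD f1 g2) (sqi_mul mD f2 g1).
by apply: eq_integrable => // x _ /=; rewrite ImM EFinD.
Qed.

Lemma absq_cint_mul_le f g : L2 mu D f -> L2 mu D g ->
  absq (cint mu D (fun x => f x * g x)) <= 2 * nsq f * nsq g.
Proof.
move=> hf hg; rewrite (sqL2E hf) (sqL2E hg) /=.
move: hf hg => /L2P[f1 f2] /L2P[g1 g2].
rewrite /absq /cint /=.
under eq_Rintegral do rewrite ReM.
under [X in _ + X ^+ 2]eq_Rintegral do rewrite ImM.
rewrite RintegralB ?RintegralD//; try exact: sqi_mul.
(* Cauchy-Schwarz holds for each of the four products of real and imaginary parts, and the four
   bounds add up to (a + b)(c + e). The factor 2 comes from (r - s)^2 <= 2 r^2 + 2 s^2 and its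
   analogue for p + q. *)
have aux (a b c e p q r s : R) : r ^+ 2 <= a * c -> s ^+ 2 <= b * e ->
    p ^+ 2 <= a * e -> q ^+ 2 <= b * c ->
    (r - s) ^+ 2 + (p + q) ^+ 2 <= 2 * (a + b) * (c + e).
  by have := sqr_ge0 (r + s); have := sqr_ge0 (p - q); nra.
exact: aux (sqr_Rintegral_mul mD f1 g1) (sqr_Rintegral_mul mD f2 g2)
  (sqr_Rintegral_mul mD f1 g2) (sqr_Rintegral_mul mD f2 g1).
Qed.

Lemma sqL2D_le f g : L2 mu D f -> L2 mu D g ->
  nsq (fun x => f x + g x) <= 2 * nsq f + 2 * nsq g.
Proof.
move=> hf hg; have hfg := L2D hf hg.
rewrite -lee_fin EFinD !EFinM -!sqL2_fineK// /sqL2.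
rewrite -!ge0_integralZl_EFin//; try (exact: measurable_absq);
  try (by move=> x _; rewrite lee_fin absq_ge0).
rewrite -ge0_integralD//.
- apply: ge0_le_integral => //.
  + by move=> x _; rewrite lee_fin absq_ge0.
  + exact: measurable_absq.
  + apply: emeasurable_funD; apply: measurable_funeM; exact: measurable_absq.
  + by move=> x _; rewrite -!EFinM -EFinD lee_fin absqD_le.
- by move=> x _; rewrite -EFinM lee_fin mulr_ge0// absq_ge0.
- by apply: measurable_funeM; exact: measurable_absq.
- by move=> x _; rewrite -EFinM lee_fin mulr_ge0// absq_ge0.
- by apply: measurable_funeM; exact: measurable_absq.
Qed.

Lemma sqL2N f : sqL2 mu D (fun x => - f x) = sqL2 mu D f.
Proof. by apply: eq_integral => x _; rewrite absqN. Qed.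

Lemma sqL2_ae0 f : L2 mu D f ->
  sqL2 mu D f = 0%E <-> {ae mu, forall x, D x -> f x = 0}.
Proof.
move=> hf; have := ae_eq_integral_abs mu mD (measurable_absq hf).
have -> : (\int[mu]_(x in D) `|(absq (f x))%:E|)%E = sqL2 mu D f.
  by apply: eq_integral => x _; rewrite abse_EFin ger0_norm ?absq_ge0.
case=> h1 h2; split=> [/h1|h].
  by apply: aeS => x /= h Dx; apply: absq_eq0; case: (h Dx).
by apply: h2; apply: aeS h => x /= h Dx; rewrite h// absq0.
Qed.

Lemma cint_mulC f g : cint mu D (fun x => f x * g x) = cint mu D (fun x => g x * f x).
Proof. by apply: eq_cint => x _; rewrite mulrC. Qed.

Lemma cint_mulDl f g h : L2 mu D f -> L2 mu D g -> L2 mu D h ->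
  cint mu D (fun x => (f x + g x) * h x) =
  cint mu D (fun x => f x * h x) + cint mu D (fun x => g x * h x).
Proof.
move=> hf hg hh; rewrite -cintD; [|exact: L2_mul..].
by apply: eq_cint => x _; rewrite mulrDl.
Qed.

Lemma cint_mulZl a f h : L2 mu D f -> L2 mu D h ->
  cint mu D (fun x => (a * f x) * h x) = a * cint mu D (fun x => f x * h x).
Proof.
move=> hf hh; rewrite -cintZ; last exact: L2_mul.
by apply: eq_cint => x _; rewrite mulrA.
Qed.

End ScalarL2.

Section VectorL2.
Context {R : realType}.
Variables (mu : {measure set (mspace3 R) -> \bar R}) (D : set (space3 R)).
Hypothesis mD : measurable (D : set (mspace3 R)).
Implicit Types (u v w : cfield R) (a : R[i]).

Local Notation nsq f := (fine (sqL2 mu D f)).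
Local Notation nsqv f := (fine (sqL2v mu D f)).
Local Notation pair u v := (cint mu D (fun x => dot (u x) (v x))).

Lemma sqL2v_ge0 u : (0 <= sqL2v mu D u)%E.
Proof.
by apply: integral_ge0 => x _; rewrite lee_fin sumr_ge0// => i _; exact: absq_ge0.
Qed.

Lemma sqL2vE u : L2v mu D u ->
  sqL2v mu D u = (\sum_i sqL2 mu D (fun x => u x 0%R i))%E.
Proof.
move=> hu; rewrite /sqL2v.
under eq_integral do rewrite -sumEFin.
rewrite ge0_integral_sum// => [i|i x _]; first exact: measurable_absq.
by rewrite lee_fin absq_ge0.
Qed.

Lemma sqL2v_fin u : L2v mu D u -> sqL2v mu D u = (\sum_i nsq (fun x => u x 0 i))%:E.
Proof.
move=> hu; rewrite sqL2vE// -sumEFin; apply: eq_bigr => i _.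
by rewrite -sqL2_fineK.
Qed.

Lemma sqL2v_fineK u : L2v mu D u -> sqL2v mu D u = (nsqv u)%:E.
Proof. by move=> /sqL2v_fin ->. Qed.

Lemma nsqvE u : L2v mu D u -> nsqv u = \sum_i nsq (fun x => u x 0 i).
Proof. by move=> /sqL2v_fin ->. Qed.

Lemma L2vD u v : L2v mu D u -> L2v mu D v -> L2v mu D (u + v).
Proof.
move=> hu hv i; have := L2D mD (hu i) (hv i); congr (L2 _ _ _).
by apply/funext => x; rewrite mxE.
Qed.

Lemma L2vZ a u : L2v mu D u -> L2v mu D (a *: u).
Proof.
move=> hu i; have := L2Z mD a (hu i); congr (L2 _ _ _).
by apply/funext => x; rewrite mxE.
Qed.

Lemma L2v0 : L2v mu D 0.
Proof.
move=> i; have := L2_0 mu D; congr (L2 _ _ _).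
by apply/funext => x; rewrite mxE.
Qed.

Lemma L2vN u : L2v mu D u -> L2v mu D (- u).
Proof. by move=> hu; rewrite -scaleN1r; exact: L2vZ. Qed.

Lemma L2vB u v : L2v mu D u -> L2v mu D v -> L2v mu D (u - v).
Proof. by move=> hu hv; apply: L2vD => //; exact: L2vN. Qed.

Lemma L2v_conj u : L2v mu D u -> L2v mu D (conj_field u).
Proof.
move=> hu i; have := L2_conj mD (hu i); congr (L2 _ _ _).
by apply/funext => x; rewrite mxE.
Qed.

Lemma nsqvD_le u v : L2v mu D u -> L2v mu D v ->
  nsqv (u + v) <= 2 * nsqv u + 2 * nsqv v.
Proof.
move=> hu hv; rewrite !nsqvE//; last exact: L2vD.
rewrite !mulr_sumr -big_split/=; apply: ler_sum => i _.
have := sqL2D_le mD (hu i) (hv i); congr (_ <= _); congr fine.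
by apply: eq_integral => x _; rewrite mxE.
Qed.

Lemma sqL2vN u : sqL2v mu D (- u) = sqL2v mu D u.
Proof.
apply: eq_integral => x _; congr EFin; apply: eq_bigr => i _.
by rewrite mxE absqN.
Qed.

Lemma sqL2vBC u v : sqL2v mu D (u - v) = sqL2v mu D (v - u).
Proof. by rewrite -sqL2vN opprB. Qed.

Lemma cint_sum (F : 'I_3 -> space3 R -> R[i]) :
  (forall i, cintegrable mu D (F i)) ->
  cintegrable mu D (fun x => \sum_i F i x) /\
  cint mu D (fun x => \sum_i F i x) = \sum_i cint mu D (F i).
Proof.
move=> hF.
have -> : (fun x => \sum_i F i x) = (fun x => F 0 x + (F 1 x + F 2 x)).
  apply/funext => x; rewrite !big_ord_recl big_ord0 addr0.
  by congr (F _ x + (F _ x + F _ x)); apply: val_inj.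
have -> : \sum_i cint mu D (F i) =
    cint mu D (F 0) + (cint mu D (F 1) + cint mu D (F 2)).
  rewrite !big_ord_recl big_ord0 addr0.
  by congr (cint _ _ (F _) + (cint _ _ (F _) + cint _ _ (F _))); apply: val_inj.
have h12 : cintegrable mu D (fun x => F 1 x + F 2 x) by apply: cintegrableD.
by split; [exact: cintegrableD|rewrite !cintD].
Qed.

Lemma cintegrable_pair u v : L2v mu D u -> L2v mu D v ->
  cintegrable mu D (fun x => dot (u x) (v x)).
Proof.
move=> hu hv; have [] := @cint_sum (fun i x => u x 0 i * v x 0 i) => //.
by move=> i; exact: L2_mul.
Qed.

Lemma pairE u v : L2v mu D u -> L2v mu D v ->
  pair u v = \sum_i cint mu D (fun x => u x 0 i * v x 0 i).
Proof.
move=> hu hv; have [] := @cint_sum (fun i x => u x 0 i * v x 0 i) => //.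
by move=> i; exact: L2_mul.
Qed.

Lemma pairC u v : pair u v = pair v u.
Proof.
by apply: eq_cint => x _; apply: eq_bigr => i _; rewrite mulrC.
Qed.

Lemma pairDl u v w : L2v mu D u -> L2v mu D v -> L2v mu D w ->
  pair (u + v) w = pair u w + pair v w.
Proof.
move=> hu hv hw; rewrite -(cintD mD); [|exact: cintegrable_pair..].
apply: eq_cint => x _; rewrite -big_split/=; apply: eq_bigr => i _.
by rewrite mxE mulrDl.
Qed.

Lemma pairZl a u w : L2v mu D u -> L2v mu D w -> pair (a *: u) w = a * pair u w.
Proof.
move=> hu hw; rewrite -(cintZ mD); last exact: cintegrable_pair.
apply: eq_cint => x _; rewrite mulr_sumr; apply: eq_bigr => i _.
by rewrite mxE mulrA.
Qed.

Lemma pair_conj u v : L2v mu D u -> L2v mu D v ->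
  pair (conj_field u) (conj_field v) = conjc (pair u v).
Proof.
move=> hu hv; rewrite -cint_conj//; last exact: cintegrable_pair.
apply: eq_cint => x _; rewrite rmorph_sum; apply: eq_bigr => i _.
by rewrite !mxE rmorphM.
Qed.

(** Only the finiteness of the constant matters: each of the three components is at most 2 |u|^2
    |v|^2, and two uses of [absqD_le] give them the weights 2, 4 and 4. *)
Lemma absq_pair_le u v : L2v mu D u -> L2v mu D v ->
  absq (pair u v) <= 20 * nsqv u * nsqv v.
Proof.
move=> hu hv; rewrite pairE//.
have H i : absq (cint mu D (fun x => u x 0 i * v x 0 i)) <= 2 * nsqv u * nsqv v.
  apply: (le_trans (absq_cint_mul_le mD (hu i) (hv i))).
  have le1 (w : cfield R) : L2v mu D w -> nsq (fun x => w x 0 i) <= nsqv w.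
    move=> hw; rewrite nsqvE// (bigD1 i)//= lerDl sumr_ge0// => j _.
    by rewrite fine_ge0// sqL2_ge0.
  have ge (w : cfield R) : 0 <= nsq (fun x => w x 0 i).
    by rewrite fine_ge0// sqL2_ge0.
  by apply: ler_pM => //; [rewrite mulr_ge0|rewrite ler_pM2l// le1|exact: le1].
rewrite !big_ord_recl big_ord0 addr0.
set A := cint _ _ _; set B := cint _ _ _; set C := cint _ _ _.
have := absqD_le A (B + C); have := absqD_le B C.
have hA : absq A <= 2 * nsqv u * nsqv v by exact: H.
have hB : absq B <= 2 * nsqv u * nsqv v by exact: H.
have hC : absq C <= 2 * nsqv u * nsqv v by exact: H.
have hge : 0 <= 2 * nsqv u * nsqv v.
  by rewrite !mulr_ge0// fine_ge0// sqL2v_ge0.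
by lra.
Qed.

Lemma pair_self u : L2v mu D u -> pair u (conj_field u) = (nsqv u)%:C%C.
Proof.
move=> hu; rewrite pairE//; last exact: L2v_conj.
rewrite nsqvE// rmorph_sum/=; apply: eq_bigr => i _.
rewrite (_ : cint _ _ _ = cint mu D (fun x => (absq (u x 0 i))%:C%C)).
  apply: complexP; rewrite /cint/=//.
  by rewrite /Rintegral/= integral0.
by apply: eq_cint => x _; rewrite mxE mulc_conj.
Qed.

Lemma sqL2v_ae0 u : L2v mu D u ->
  sqL2v mu D u = 0%E <-> {ae mu, forall x, D x -> u x = 0}.
Proof.
move=> hu; split=> h.
  have H i : {ae mu, forall x, D x -> u x 0 i = 0}.
    apply/sqL2_ae0 => //; move: h; rewrite sqL2vE// => /eqP.
    rewrite seq_psume_eq0; last by move=> j _; exact: sqL2_ge0.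
    by move=> /allP/(_ i (mem_index_enum _))/eqP.
  (* [inord] reindexes the three components by the natural numbers, so that the exceptional sets
     form a countable family. *)
  have := ae_foralln (fun n => H (inord n)).
  apply: aeS => x /= hx Dx; apply/rowP => i; rewrite mxE.
  by have := hx i Dx; rewrite inord_val.
rewrite sqL2vE// big1// => i _; apply/sqL2_ae0 => //.
by apply: aeS h => x /= h Dx; rewrite h// mxE.
Qed.

End VectorL2.

(** * Completeness of L2 over sets of finite measure *)

Section Completeness.
Context d {T : measurableType d} {R : realType}.
Variables (mu : {measure set T -> \bar R}) (D : set T).
Hypothesis mD : measurable D.
Hypothesis finD : (mu D < +oo)%E.
Implicit Types f g : T -> R.

Local Notation I2 f := (Rintegral mu D (fun x => f x ^+ 2)).

(* On a set of finite measure, [|x| <= t x^2 + 1/t] turns the L2 bounds on the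
   increments of a fast subsequence into summable L1 bounds. *)
Lemma sqi_abs_le f (t : R) : 0 < t -> sqi mu D f ->
  (\int[mu]_(x in D) `|(f x)%:E| <= (t * I2 f + t^-1 * fine (mu D))%:E)%E.
Proof.
move=> t0 [mf If].
have -> : ((t * I2 f + t^-1 * fine (mu D))%:E =
   \int[mu]_(x in D) (t * f x ^+ 2 + t^-1)%:E)%E.
  have i1 : mu.-integrable D (EFin \o (fun x => t * f x ^+ 2)).
    by have := integrableZl mD t If; apply: eq_integrable.
  have i2 : mu.-integrable D (EFin \o (fun=> t^-1 : R)).
    apply: measurable_bounded_integrable => //.
    exact: bounded_cst.
  rewrite -RintegralZl// -Rintegral_cst// -RintegralD//.
  rewrite /Rintegral fineK//; apply: integrable_fin_num => //.
  by have := integrableD mD i1 i2; apply: eq_integrable.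
apply: ge0_le_integral => //.
- by apply: measurableT_comp => //; exact/measurable_EFinP.
- apply/measurable_EFinP; apply: measurable_funD; last exact: measurable_cst.
  by apply: measurable_funM; [exact: measurable_cst|exact: measurable_funX].
- move=> x _; rewrite abse_EFin lee_fin.
  have h : 0 <= t^-1 * (t * `|f x| - 1) ^+ 2 by rewrite mulr_ge0 ?sqr_ge0// invr_ge0 ltW.
  have e : t^-1 * (t * `|f x| - 1) ^+ 2 = t * f x ^+ 2 + t^-1 - 2 * `|f x|.
    by rewrite -(real_normK (num_real (f x))); field; rewrite gt_eqF.
  by have := normr_ge0 (f x); lra.
Qed.

Lemma geometric_sum_lty (C : R) : 0 <= C ->
  (\sum_(0 <= k <oo) (C / 2 ^+ k)%:E < +oo)%E.
Proof.
move=> C0; apply: (@le_lt_trans _ _ (2 * C)%:E); last exact: ltry.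
apply: lime_le.
  apply: is_cvg_nneseries => n _ _.
  by rewrite lee_fin divr_ge0// exprn_ge0.
apply: nearW => n; rewrite sumEFin lee_fin.
suff -> : \sum_(0 <= k < n) (C / 2 ^+ k) = 2 * C - 2 * C / 2 ^+ n.
  by rewrite lerBlDr lerDl divr_ge0// ?mulr_ge0// exprn_ge0.
elim: n => [|n IH]; first by rewrite big_nil expr0 divr1 subrr.
have h : (2 : R) ^+ n != 0 by rewrite expf_neq0.
by rewrite big_nat_recr//= IH exprS; field; rewrite h.
Qed.

Lemma summable_telescope_cvg (g : nat -> R) :
  (\sum_(0 <= k <oo) `|(g k.+1 - g k)%:E| < +oo)%E -> cvgn g.
Proof.
move=> h.
have bnd n : \sum_(0 <= k < n) `|g k.+1 - g k| <=
    fine (\sum_(0 <= k <oo) `|(g k.+1 - g k)%:E|)%E.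
  rewrite -lee_fin fineK; last by rewrite ge0_fin_numE// nneseries_ge0.
  by rewrite -sumEFin; apply: nneseries_lim_ge.
have : cvgn [normed series (telescope g)].
  have -> : [normed series (telescope g)] =
    (fun n => \sum_(0 <= k < n) `|g k.+1 - g k|) by [].
  apply: nondecreasing_is_cvgn.
    by apply/nondecreasing_seqP => n /=; rewrite big_nat_recr//= lerDl.
  by exists (fine (\sum_(0 <= k <oo) `|(g k.+1 - g k)%:E|)%E) => _ [n _ <-].
move=> /normed_cvg hc.
have -> : g = (fun n => g 0%N + series (telescope g) n).
  by apply/funext => n; exact: eq_sum_telescope.
by apply: is_cvgD => //; exact: is_cvg_cst.
Qed.

(** Riesz-Fischer: a subsequence with fast shrinking gaps converges almost everywhere, and Fatou's
    lemma turns this into L2 convergence of the whole sequence. *)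
Lemma sqi_complete (f : nat -> T -> R) : (forall n, sqi mu D (f n)) ->
  (forall e : R, 0 < e -> exists N, forall m n, (N <= m)%N -> (N <= n)%N ->
     I2 (f m - f n) <= e) ->
  exists2 g, sqi mu D g &
    forall e : R, 0 < e -> exists N, forall n, (N <= n)%N -> I2 (g - f n) <= e.
Proof.
move=> hf cauchy.
have hB m n : sqi mu D (f m - f n).
  have := sqiD mD (hf m) (sqiZ mD (-1) (hf n)); congr (sqi _ _ _).
  by apply/funext => x; rewrite mulN1r.
have p4 k : (0 : R) < (4 ^+ k)^-1 by rewrite invr_gt0 exprn_gt0.
have /choice[N0 hN0] : forall k, exists N, forall m n, (N <= m)%N -> (N <= n)%N ->
    I2 (f m - f n) <= (4 ^+ k)^-1 by move=> k; exact: cauchy.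
(* The maximum makes [phi] nondecreasing while dominating [N0 k]; the summand [j] makes it
   unbounded. *)
pose phi k := (\max_(j < k.+1) (N0 j + j))%N.
have phik k : (N0 k + k <= phi k)%N.
  exact: (leq_bigmax (F := fun j : 'I_k.+1 => (N0 j + j)%N) ord_max).
have phiN k : (N0 k <= phi k)%N by exact: leq_trans (leq_addr _ _) (phik k).
have phiS k : (phi k <= phi k.+1)%N.
  by rewrite /phi [leqRHS]big_ord_recr/= leq_maxl.
pose g k := f (phi k).
pose dg k x := `|(g k.+1 x - g k x)%:E|%E.
have mdg k : measurable_fun D (dg k).
  by apply: measurableT_comp => //; apply/measurable_EFinP; case: (hB (phi k.+1) (phi k)).
have Idg : (\int[mu]_(x in D) (\sum_(0 <= k <oo) dg k x) < +oo)%E.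
  rewrite integral_nneseries//; last by move=> k x _; exact: abse_ge0.
  apply: (@le_lt_trans _ _ (\sum_(0 <= k <oo) ((1 + fine (mu D)) / 2 ^+ k)%:E)%E).
    apply: lee_nneseries => [k _ _|k _].
    by apply: integral_ge0 => x _; exact: abse_ge0.
    (* The choice t = 2^k balances the two terms of [sqi_abs_le]: both 2^k 4^-k and 1 / t equal
       2^-k. *)
    have := @sqi_abs_le (g k.+1 - g k) (2 ^+ k) (exprn_gt0 _ _) (hB _ _).
    move=> /(_ (ltr0n _ 2)) h; apply: (le_trans h).
    rewrite lee_fin mulrDl mul1r [(fine _) * _]mulrC lerD2r.
    have := hN0 k (phi k.+1) (phi k) (leq_trans (phiN k) (phiS k)) (phiN k).
    rewrite -(ler_pM2l (x := 2 ^+ k)) ?exprn_gt0// => /le_trans; apply.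
    by rewrite (_ : 4 = 2 * 2 :> R) ?exprMn ?invfM ?mulrA ?divff ?mul1r ?expf_neq0//; ring.
  by apply: geometric_sum_lty; rewrite addr_ge0// fine_ge0.
have mS : measurable_fun D (fun x => \sum_(0 <= k <oo) dg k x)%E.
  by apply: (@ge0_emeasurable_sum _ _ _ _ dg predT) => // k x _ _; exact: abse_ge0.
have aeg : {ae mu, forall x, D x -> cvgn (fun k => g k x)}.
  have : mu.-integrable D (fun x => \sum_(0 <= k <oo) dg k x)%E.
    apply/integrableP; split=> //.
    move: Idg; congr (_ < _)%E; apply: eq_integral => x _.
    by rewrite gee0_abs//; apply: nneseries_ge0 => k _ _; exact: abse_ge0.
  move=> /(integrable_ae mD); apply: aeS => x /= h Dx.
  apply: summable_telescope_cvg.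
  have := h Dx; rewrite ge0_fin_numE//.
  by apply: nneseries_ge0 => k _ _; exact: abse_ge0.
(* An upper limit is measurable regardless of where the sequence converges; where it does converge,
   [F] is its limit. *)
pose F x := fine (limn_esup (fun k => (g k x)%:E)).
have mF : measurable_fun D F.
  apply: measurableT_comp; first exact: fine_measurable.
  by apply: measurable_fun_limn_esup => k; apply/measurable_EFinP; case: (hf (phi k)).
have FE x : cvgn (fun k => g k x) -> (fun k => g k x) @ \oo --> F x.
  move=> /cvg_ex[l hl]; suff -> : F x = l by [].
  rewrite /F; have /cvg_limn_einf_sup[_ ->] // : (fun k => (g k x)%:E) @ \oo --> l%:E.
  by apply: cvg_EFin => //; exact: nearW.
(* Fatou's lemma in k with n fixed: almost everywhere the lower limit of the squares is (F - f
   n)^2. *)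
have key n e : (exists K, forall k, (K <= k)%N -> I2 (f (phi k) - f n) <= e) ->
    (\int[mu]_(x in D) ((F x - f n x) ^+ 2)%:E <= e%:E)%E.
  case=> K hK.
  have mq k : measurable_fun D (fun x => ((g k x - f n x) ^+ 2)%:E).
    by apply/measurable_EFinP/measurable_funX; case: (hB (phi k) n).
  rewrite (_ : (\int[mu]_(x in D) ((F x - f n x) ^+ 2)%:E)%E =
     (\int[mu]_(x in D) limn_einf (fun k => ((g k x - f n x) ^+ 2)%:E))%E).
    apply: (le_trans (fatou mu mD mq _)) => [k x _|].
      by rewrite lee_fin sqr_ge0.
    rewrite limn_einf_lim; apply: lime_le; first exact: is_cvg_einfs.
    apply: nearW => m; apply: ereal_inf_le.
    exists (\int[mu]_(x in D) ((g (maxn m K) x - f n x) ^+ 2)%:E)%E.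
      by exists (maxn m K) => //=; rewrite leq_maxl.
    have := hK (maxn m K) (leq_maxr _ _); rewrite -lee_fin /Rintegral fineK//.
    by apply: integrable_fin_num => //; case: (hB (phi (maxn m K)) n).
  apply: ae_eq_integral => //.
  - by apply/measurable_EFinP/measurable_funX/measurable_funB => //; case: (hf n).
  - have -> : (fun x => limn_einf (fun k => ((g k x - f n x) ^+ 2)%:E)) =
        (fun x => - limn_esup (-%E \o fun k => ((g k x - f n x) ^+ 2)%:E))%E.
      by apply/funext => x; rewrite limn_esupN oppeK.
    apply: measurableT_comp => //.
    apply: (@measurable_fun_limn_esup _ _ _ D
      (fun k x => - ((g k x - f n x) ^+ 2)%:E)%E) => k.
    by apply: measurableT_comp => //; exact: mq.
  - apply: aeS aeg => x /= h Dx; have hF := FE x (h Dx).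
    have /cvg_limn_einf_sup[-> _] // :
      (fun k => ((g k x - f n x) ^+ 2)%:E) @ \oo --> ((F x - f n x) ^+ 2)%:E.
    apply: cvg_EFin; first exact: nearW.
    have hc : (fun k => g k x - f n x) @ \oo --> F x - f n x.
      by apply: cvgB => //; exact: cvg_cst.
    by rewrite /= expr2; under eq_fun do rewrite /= expr2; exact: cvgM.
have conv e : 0 < e -> exists N, forall n, (N <= n)%N ->
    (\int[mu]_(x in D) ((F x - f n x) ^+ 2)%:E <= e%:E)%E.
  move=> e0; have [N hN] := cauchy e e0; exists N => n Nn; apply: key.
  exists N => k Nk; apply: hN => //.
  exact: leq_trans Nk (leq_trans (leq_addl _ _) (phik k)).
have sqF n : measurable_fun D (fun x => F x - f n x).
  by apply: measurable_funB => //; case: (hf n).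
have FfI n e : (\int[mu]_(x in D) ((F x - f n x) ^+ 2)%:E <= e%:E)%E ->
    sqi mu D (fun x => F x - f n x).
  move=> h; split=> //; apply/integrableP; split.
    exact/measurable_EFinP/measurable_funX.
  apply: le_lt_trans (ltry e); apply: le_trans h.
  by rewrite le_eqVlt; apply/orP; left; apply/eqP; apply: eq_integral => x _;
    rewrite /= ger0_norm ?sqr_ge0.
exists F.
  have [N hN] := conv 1 ltr01.
  have := sqiD mD (FfI N 1 (hN _ (leqnn N))) (hf N); congr (sqi _ _ _).
  by apply/funext => x; rewrite subrK.
move=> e e0; have [N hN] := conv e e0; exists N => n Nn.
have h := hN n Nn; have [_ hI] := FfI _ _ h.
by rewrite -lee_fin /Rintegral fineK//; apply: integrable_fin_num.
Qed.

End Completeness.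

Section ComplexCompleteness.
Context {R : realType}.
Variables (mu : {measure set (mspace3 R) -> \bar R}) (D : set (space3 R)).
Hypothesis mD : measurable (D : set (mspace3 R)).
Hypothesis finD : (mu D < +oo)%E.

Local Notation nsq f := (fine (sqL2 mu D f)).
Local Notation nsqv f := (fine (sqL2v mu D f)).

Lemma nsqB f g : L2 mu D f -> L2 mu D g -> nsq (f - g) =
  Rintegral mu D (fun x => (complex.Re (f x) - complex.Re (g x)) ^+ 2) +
  Rintegral mu D (fun x => (complex.Im (f x) - complex.Im (g x)) ^+ 2).
Proof.
move=> hf hg; have := sqL2E mD (L2B mD hf hg) => ->/=; congr (_ + _);
  by apply: eq_Rintegral => x _; rewrite ?ReD ?ImD ?ReN ?ImN.
Qed.

Lemma L2_complete (f : nat -> space3 R -> R[i]) : (forall n, L2 mu D (f n)) ->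
  (forall e : R, 0 < e -> exists N, forall m n, (N <= m)%N -> (N <= n)%N ->
     nsq (f m - f n) <= e) ->
  exists2 g, L2 mu D g &
    forall e : R, 0 < e -> exists N, forall n, (N <= n)%N -> nsq (g - f n) <= e.
Proof.
move=> hf cauchy.
have hR n : sqi mu D (fun x => complex.Re (f n x)) by case: (L2P mu mD (f n)) => /(_ (hf n))[].
have hI n : sqi mu D (fun x => complex.Im (f n x)) by case: (L2P mu mD (f n)) => /(_ (hf n))[].
have I0 h : 0 <= Rintegral mu D (fun x => h x ^+ 2).
  by apply: Rintegral_ge0 => x _; exact: sqr_ge0.
have [e e0|a ha ca] := sqi_complete mD finD hR.
  have [N hN] := cauchy e e0; exists N => m n Nm Nn.
  by apply: le_trans (hN m n Nm Nn); rewrite nsqB// lerDl; exact: I0.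
have [e e0|b hb cb] := sqi_complete mD finD hI.
  have [N hN] := cauchy e e0; exists N => m n Nm Nn.
  by apply: le_trans (hN m n Nm Nn); rewrite nsqB// lerDr; exact: I0.
have hg : L2 mu D (fun x => Complex (a x) (b x)) by apply/L2P.
exists (fun x => Complex (a x) (b x)) => // e e0.
have e2 : 0 < e / 2 by rewrite divr_gt0.
have [N hN] := ca _ e2; have [M hM] := cb _ e2.
exists (maxn N M) => n; rewrite geq_max => /andP[Nn Mn].
rewrite nsqB//= [leRHS]splitr lerD//; [exact: hN|exact: hM].
Qed.

Lemma L2v_complete (f : nat -> cfield R) : (forall n, L2v mu D (f n)) ->
  (forall e : R, 0 < e -> exists N, forall m n, (N <= m)%N -> (N <= n)%N ->
     nsqv (f m - f n) <= e) ->
  exists2 g, L2v mu D g &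
    forall e : R, 0 < e -> exists N, forall n, (N <= n)%N -> nsqv (g - f n) <= e.
Proof.
move=> hf cauchy.
have nsqvB (u v : cfield R) : L2v mu D u -> L2v mu D v -> nsqv (u - v) =
    \sum_i nsq ((fun x => u x 0 i) - (fun x => v x 0 i)).
  move=> hu hv; rewrite nsqvE//; last exact: L2vB.
  apply: eq_bigr => i _; congr fine; apply: eq_integral => x _.
  by rewrite !mxE.
have /choice[g hg] : forall i : 'I_3, exists g, L2 mu D g /\
    forall e : R, 0 < e -> exists N, forall n, (N <= n)%N ->
      nsq (g - (fun x => f n x 0 i)) <= e.
  move=> i; have [||g g1 g2] := @L2_complete (fun n x => f n x 0 i); last by exists g.
  - by move=> n; exact: hf.
  - move=> e e0; have [N hN] := cauchy e e0; exists N => m n Nm Nn.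
    apply: le_trans (hN m n Nm Nn); rewrite nsqvB// (bigD1 i)//= lerDl sumr_ge0// => j _.
    by rewrite fine_ge0// sqL2_ge0.
have hG : L2v mu D (fun x => \row_i g i x).
  move=> i; have [h _] := hg i; move: h; congr (L2 _ _ _).
  by apply/funext => x; rewrite mxE.
exists (fun x => \row_i g i x) => // e e0.
have e3 : 0 < e / 3 by rewrite divr_gt0.
have /choice[N hN] : forall i : 'I_3, exists N, forall n, (N <= n)%N ->
    nsq (g i - (fun x => f n x 0 i)) <= e / 3.
  by move=> i; have [_ /(_ _ e3)] := hg i.
exists (\max_i N i)%N => n Nn; rewrite nsqvB//.
apply: (@le_trans _ _ (\sum_(i < 3) (e / 3))).
  apply: ler_sum => i _; apply: le_trans (hN i n (leq_trans (leq_bigmax i) Nn)).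
  rewrite le_eqVlt; apply/orP; left; apply/eqP; congr fine.
  by apply: eq_integral => x _; rewrite !fctE mxE.
by rewrite sumr_const card_ord -[leLHS]mulr_natr divfK.
Qed.

End ComplexCompleteness.

(** * Smooth bump functions *)

Section FlatExponential.
Context {R : realType}.
Implicit Types (k : nat) (s b t : R).

(* The family is closed under differentiation up to linear combinations:
   [f_k' = - k f_(k+1) + f_(k+2)]. *)
Definition flat_exp k t : R := if 0 < t then (t^-1) ^+ k * expR (- t^-1) else 0.

(** The exponential of 1 / t dominates its Taylor term of degree k + 2. The factor t^2 that is left
    over makes the difference quotients at 0 tend to 0. *)
Lemma flat_exp_le k t : 0 < t -> (t^-1) ^+ k * expR (- t^-1) <= k.+2`!%:R * t ^+ 2.
Proof.
move=> t0; have ti : 0 < t^-1 by rewrite invr_gt0.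
have := expR_ge1Dxn k.+1 (ltW ti).
set F := k.+2`!%:R => h.
have F0 : 0 < F by rewrite ltr0n fact_gt0.
have h2 : (t^-1) ^+ k.+2 <= F * expR t^-1.
  rewrite mulrC -ler_pdivrMr//; apply: le_trans h; by rewrite lerDr.
rewrite expRN -ler_pdivlMr ?invr_gt0 ?expR_gt0// invrK.
rewrite [_ * t ^+ 2 * _]mulrAC.
rewrite -ler_pdivrMr ?exprn_gt0//; apply: le_trans h2.
by rewrite -exprVn -exprD addn2.
Qed.

Lemma is_derive_flat_formula k t : 0 < t ->
  is_derive t 1 (fun u : R => (u^-1) ^+ k * expR (- u^-1))
    (- k%:R * ((t^-1) ^+ k.+1 * expR (- t^-1)) + (t^-1) ^+ k.+2 * expR (- t^-1)).
Proof.
move=> t0; have tn0 : t != 0 by rewrite gt_eqF.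
have dV : is_derive t 1 (fun u : R => u^-1) (- t ^- 2).
  apply: DeriveDef; first by apply: derivableV.
  by rewrite deriveV// derive_id; rewrite /GRing.scale/= mulr1.
have dE : is_derive t 1 (expR \o (fun u : R => - u^-1)) (expR (- t^-1) * t ^- 2).
  apply: is_derive1_comp; rewrite -[t ^- 2]opprK; exact: is_deriveN.
have dP : is_derive t 1 ((fun u : R => u^-1) ^+ k) ((k%:R * t^-1 ^+ k.-1) *: - t ^- 2).
  exact: is_deriveX.
have := is_deriveM dP dE.
rewrite (_ : (fun u : R => u^-1) ^+ k * _ = fun u : R => (u^-1) ^+ k * expR (- u^-1)); last first.
  by apply/funext => u; rewrite !fctE.
move=> h; apply: (is_derive_eq h); rewrite !fctE /GRing.scale/=.
move: (expR _) => E; rewrite -!exprVn; move: t^-1 => i.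
have hk : k%:R * i ^+ k.-1 * i = k%:R * i ^+ k.
  by case: k {dP h} => [|k]; rewrite ?mul0r// -mulrA -exprSr.
transitivity (i ^+ k * (E * i ^+ 2) - E * i * (k%:R * i ^+ k.-1 * i)); first by ring.
by rewrite hk !exprS; move: (i ^+ k) (k%:R : R) => P K; ring.
Qed.

Lemma is_derive_flat_exp k t :
  is_derive t 1 (flat_exp k) (- k%:R * flat_exp k.+1 t + flat_exp k.+2 t).
Proof.
have [t0|t0|t0] := ltgtP t 0.
- have e : {near t, (fun=> 0) =1 flat_exp k}.
    near=> u; rewrite /flat_exp ltNge (ltW _)//=.
    by near: u; exact: lt_nbhsl.
  have z j : flat_exp j t = 0 by rewrite /flat_exp ltNge (ltW t0).
  rewrite !z mulr0 addr0; apply: (@near_eq_is_derive _ _ _ (cst 0) (flat_exp k) _ _ _ e).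
- have e : {near t, (fun u : R => (u^-1) ^+ k * expR (- u^-1)) =1 flat_exp k}.
    near=> u; rewrite /flat_exp ifT//.
    by near: u; exact: lt_nbhsr.
  have := is_derive_flat_formula k t0; rewrite /flat_exp t0.
  exact: near_eq_is_derive.
- rewrite t0.
  have z j : flat_exp j 0 = 0 by rewrite /flat_exp ltxx.
  rewrite !z mulr0 addr0.
  (* At the junction point the difference quotient is [flat_exp k h] divided by h, which
     [flat_exp_le] bounds by a multiple of h for h > 0. *)
  have H : (fun h : R => h^-1 *: ((flat_exp k \o shift 0) (h *: 1) - flat_exp k 0)) @ 0^' --> (0 : R).
    apply/cvgrPdist_le => e e0; near=> h.
    rewrite z subr0 sub0r normrN /GRing.scale/= mulr1 addr0 /flat_exp.
    case: ifPn => [h0|_]; last by rewrite mulr0 normr0 ltW.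
    rewrite ger0_norm ?mulr_ge0 ?invr_ge0 ?exprn_ge0 ?expR_ge0 ?invr_ge0 ?(ltW h0)//.
    rewrite mulrC ler_pdivrMr//; apply: (le_trans (flat_exp_le k h0)).
    rewrite expr2 mulrA ler_pM2r// -ler_pdivlMl ?ltr0n ?fact_gt0//.
    apply: le_trans (ler_norm h) _; near: h.
    apply: dnbhs0_le; by rewrite mulr_gt0// invr_gt0 ltr0n fact_gt0.
  by apply: DeriveDef; [apply: (cvgP _ H)|exact: (cvg_lim _ H)].
Unshelve. all: by end_near. Qed.

Lemma flat_exp_continuous k : continuous (flat_exp k).
Proof.
move=> t; apply: differentiable_continuous; apply/derivable1_diffP.
by have [] := is_derive_flat_exp k t.
Qed.

End FlatExponential.

Lemma ord3P (i : 'I_3) : [\/ i = 0, i = 1 | i = 2].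
Proof.
by case: i => -[|[|[|//]]] p; [constructor 1|constructor 2|constructor 3];
  apply: val_inj.
Qed.

Section SmoothBumps.
Context {R : realType}.
Implicit Types (f g : space3 R -> R) (i j : 'I_3) (x v : space3 R) (l u : 'I_3 -> R).

Local Notation co i x := (vec x 0 i).

Lemma coE x i : co i x = if i == 0 then x.1.1 else if i == 1 then x.1.2 else x.2.
Proof. by rewrite mxE. Qed.

Lemma coD x v i : co i (x + v) = co i x + co i v.
Proof. by rewrite !coE; case: ifP => // _; case: ifP. Qed.

Lemma coZ (h : R) x i : co i (h *: x) = h * co i x.
Proof. by rewrite !coE; case: ifP => // _; case: ifP. Qed.

Lemma coB x v i : co i (x - v) = co i x - co i v.
Proof. by rewrite coD -scaleN1r coZ mulN1r. Qed.

Lemma co_inj x v : (forall i, co i x = co i v) -> x = v.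
Proof.
move=> h; have := h 0; have := h 1; have := h 2; rewrite !coE /=.
by case: x {h} => [[? ?] ?]; case: v => [[? ?] ?] /= -> -> ->.
Qed.

Lemma continuous_co i : continuous (fun x => co i x).
Proof.
move=> x.
have -> : (fun x => co i x) = if i == 0 then (fun x => x.1.1)
    else if i == 1 then (fun x => x.1.2) else (fun x => x.2).
  by apply/funext => y; rewrite coE; case: ifP => // _; case: ifP.
case: ifP => _; last case: ifP => _.
- by apply: continuous_comp; exact: cvg_fst.
- by apply: (@continuous_comp _ _ _ fst snd); [exact: cvg_fst|exact: cvg_snd].
- exact: cvg_snd.
Qed.

(** A class that contains the bumps and is closed under directional derivatives. Smoothness
    quantifies over all iterated partial derivatives, so for this class it follows by one induction
    on their sequence. *)
Inductive elementary : (space3 R -> R) -> Prop :=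
| elementary_cst c : elementary (fun=> c)
| elementary_add f g : elementary f -> elementary g -> elementary (f + g)
| elementary_mul f g : elementary f -> elementary g -> elementary (f * g)
| elementary_flat k s b i : elementary (fun x => flat_exp k (s * co i x + b)).

Lemma continuous_affine s b i : continuous (fun x => s * co i x + b : R).
Proof.
move=> x; apply: cvgD; last exact: cvg_cst.
by apply: cvgM; [exact: cvg_cst|exact: continuous_co].
Qed.

Lemma is_derive_flat_affine k s b i x v :
  is_derive x v (fun y => flat_exp k (s * co i y + b))
    ((s * co i v) * (- k%:R * flat_exp k.+1 (s * co i x + b) +
                     flat_exp k.+2 (s * co i x + b))).
Proof.
set t := s * co i x + b; set c := s * co i v.
have [d1 d2] := is_derive_flat_exp k t.
have dd : differentiable (flat_exp k) t by apply/derivable1_diffP.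
(* Along v the composite has exactly the difference quotients of [flat_exp k] at t in the direction
   c, so the chain rule reduces to one variable. *)
have E : (fun h : R => h^-1 *: (((fun y => flat_exp k (s * co i y + b)) \o shift x) (h *: v)
      - flat_exp k (s * co i x + b))) =
    (fun h : R => h^-1 *: ((flat_exp k \o shift t) (h *: c) - flat_exp k t)).
  apply/funext => h /=; congr (_ *: (flat_exp _ _ - _)).
  by rewrite coD coZ /t /c /GRing.scale/=; ring.
apply: DeriveDef; first by rewrite /derivable E; exact: (@diff_derivable _ _ _ _ _ c).
rewrite /derive E -/(derive _ _ _) deriveE//.
have -> : c = c *: (1 : R) by rewrite /GRing.scale/= mulr1.
by rewrite linearZ/= -deriveE// d2 /GRing.scale/= mulr1.
Qed.

Lemma elementary_derivable f : elementary f ->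
  continuous f /\ forall v, exists2 g, elementary g & forall x, is_derive x v f (g x).
Proof.
elim=> {f} [c|f g _ [cf df] _ [cg dg]|f g ef [cf df] eg [cg dg]|k s b i].
- split; first exact: cst_continuous.
  by move=> v; exists (fun=> 0) => [|x]; [exact: elementary_cst|exact: is_derive_cst].
- split; first by move=> x; apply: cvgD; [exact: cf|exact: cg].
  move=> v; have [f' ef' hf] := df v; have [g' eg' hg] := dg v.
  by exists (f' + g') => [|x]; [exact: elementary_add|exact: is_deriveD].
- split; first by move=> x; apply: cvgM; [exact: cf|exact: cg].
  move=> v; have [f' ef' hf] := df v; have [g' eg' hg] := dg v.
  exists (f * g' + g * f') => [|x].
    by apply: elementary_add; exact: elementary_mul.
  exact: is_deriveM.
- split.
    move=> x; apply: (@continuous_comp _ _ _ (fun x => s * co i x + b) (flat_exp k)).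
      exact: continuous_affine.
    exact: flat_exp_continuous.
  move=> v; exists ((fun=> s * co i v) * ((fun=> - k%:R) *
      (fun x => flat_exp k.+1 (s * co i x + b)) + (fun x => flat_exp k.+2 (s * co i x + b)))).
    apply: elementary_mul; first exact: elementary_cst.
    apply: elementary_add; last exact: elementary_flat.
    by apply: elementary_mul; [exact: elementary_cst|exact: elementary_flat].
  move=> x; exact: is_derive_flat_affine.
Qed.

Lemma elementary_smooth f : elementary f -> smooth f.
Proof.
move=> ef s; set psi := foldr _ _ _.
have : elementary psi.
  rewrite /psi; elim: s {psi} => //= i s /elementary_derivable[_ /(_ (Defs.basis i))[g eg hg]].
  suff -> : pd i (foldr pd f s) = g by [].
  by apply/funext => x; rewrite /pd; have [_ ->] := hg x.
move=> /elementary_derivable[c d]; split=> // i x.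
by have [g _ /(_ x)[]] := d (Defs.basis i).
Qed.

Definition obox l u : set (space3 R) := [set x | forall i, l i < co i x < u i].
Definition cbox l u : set (space3 R) := [set x | forall i, l i <= co i x <= u i].

Lemma cbox_compact l u : compact (cbox l u).
Proof.
have -> : cbox l u = (`[l 0, u 0] `*` `[l 1, u 1]) `*` `[l 2, u 2].
  apply/seteqP; split=> [x h|x [[h0 h1] h2] i] /=.
    have := h 0; have := h 1; have := h 2; rewrite !coE/= => h2 h1 h0.
    by split; [split|]; rewrite /= in_itv.
  move: h0 h1 h2; rewrite /= !in_itv/= coE => h0 h1 h2.
  by case: (ord3P i) => ->.
by apply: compact_setX; [apply: compact_setX|]; exact: segment_compact.
Qed.

(* The factors [n.+1] make the bumps converge to the indicator of the open box. *)
Definition bump1 l u n i x : R :=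
  flat_exp 0 (n.+1%:R * co i x + - (n.+1%:R * l i)) *
  flat_exp 0 (- n.+1%:R * co i x + n.+1%:R * u i).

Definition bump l u n x : R := bump1 l u n 0 x * bump1 l u n 1 x * bump1 l u n 2 x.

Lemma bump_smooth l u n : smooth (bump l u n).
Proof.
apply: elementary_smooth.
have h i : elementary (bump1 l u n i).
  by apply: elementary_mul; exact: elementary_flat.
exact: elementary_mul (elementary_mul (h 0) (h 1)) (h 2).
Qed.

Lemma flat_exp0_bound (t : R) : 0 <= flat_exp 0 t <= 1.
Proof.
rewrite /flat_exp; case: ifPn => [t0|_]; last by rewrite lexx ler01.
by rewrite expr0 mul1r expR_ge0 -expR0 ler_expR oppr_le0 invr_ge0 ltW.
Qed.

Lemma bump1_bound l u n i x : 0 <= bump1 l u n i x <= 1.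
Proof.
rewrite /bump1; have /andP[a0 a1] := flat_exp0_bound (n.+1%:R * co i x + - (n.+1%:R * l i)).
have /andP[b0 b1] := flat_exp0_bound (- n.+1%:R * co i x + n.+1%:R * u i).
by rewrite mulr_ge0//= mulr_ile1.
Qed.

Lemma bump_bound l u n x : 0 <= bump l u n x <= 1.
Proof.
rewrite /bump; have /andP[a0 a1] := bump1_bound l u n 0 x.
have /andP[b0 b1] := bump1_bound l u n 1 x; have /andP[c0 c1] := bump1_bound l u n 2 x.
have ab0 := mulr_ge0 a0 b0; have ab1 := mulr_ile1 a0 b0 a1 b1.
by rewrite mulr_ge0//= mulr_ile1.
Qed.

Lemma flat_exp0_npos (t : R) : t <= 0 -> flat_exp 0 t = 0.
Proof. by move=> t0; rewrite /flat_exp ltNge t0. Qed.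

Lemma bump1_out l u n i x : ~~ (l i < co i x < u i) -> bump1 l u n i x = 0.
Proof.
rewrite negb_and -!leNgt => /orP[h|h]; rewrite /bump1.
  by rewrite flat_exp0_npos ?mul0r// -mulrBr pmulr_rle0// subr_le0.
by rewrite [X in _ * X]flat_exp0_npos ?mulr0// mulNr addrC -mulrBr pmulr_rle0// subr_le0.
Qed.

Lemma flat_exp0_cvg (t : R) : 0 < t ->
  (fun n => flat_exp 0 (n.+1%:R * t)) @ \oo --> (1 : R).
Proof.
move=> t0; rewrite /flat_exp.
under eq_fun do rewrite mulr_gt0// expr0 mul1r invfM.
have h : (fun n => - (n.+1%:R^-1 * t^-1)) @ \oo --> (0 : R).
  rewrite -oppr0; apply: cvgN; rewrite -(mul0r t^-1); apply: cvgM; last exact: cvg_cst.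
  exact: cvg_harmonic.
by have := cvg_comp _ _ h (@continuous_expR R 0); rewrite expR0.
Qed.

Lemma bump1_cvg l u i x : (fun n => bump1 l u n i x) @ \oo --> (((l i < co i x < u i)%R : nat)%:R : R).
Proof.
have [/andP[h1 h2]|h] := boolP (l i < co i x < u i); last first.
  under eq_fun do rewrite bump1_out//.
  exact: cvg_cst.
rewrite -(mulr1 1%:R); apply: cvgM.
  under eq_fun do rewrite -mulrBr; apply: flat_exp0_cvg; by rewrite subr_gt0.
under eq_fun do rewrite mulNr addrC -mulrBr.
by apply: flat_exp0_cvg; rewrite subr_gt0.
Qed.

Lemma bump_cvg l u x : (fun n => bump l u n x) @ \oo --> (\1_(obox l u) x : R).
Proof.
have -> : \1_(obox l u) x = ((l 0 < co 0 x < u 0)%R : nat)%:R *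
   ((l 1 < co 1 x < u 1)%R : nat)%:R * ((l 2 < co 2 x < u 2)%R : nat)%:R :> R.
  rewrite indicE -!natrM !mulnb.
  suff -> : (x \in obox l u) =
    [&& l 0 < co 0 x < u 0, l 1 < co 1 x < u 1 & l 2 < co 2 x < u 2].
    by rewrite !andbA.
  apply/idP/and3P => [|[h0 h1 h2]]; rewrite inE; first by move=> h; split; exact: h.
  move=> i; by case: (ord3P i) => ->.
by apply: cvgM; [apply: cvgM|]; exact: bump1_cvg.
Qed.

Lemma bump_supported l u n (U : set (space3 R)) : cbox l u `<=` U ->
  supported_in U (bump l u n).
Proof.
move=> lU; exists (cbox l u); split=> //; first exact: cbox_compact.
move=> x nx.
have [i hi] : exists i, ~~ (l i < co i x < u i).
  apply: contrapT => h; apply: nx => i; apply: contrapT => hi; apply: h; exists i.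
  by apply/negP => /andP[/ltW a /ltW b]; apply: hi; rewrite a b.
have := bump1_out n hi; rewrite /bump.
by case: (ord3P i) => -> ->; rewrite ?mulr0 ?mul0r.
Qed.

End SmoothBumps.

(** * Fundamental lemma of the calculus of variations *)

Section BoxCovers.
Context {R : realType}.
Implicit Types (l u : 'I_3 -> R) (x : space3 R) (A D U : set (space3 R)).

Local Notation co i x := (vec x 0 i).

Lemma ball_co x (e : R) (y : space3 R) :
  ball x e y <-> forall i, `|co i x - co i y| < e.
Proof.
split=> [[[h1 h2] h3] i|h]; first by rewrite !coE; case: (ord3P i) => ->.
have h0 := h 0; have h1 := h 1; have h2 := h 2.
by move: h0 h1 h2; rewrite !coE/= => h0 h1 h2; split; [split|].
Qed.

(** Boxes with rational centres and half-widths 1 / (n + 1), enumerated by [pickle]. The closed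
    boxes must lie in U because they carry the supports of the bumps; the open ones must cover
    because the bumps converge to their indicators. *)
Lemma open_obox_cover U : open U -> exists l u : nat -> 'I_3 -> R,
  (forall k, cbox (l k) (u k) `<=` U) /\ U `<=` \bigcup_k obox (l k) (u k).
Proof.
move=> oU.
pose cen (q : rat * rat * rat) (i : 'I_3) : R :=
  ratr (if i == 0 then q.1.1 else if i == 1 then q.1.2 else q.2).
pose L (p : rat * rat * rat * nat) i := cen p.1 i - p.2.+1%:R^-1.
pose V (p : rat * rat * rat * nat) i := cen p.1 i + p.2.+1%:R^-1.
pose good p := `[< cbox (L p) (V p) `<=` U >].
(* Codes that decode to nothing, or to a box leaving U, get the lower bound 1 and the upper bound 0,
   hence an empty box. *)
pose sel (F : _ -> 'I_3 -> R) (c : R) k :=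
  if unpickle k is Some p then (if good p then F p else fun=> c) else fun=> c.
exists (sel L 1), (sel V 0); split.
  move=> k x; rewrite /sel; case: (unpickle k) => [p|]; last first.
    by move=> /(_ 0)/andP[h1 /(le_trans h1)]; rewrite ler10.
  case: ifPn => [/asboolP gp|_]; first exact: gp.
  by move=> /(_ 0)/andP[h1 /(le_trans h1)]; rewrite ler10.
move=> x Ux.
have /nbhs_ballP[e e0 he] : nbhs x U by exact: open_nbhs_nbhs.
have e2 : 0 < e / 2 by rewrite divr_gt0.
have [n hn] : exists n, n.+1%:R^-1 < e / 2.
  by have [n] := ltr_add_invr e2; rewrite add0r => h; exists n.
have r0 : 0 < (n.+1%:R^-1 : R) by rewrite invr_gt0 ltr0n.
have rq i : exists q : rat, `|co i x - ratr q| < n.+1%:R^-1.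
  have /rat_in_itvoo[q] : co i x - n.+1%:R^-1 < co i x + n.+1%:R^-1.
    by rewrite ltrD2l gtrN.
  by rewrite in_itv => q12; exists q; rewrite distrC ltr_distl.
have [q0 h0] := rq 0; have [q1 h1] := rq 1; have [q2 h2] := rq 2.
pose p := (q0, q1, q2, n).
have hc i : `|co i x - cen (q0, q1, q2) i| < n.+1%:R^-1.
  by rewrite /cen; case: (ord3P i) => ->.
have gp : good p.
  apply/asboolP => y hy; apply: he; apply/ball_co => i.
  have := hy i; rewrite /L /V [p.1]/= [p.2]/= => /andP[y1 y2].
  have aux (a b c r : R) : c - r <= b -> b <= c + r -> `|a - c| < r ->
      r < e / 2 -> `|a - b| < e.
    by rewrite !ltr_norml => ? ? /andP[? ?] ?; apply/andP; split; lra.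
  exact: aux y1 y2 (hc i) hn.
exists (pickle p) => // i; rewrite /sel pickleK gp /L /V [p.1]/= [p.2]/=.
by have := hc i; rewrite ltr_distl.
Qed.

Lemma measurable_co i (S : set R) : measurable S ->
  measurable ([set x | S (co i x)] : set (mspace3 R)).
Proof.
move=> mS.
have m1 : measurable_fun [set: mspace3 R] (fun x : mspace3 R => x.1.1 : measurableTypeR R).
  by apply: (measurableT_comp (f := fst)); [exact: measurable_fst|exact: measurable_fst].
have m2 : measurable_fun [set: mspace3 R] (fun x : mspace3 R => x.1.2 : measurableTypeR R).
  by apply: (measurableT_comp (f := snd)); [exact: measurable_snd|exact: measurable_fst].
have m3 : measurable_fun [set: mspace3 R] (fun x : mspace3 R => x.2 : measurableTypeR R).
  exact: measurable_snd.
case: (ord3P i) => ->.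
- rewrite (_ : [set x | _] = setT `&` (fun x : mspace3 R => x.1.1) @^-1` S).
    exact: m1.
  by rewrite setTI; apply/seteqP; split=> x /=; rewrite coE.
- rewrite (_ : [set x | _] = setT `&` (fun x : mspace3 R => x.1.2) @^-1` S).
    exact: m2.
  by rewrite setTI; apply/seteqP; split=> x /=; rewrite coE.
- rewrite (_ : [set x | _] = setT `&` (fun x : mspace3 R => x.2) @^-1` S).
    exact: m3.
  by rewrite setTI; apply/seteqP; split=> x /=; rewrite coE.
Qed.

Definition sides (S : 'I_3 -> set R) : set (space3 R) := [set x | forall i, S i (co i x)].

Lemma measurable_sides (S : 'I_3 -> set R) : (forall i, measurable (S i)) ->
  measurable (sides S : set (mspace3 R)).
Proof.
move=> mS.
rewrite (_ : sides S = [set x | S 0 (co 0 x)] `&` [set x | S 1 (co 1 x)] `&` [set x | S 2 (co 2 x)]).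
  by apply: measurableI; [apply: measurableI|]; exact: measurable_co.
apply/seteqP; split=> x /=; first by move=> h; split; [split|]; exact: h.
by move=> [[h0 h1] h2] i; case: (ord3P i) => ->.
Qed.

Lemma oboxE l u : obox l u = sides (fun i => `]l i, u i[%classic).
Proof. by apply/seteqP; split=> x h i; have := h i; rewrite /= in_itv. Qed.

Lemma measurable_obox l u : measurable (obox l u : set (mspace3 R)).
Proof. by rewrite oboxE; apply: measurable_sides => i; exact: measurable_itv. Qed.

Lemma open_measurable3 U : open U -> measurable (U : set (mspace3 R)).
Proof.
move=> /open_obox_cover[l [u [h1 h2]]].
have -> : U = \bigcup_k obox (l k) (u k).
  apply/seteqP; split=> // x [k _ hx]; apply: (h1 k) => i.
  by have /andP[/ltW -> /ltW ->] := hx i.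
by apply: bigcupT_measurable => k; exact: measurable_obox.
Qed.

Definition openside (S : set R) := S = setT \/ exists a b, S = `]a, b[%classic.

Lemma openside_measurable S : openside S -> measurable S.
Proof. by move=> [->|[a [b ->]]]; [exact: measurableT|exact: measurable_itv]. Qed.

Lemma itvI (a b a' b' : R) :
  `]a, b[%classic `&` `]a', b'[%classic = `]Num.max a a', Num.min b b'[%classic.
Proof.
apply/seteqP; split=> x /=; rewrite !in_itv/= gt_max lt_min.
  by move=> [/andP[-> ->] /andP[-> ->]].
by move=> /andP[/andP[-> ->] /andP[-> ->]].
Qed.

Lemma opensideI S S' : openside S -> openside S' -> openside (S `&` S').
Proof.
move=> [->|[a [b ->]]]; first by rewrite setTI.
move=> [->|[a' [b' ->]]]; first by rewrite setIT; right; exists a, b.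
by right; rewrite itvI; eexists; eexists.
Qed.

Definition openboxes : set (set (space3 R)) :=
  [set Q | exists2 S, (forall i, openside (S i)) & Q = sides S].

Lemma openboxes_setI : setI_closed openboxes.
Proof.
move=> _ _ [S hS ->] [S' hS' ->]; exists (fun i => S i `&` S' i).
  by move=> i; exact: opensideI.
apply/seteqP; split=> x /=; first by move=> [h1 h2] i; split.
by move=> h; split=> i; have [] := h i.
Qed.

(** The identity from the space with the generated sigma-algebra to the product is measurable
    because its three coordinates are. *)
Lemma measurable3_gen :
  (measurable : set (set (mspace3 R))) `<=` <<s openboxes >>.
Proof.
pose T0 := g_sigma_algebraType openboxes.
have mco i : measurable_fun [set: T0] (fun x : T0 => co i (x : space3 R) : measurableTypeR R).
  apply: (measurability _ (RGenOpens.measurableE R)) => //.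
  move=> _ [_ [a [b ->]] <-]; apply: sub_sigma_algebra.
  exists (fun j => if j == i then `]a, b[%classic else setT).
    by move=> j; case: ifP => _; [right; exists a, b|left].
  apply/seteqP; split=> x /=.
    by move=> [_ h] j; case: ifP => [/eqP ->|].
  by move=> h; split=> //; have := h i; rewrite eqxx.
have mid : measurable_fun [set: T0] (fun x : T0 => (x : mspace3 R)).
  rewrite (_ : (fun x : T0 => (x : mspace3 R)) =
    (fun x : T0 => ((co 0 (x : space3 R), co 1 (x : space3 R)), co 2 (x : space3 R)) : mspace3 R)).
    by apply: measurable_fun_pair; [apply: measurable_fun_pair|]; exact: mco.
  by apply/funext => -[[x y] z]; rewrite !coE.
by move=> A mA; have := mid measurableT A mA; rewrite setTI.
Qed.

End BoxCovers.

(** * From smooth test functions to almost everywhere vanishing *)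

Section FundamentalLemma.
Context {R : realType}.
Variables (mu : {measure set (mspace3 R) -> \bar R}) (D U : set (space3 R)).
Hypothesis mD : measurable (D : set (mspace3 R)).
Hypothesis oU : open U.
Hypothesis DU : D `<=` U.
Variable h : space3 R -> R.
Hypothesis ih : mu.-integrable (D : set (mspace3 R)) (EFin \o h).
Hypothesis h0 : forall phi : space3 R -> R, smooth phi -> supported_in U phi ->
  Rintegral mu D (fun x => h x * phi x) = 0.

Lemma smooth_measurable (phi : space3 R -> R) (E : set (space3 R)) :
  continuous phi -> measurable_fun (E : set (mspace3 R)) phi.
Proof.
move=> cphi; apply: measurable_funTS.
apply: (measurability _ (RGenOpens.measurableE R)) => //.
move=> _ [_ [a [b ->]] <-]; rewrite setTI; apply: open_measurable3.
by apply: open_comp => //; exact: itv_open.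
Qed.

(** Dominated convergence along the bumps of the box, with |h| as majorant. *)
Lemma integral_obox_eq0 l u : cbox l u `<=` U ->
  (\int[mu]_(x in D `&` obox l u) (h x)%:E = 0)%E.
Proof.
move=> lU.
have mh : measurable_fun (D : set (mspace3 R)) h by apply/measurable_EFinP; exact: (measurable_int mu ih).
have cb n : continuous (bump l u n) by have [] := bump_smooth l u n [::].
have mb n : measurable_fun (D : set (mspace3 R)) (bump l u n) by apply: smooth_measurable.
have DC := @dominated_convergence _ (mspace3 R) R mu D mD
  (fun n x => (h x * bump l u n x)%:E) (fun x => (h x * \1_(obox l u) x)%:E)
  (fun x => `|(h x)%:E|%E).
case: DC.
- by move=> n; apply/measurable_EFinP; exact: measurable_funM.
- apply/measurable_EFinP; apply: measurable_funM => //.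
  by apply: measurable_indic; exact: measurable_obox.
- apply: aeW => x _; apply: cvg_EFin; first exact: nearW.
  by apply: cvgM; [exact: cvg_cst|exact: bump_cvg].
- exact: integrable_abse.
- apply: aeW => x n _; rewrite !abse_EFin lee_fin normrM.
  have /andP[b0 b1] := bump_bound l u n x.
  by rewrite (ger0_norm b0) ler_piMr.
move=> _ _; rewrite (_ : [sequence _]_n = fun=> 0%E).
  move=> /(cvg_unique (@ereal_hausdorff R) (cvg_cst _)) => E.
  rewrite integral_mkcondr E; apply: eq_integral => x _.
  by rewrite patchE indicE; case: ifP => _; rewrite ?mulr1 ?mulr0.
apply/funext => n /=.
have := h0 (bump_smooth l u n) (bump_supported n lU).
rewrite /Rintegral => /eqP; rewrite fine_eq0; first by move/eqP.
apply: integrable_fin_num => //; apply: le_integrable ih => //.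
  by apply/measurable_EFinP; exact: measurable_funM.
move=> x _; rewrite !abse_EFin lee_fin normrM.
have /andP[b0 b1] := bump_bound l u n x.
by rewrite (ger0_norm b0) ler_piMr.
Qed.

(** The pi-lambda theorem, from open boxes to all measurable sets. It is run inside one fixed box,
    where the total integral is already known to vanish; this is what gives stability under
    complements. *)
Lemma integral_in_obox_eq0 l u : cbox l u `<=` U -> forall A,
  measurable (A : set (mspace3 R)) ->
  (\int[mu]_(x in (D `&` obox l u) `&` A) (h x)%:E = 0)%E.
Proof.
move=> lU.
set Q := D `&` obox l u.
have mQ : measurable (Q : set (mspace3 R)).
  by apply: measurableI => //; exact: measurable_obox.
have iQ : mu.-integrable (Q : set (mspace3 R)) (EFin \o h).
  by apply: integrableS ih => // x [].
have sub E : measurable (E : set (mspace3 R)) -> mu.-integrable (Q `&` E) (EFin \o h).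
  by move=> mE; apply: integrableS iQ => //; exact: measurableI.
pose P := [set A : set (mspace3 R) | measurable A /\ (\int[mu]_(x in Q `&` A) (h x)%:E = 0)%E].
suff HP : <<s @openboxes R >> `<=` P by move=> A /measurable3_gen/HP[].
apply: lambda_system_subset => //.
- exact: openboxes_setI.
- apply/dynkin_lambda_system; split.
  + split; first exact: measurableT.
    by rewrite setIT integral_obox_eq0.
  + move=> A [mA A0]; split; first exact: measurableC.
    have := integral_obox_eq0 lU; rewrite -/Q -[in LHS](setIT Q) -(setUv A) setIUr.
    rewrite integral_setU//; first by rewrite A0 add0e.
    * exact: measurableI.
    * by apply: measurableI => //; exact: measurableC.
    * by rewrite -setIUr setUv setIT; exact: (measurable_int mu).
    * by apply/disj_setPS => x [[_ Ax] [_ nAx]].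
  + move=> F tF PF; split; first by apply: bigcupT_measurable => k; have [] := PF k.
    rewrite setI_bigcupr integral_bigcup//.
    * by rewrite eseries0// => k _ _; have [] := PF k.
    * exact: trivIset_setIl.
    * by move=> k; apply: measurableI => //; have [] := PF k.
    * rewrite -setI_bigcupr; apply: sub.
      by apply: bigcupT_measurable => k; have [] := PF k.
- move=> _ [S hS ->]; split.
    by apply: measurable_sides => i; exact: openside_measurable.
  (* A generating box cuts the fixed box in a smaller box, to which [integral_obox_eq0] applies
     again. *)
  have /choice[lu hlu] : forall i, exists p : R * R,
      [/\ `]l i, u i[%classic `&` S i = `]p.1, p.2[%classic, l i <= p.1 & p.2 <= u i].
    move=> i; case: (hS i) => [->|[a [b ->]]].
      by exists (l i, u i); rewrite setIT.
    exists (Num.max (l i) a, Num.min (u i) b); rewrite itvI; split=> //=.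
      by rewrite le_max lexx.
    by rewrite ge_min lexx.
  have -> : Q `&` sides S = D `&` obox (fun i => (lu i).1) (fun i => (lu i).2).
    rewrite /Q -setIA; congr (D `&` _); rewrite !oboxE; apply/seteqP; split=> x.
      by move=> [h1 h2] i; have [<- _ _] := hlu i; split; [exact: h1|exact: h2].
    by move=> hx; split=> i; have := hx i; have [<- _ _] := hlu i => -[].
  apply: integral_obox_eq0; apply: subset_trans lU => x hx i.
  have /andP[h1 h2] := hx i; have [_ h3 h4] := hlu i.
  by rewrite (le_trans h3 h1) (le_trans h2 h4).
Qed.

Lemma fundamental_lemma : {ae mu, forall x, D x -> h x = 0}.
Proof.
have [l [u [h1 h2]]] := open_obox_cover oU.
have H k : {ae mu, forall x, (D `&` obox (l k) (u k)) x -> (h x)%:E = 0%E}.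
  have mQ : measurable (D `&` obox (l k) (u k) : set (mspace3 R)).
    by apply: measurableI => //; exact: measurable_obox.
  apply: (@integral_ae_eq _ _ _ mu _ mQ (cst 0%E) (EFin \o h)).
  - by apply: integrableS ih => // x [].
  - exact: measurable_cst.
  - move=> E EQ mE; rewrite integral0 -(setIidr EQ).
    exact: integral_in_obox_eq0.
have := ae_foralln H; apply: aeS => x /= hx Dx.
by have [k _ xk] := h2 x (DU Dx); have [] := hx k (conj Dx xk).
Qed.

End FundamentalLemma.

Section WeakUniqueness.
Context {R : realType}.
Variables (mu : {measure set (mspace3 R) -> \bar R}) (D U : set (space3 R)).
Hypothesis mD : measurable (D : set (mspace3 R)).
Hypothesis finD : (mu D < +oo)%E.
Hypothesis oU : open U.
Hypothesis DU : D `<=` U.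

Lemma sqi_integrable (h : space3 R -> R) : sqi mu D h ->
  mu.-integrable (D : set (mspace3 R)) (EFin \o h).
Proof.
move=> hh; have h1 : sqi mu D (fun=> 1 : R).
  split; first exact: measurable_cst.
  apply: measurable_bounded_integrable => //.
  by under eq_fun do rewrite expr1n; exact: bounded_cst.
by have := sqi_mul mD hh h1; apply: eq_integrable => // x _ /=; rewrite mulr1.
Qed.

Lemma L2_test_eq0 (d : space3 R -> R[i]) : L2 mu D d ->
  (forall phi, smooth phi -> supported_in U phi ->
    cint mu D (fun x => d x * (phi x)%:C%C) = 0) ->
  sqL2 mu D d = 0%E.
Proof.
move=> hd h; apply/sqL2_ae0 => //.
have /L2P-/(_ mD)[dR dI] := hd.
have aR : {ae mu, forall x, D x -> complex.Re (d x) = 0}.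
  apply: (fundamental_lemma mD oU DU (sqi_integrable dR)) => phi sp su.
  have := congr1 (@complex.Re R) (h phi sp su); rewrite /cint /= => <-.
  by apply: eq_Rintegral => x _; rewrite ReM /= mulr0 subr0.
have aI : {ae mu, forall x, D x -> complex.Im (d x) = 0}.
  apply: (fundamental_lemma mD oU DU (sqi_integrable dI)) => phi sp su.
  have := congr1 (@complex.Im R) (h phi sp su); rewrite /cint /= => <-.
  by apply: eq_Rintegral => x _; rewrite ImM /= mulr0 add0r.
by apply: aeS2 aR aI => x /= h1 h2 Dx; apply: complexP; [exact: h1|exact: h2].
Qed.

Lemma L2v_test_eq0 (w : cfield R) : L2v mu D w ->
  (forall psi : space3 R -> 'rV[R]_3, smoothv psi -> supported_in U psi ->
    cint mu D (fun x => dot (w x) (toC (psi x))) = 0) ->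
  sqL2v mu D w = 0%E.
Proof.
move=> hw h; rewrite sqL2vE// big1// => i _; apply: L2_test_eq0 => // phi sp su.
pose psi x : 'rV[R]_3 := \row_j (if j == i then phi x else 0).
have := h psi.
have -> : (fun x => dot (w x) (toC (psi x))) = (fun x => w x 0 i * (phi x)%:C%C).
  apply/funext => x; rewrite /dot (bigD1 i)//= !mxE eqxx big1 ?addr0// => j ji.
  by rewrite !mxE (negPf ji) rmorph0 mulr0.
apply.
- move=> j; have -> : (fun x => psi x 0 j) = if j == i then phi else (fun=> 0).
    by apply/funext => x; rewrite mxE; case: ifP.
  by case: ifP => // _; apply: elementary_smooth; exact: elementary_cst.
- case: su => K [cK KU K0]; exists K; split=> // x /K0 p0.
  by apply/rowP => j; rewrite !mxE p0 if_same.
Qed.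

End WeakUniqueness.

(** * Geometry of the boundary *)

Lemma sum_ord3 (V : nmodType) (F : 'I_3 -> V) : \sum_i F i = F 0 + F 1 + F 2.
Proof.
rewrite !big_ord_recl big_ord0 addr0 addrA.
by congr (F _ + F _ + F _); apply: val_inj.
Qed.

Section DotAlgebra.
Context {K : comNzRingType}.
Implicit Types (a b c : 'rV[K]_3) (k : K).

Lemma dotC a b : dot a b = dot b a.
Proof. by apply: eq_bigr => i _; rewrite mulrC. Qed.

Lemma dotDl a b c : dot (a + b) c = dot a c + dot b c.
Proof. by rewrite -big_split; apply: eq_bigr => i _; rewrite mxE mulrDl. Qed.

Lemma dotZl k a b : dot (k *: a) b = k * dot a b.
Proof. by rewrite mulr_sumr; apply: eq_bigr => i _; rewrite mxE mulrA. Qed.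

Lemma dotE a b : dot a b = a 0 0 * b 0 0 + a 0 1 * b 0 1 + a 0 2 * b 0 2.
Proof. exact: sum_ord3. Qed.

End DotAlgebra.

Section Geometry.
Context {R : realType}.
Variable Omega : set (space3 R).
Hypothesis oOmega : open Omega.
Implicit Types (k : @chart R) (x p : space3 R) (y : R * R) (z : R).

Local Notation co i x := (vec x 0 i).

Lemma vecD x p : vec (x + p) = vec x + vec p.
Proof. by apply/rowP => i; rewrite coD [RHS]mxE. Qed.

Lemma vecZ (a : R) x : vec (a *: x) = a *: vec x.
Proof. by apply/rowP => i; rewrite coZ [RHS]mxE. Qed.

(** The frame being orthonormal, these inner products invert [chart_pt]. *)
Definition chart_co k j x : R := dot (vec (x - ctr k)) (vec (frame k j)).

Lemma chart_co_continuous k j : continuous (chart_co k j).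
Proof.
have -> : chart_co k j = fun x => (co 0 x - co 0 (ctr k)) * co 0 (frame k j) +
    (co 1 x - co 1 (ctr k)) * co 1 (frame k j) + (co 2 x - co 2 (ctr k)) * co 2 (frame k j).
  by apply/funext => x; rewrite /chart_co dotE !coB.
move=> x; have h i : (co i x' - co i (ctr k)) * co i (frame k j) @[x' --> x] -->
    (co i x - co i (ctr k)) * co i (frame k j).
  apply: cvgM; last exact: cvg_cst.
  by apply: cvgB; [exact: continuous_co|exact: cvg_cst].
by apply: cvgD; [apply: cvgD|]; exact: h.
Qed.

Section OneChart.
Variable k : @chart R.
Hypothesis ck : C11_chart Omega k.

Local Notation g := (gfun k).

Lemma chart_orth i j : dot (vec (frame k i)) (vec (frame k j)) = (i == j)%:R.
Proof. by case: ck => _ ->. Qed.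

Lemma chart_co_pt y z :
  [/\ chart_co k 0 (chart_pt k y z) = y.1, chart_co k 1 (chart_pt k y z) = y.2 &
      chart_co k 2 (chart_pt k y z) = z].
Proof.
have e j : chart_co k j (chart_pt k y z) =
    y.1 * (0 == j)%:R + y.2 * (1 == j)%:R + z * (2 == j)%:R.
  rewrite /chart_co /chart_pt.
  have -> : ctr k + y.1 *: frame k 0 + y.2 *: frame k 1 + z *: frame k 2 - ctr k =
    y.1 *: frame k 0 + y.2 *: frame k 1 + z *: frame k 2.
    by rewrite -!addrA [LHS]addrC !addrA subrK.
  by rewrite !vecD !vecZ !dotDl !dotZl !chart_orth.
by split; rewrite e /=; ring.
Qed.

(** A square matrix with orthonormal rows also has orthonormal columns, so the three frame vectors
    span the space. *)
Lemma chart_ptK x :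
  x = chart_pt k (chart_co k 0 x, chart_co k 1 x) (chart_co k 2 x).
Proof.
pose F : 'M[R]_3 := \matrix_(j, i) co i (frame k j).
have FF : F *m F^T = 1%:M.
  apply/matrixP => i j; rewrite !mxE -chart_orth.
  by apply: eq_bigr => l _; rewrite !mxE.
have {}FF : F^T *m F = 1%:M by exact: mulmx1C.
have e : vec (x - ctr k) = \sum_j chart_co k j x *: vec (frame k j).
  rewrite -[LHS]mulmx1 -FF mulmxA; apply/rowP => i.
  rewrite mxE summxE; apply: eq_bigr => j _; rewrite !mxE; congr (_ * _).
  by apply: eq_bigr => l _; rewrite !mxE.
apply: co_inj => i; rewrite /chart_pt !coD !coZ.
have -> : co i x = co i (ctr k) + co i (x - ctr k) by rewrite coB addrC subrK.
by rewrite e summxE sum_ord3 ![(_ *: vec _) _ _]mxE !addrA.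
Qed.

Lemma squareE y : square k y <-> `|y.1| < Defs.rad k /\ `|y.2| < Defs.rad k.
Proof.
rewrite /square /= prod_normE gt_max; split; first by move/andP.
by move=> [-> ->].
Qed.

Lemma box_co x : box k x <->
  [/\ `|chart_co k 0 x| < Defs.rad k, `|chart_co k 1 x| < Defs.rad k & `|chart_co k 2 x| < hgt k].
Proof.
split=> [[y [z [/squareE[y1 y2] hz ->]]]|[h0 h1 h2]].
  by have [-> -> ->] := chart_co_pt y z.
exists (chart_co k 0 x, chart_co k 1 x), (chart_co k 2 x); split=> //.
  exact/squareE.
exact: chart_ptK.
Qed.

Lemma open_box : open (box k).
Proof.
have o j r : open [set x | `|chart_co k j x| < r].
  rewrite (_ : [set x | _] = chart_co k j @^-1` `]-r, r[%classic); last first.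
    by apply/seteqP; split=> x /=; rewrite in_itv/= ltr_norml.
  by apply: open_comp => [x _|]; [exact: chart_co_continuous|exact: itv_open].
rewrite (_ : box k = [set x | `|chart_co k 0 x| < Defs.rad k] `&`
  [set x | `|chart_co k 1 x| < Defs.rad k] `&` [set x | `|chart_co k 2 x| < hgt k]).
  by apply: openI; [apply: openI|]; exact: o.
by apply/seteqP; split=> x; [move/box_co => [? ? ?]; split; [split|]|
  move=> [[? ?] ?]; apply/box_co].
Qed.

Lemma lipschitzP (A : set (R * R)) (f : R * R -> R) : [lipschitz f y | y in A] ->
  exists2 M : R, 0 < M & forall y y', A y -> A y' -> `|f y - f y'| <= M * `|y - y'|.
Proof.
move=> h; have /filter_ex[M [M0 hM]] : \forall M \near +oo,
    0 < M /\ M.-lipschitz_on f (globally (A `*` A)).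
  near=> M; split; first by near: M; exact: nbhs_pinfty_gt.
  by near: M.
by exists M => // y y' Ay Ay'; exact: (hM (y, y')).
Unshelve. all: by end_near. Qed.

Lemma lipschitz_continuous_at (A : set (R * R)) (f : R * R -> R) y : open A ->
  [lipschitz f y | y in A] -> A y -> {for y, continuous f}.
Proof.
move=> oA /lipschitzP[M M0 hM] Ay; apply/cvgrPdist_le => e e0.
have nA : nbhs y A by apply: open_nbhs_nbhs.
near=> y'; have Ay' : A y' by near: y'; exact: nA.
apply: (le_trans (hM _ _ Ay Ay')).
rewrite mulrC -ler_pdivlMr//; near: y'.
by apply: cvgr_dist_le; [exact: cvg_id|rewrite divr_gt0].
Unshelve. all: by end_near. Qed.

Lemma open_square : open (square k).
Proof.
rewrite (_ : square k = ball (0 : R * R) (Defs.rad k)); last first.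
  by apply/seteqP; split=> y; rewrite /square -ball_normE/= sub0r normrN.
by apply: ball_open; case: ck => -[].
Qed.

Lemma square_dgE y : square k y ->
  {for y, continuous (dg1 k)} /\ {for y, continuous (dg2 k)}.
Proof.
move=> sy; have [_ _ [_ l1 l2] _ _] := ck.
by split; [exact: lipschitz_continuous_at open_square l1 sy|
           exact: lipschitz_continuous_at open_square l2 sy].
Qed.

Lemma chart0 : square k 0.
Proof. by rewrite /square /= normr0; case: ck => -[]. Qed.

Lemma lipschitz_bounded (f : R * R -> R) : [lipschitz f y | y in square k] ->
  exists C : R, forall y, square k y -> `|f y| <= C.
Proof.
move=> /lipschitzP[M M0 hM]; exists (`|f 0| + M * Defs.rad k) => y sy.
rewrite -[f y](subrK (f 0)) (le_trans (ler_normD _ _))// addrC lerD2l.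
apply: (le_trans (hM _ _ sy chart0)); rewrite subr0 ler_pM2l//.
exact: ltW.
Qed.

Lemma dg_bounded : exists2 C : R, 0 <= C &
  forall y, square k y -> `|dg1 k y| <= C /\ `|dg2 k y| <= C.
Proof.
have [_ _ [_ /lipschitz_bounded[C1 h1] /lipschitz_bounded[C2 h2]] _ _] := ck.
exists (Num.max C1 C2).
  by rewrite le_max (le_trans _ (h1 _ chart0)).
by move=> y sy; rewrite !le_max; split; apply/orP; [left; exact: h1|right; exact: h2].
Qed.

Lemma MVT_bound (f df : R -> R) (r C : R) : (forall t : R, `|t| < r -> is_derive t 1 f (df t)) ->
  (forall t : R, `|t| < r -> `|df t| <= C) ->
  forall a b, `|a| < r -> `|b| < r -> `|f b - f a| <= C * `|b - a|.
Proof.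
move=> hd hC; have H a b : a <= b -> `|a| < r -> `|b| < r -> `|f b - f a| <= C * `|b - a|.
  move=> ab; rewrite !ltr_norml => /andP[a1 a2] /andP[b1 b2].
  have inr t : t \in `[a, b] -> `|t| < r.
    rewrite in_itv/= ltr_norml => /andP[ta tb].
    by rewrite (lt_le_trans a1 ta) (le_lt_trans tb b2).
  have [||c hc ->] := @MVT_segment R f df a b ab.
  - by move=> t ht; apply: hd; apply: inr; exact: subset_itv_oo_cc.
  - by apply: derivable_within_continuous => t ht; have [] := hd t (inr t ht).
  - by rewrite normrM ler_wpM2r// hC// inr.
move=> a b ha hb; have [ab|/ltW ba] := leP a b; first exact: H.
by rewrite distrC [ `|b - a|]distrC; exact: H.
Qed.

(** A chart only provides partial derivatives. They are bounded on the square, and the mean value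
    theorem is applied to one variable at a time. *)
Lemma gfun_lip : exists2 C : R, 0 <= C & forall y y', square k y -> square k y' ->
  `|g y' - g y| <= C * (`|y'.1 - y.1| + `|y'.2 - y.2|).
Proof.
have [_ _ [gd _ _] _ _] := ck.
have [C C0 hC] := dg_bounded; exists C => // -[a b] [a' b'] sab sab'.
have /squareE[/= a1 b1] := sab; have /squareE[/= a1' b1'] := sab'.
have sq (p q : R) : `|p| < Defs.rad k -> `|q| < Defs.rad k -> square k (p, q).
  by move=> hp hq; apply/squareE.
have D1 (t q : R) : `|t| < Defs.rad k -> `|q| < Defs.rad k ->
    is_derive t 1 (fun s => g (s, q)) (dg1 k (t, q)).
  move=> ht hq; have [d1 _] := gd _ (sq _ _ ht hq).
  have E : (fun h : R => h^-1 *: (((fun s => g (s, q)) \o shift t) (h *: 1) - g (t, q))) =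
    (fun h : R => h^-1 *: ((g \o shift (t, q)) (h *: ((1, 0) : R * R)) - g (t, q))).
    apply/funext => h /=; congr (_ *: (g _ - _)).
    by congr pair; rewrite /= /GRing.scale/= ?mulr0 ?add0r.
  by apply: DeriveDef; [rewrite /derivable E|rewrite /derive E].
have D2 (t q : R) : `|t| < Defs.rad k -> `|q| < Defs.rad k ->
    is_derive q 1 (fun s => g (t, s)) (dg2 k (t, q)).
  move=> ht hq; have [_ d1] := gd _ (sq _ _ ht hq).
  have E : (fun h : R => h^-1 *: (((fun s => g (t, s)) \o shift q) (h *: 1) - g (t, q))) =
    (fun h : R => h^-1 *: ((g \o shift (t, q)) (h *: ((0, 1) : R * R)) - g (t, q))).
    apply/funext => h /=; congr (_ *: (g _ - _)).
    by congr pair; rewrite /= /GRing.scale/= ?mulr0 ?add0r.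
  by apply: DeriveDef; [rewrite /derivable E|rewrite /derive E].
(* The intermediate point (a, b') stays in the square, which is a product of intervals. *)
rewrite /= mulrDr -(subrK (g (a, b')) (g (a', b'))) -addrA.
apply: (le_trans (ler_normD _ _)); apply: lerD.
  apply: (@MVT_bound (fun s => g (s, b')) (fun s => dg1 k (s, b')) (Defs.rad k)) => // t ht.
    exact: D1.
  by have [] := hC _ (sq _ _ ht b1').
apply: (@MVT_bound (fun s => g (a, s)) (fun s => dg2 k (a, s)) (Defs.rad k)) => // t ht.
  exact: D2.
by have [] := hC _ (sq _ _ a1 ht).
Qed.

(* The Lipschitz bound on the graph function replaces its continuity: the
   function [F] is a continuous lower bound for the height above the graph. *)
Lemma chart_above_nbhs y z : square k y -> `|z| < hgt k -> g y < z ->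
  \forall x \near chart_pt k y z, ~ Omega x.
Proof.
move=> sy hz gz; have [_ _ _ gh Om] := ck.
have [C C0 hC] := gfun_lip; set p := chart_pt k y z.
have [e0 e1 e2] : [/\ chart_co k 0 p = y.1, chart_co k 1 p = y.2 & chart_co k 2 p = z].
  exact: chart_co_pt.
have bp : box k p by exists y, z.
pose F x := chart_co k 2 x - C * (`|chart_co k 0 x - y.1| + `|chart_co k 1 x - y.2|).
have cF : F x @[x --> p] --> F p.
  apply: cvgB; first exact: chart_co_continuous.
  apply: cvgM; first exact: cvg_cst.
  by apply: cvgD; apply: cvg_norm; (apply: cvgB; [exact: chart_co_continuous|exact: cvg_cst]).
have Fp : g y < F p by rewrite /F e0 e1 e2 !subrr normr0 addr0 mulr0 subr0.
have nb : nbhs p (box k) by apply: open_nbhs_nbhs; split=> //; exact: open_box.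
near=> x; have bx : box k x by near: x; exact: nb.
have gF : g y < F x by near: x; exact: (cvgr_gt _ cF).
have /box_co[h0 h1 h2] := bx.
have sx : square k (chart_co k 0 x, chart_co k 1 x) by exact/squareE.
rewrite [x]chart_ptK => /(Om _ _ sx h2); apply/negP; rewrite -leNgt.
have := hC _ _ sy sx; rewrite ler_norml /= => /andP[_ h].
by move: gF; rewrite /F => gF; lra.
Unshelve. all: by end_near. Qed.

(** A point above the graph has a neighbourhood missing [Omega], so it is not in the closure; a
    point below lies in the open set [Omega], hence in its interior. *)
Lemma bdry_box_graph p : bdry Omega p -> box k p ->
  exists2 y, square k y & p = chart_pt k y (g y).
Proof.
move=> [cp np] [y [z [sy hz E]]]; exists y => //; rewrite E; congr chart_pt.
have [_ _ _ gh Om] := ck.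
apply/eqP; rewrite eq_le; apply/andP; split; rewrite leNgt; apply/negP => h.
  have := chart_above_nbhs sy hz h; rewrite -E => hn.
  by have [x [Ox nOx]] := cp _ hn.
apply: np; rewrite /interior; apply: open_nbhs_nbhs; split=> //.
by rewrite E; apply/Om.
Qed.

Lemma area_continuous y : square k y -> {for y, continuous (area_elt k)}.
Proof.
move=> /square_dgE[c1 c2]; rewrite /area_elt.
apply: (@continuous_comp _ _ _ (fun y => 1 + dg1 k y ^+ 2 + dg2 k y ^+ 2) Num.sqrt).
  apply: cvgD; last exact: (cvg_comp _ _ c2 (@exprn_continuous R 2 _)).
  apply: cvgD; first exact: cvg_cst.
  exact: (cvg_comp _ _ c1 (@exprn_continuous R 2 _)).
exact: sqrt_continuous.
Qed.

Lemma area_gt0 y : 0 < area_elt k y.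
Proof.
by rewrite sqrtr_gt0 -addrA ltr_pwDl// addr_ge0// sqr_ge0.
Qed.

Lemma area_sqr y : area_elt k y ^+ 2 = 1 + dg1 k y ^+ 2 + dg2 k y ^+ 2.
Proof. by rewrite sqr_sqrtr// !addr_ge0// sqr_ge0. Qed.

Lemma area_bounded : exists2 M : R, 0 <= M & forall y, square k y -> area_elt k y <= M.
Proof.
have [C C0 hC] := dg_bounded; exists (1 + C + C) => [|y sy]; first by lra.
have [h1 h2] := hC y sy.
have M0 : 0 <= 1 + C + C by lra.
rewrite -(ler_pXn2r (ltn0Sn 1)) ?nnegrE ?(ltW (area_gt0 y))// area_sqr.
rewrite -(real_normK (num_real (dg1 k y))) -(real_normK (num_real (dg2 k y))).
have := normr_ge0 (dg1 k y); have := normr_ge0 (dg2 k y).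
by nra.
Qed.

(** The formula for the normal, read at the projection of x to the chart plane: this extends it from
    the graph to the whole box, where it is continuous. *)
Definition chart_normal x i : R := let y := (chart_co k 0 x, chart_co k 1 x) in
  (area_elt k y)^-1 * (co i (frame k 2) - dg1 k y * co i (frame k 0) - dg2 k y * co i (frame k 1)).

Lemma chart_normal_continuous x i : box k x ->
  {for x, continuous (fun x => chart_normal x i)}.
Proof.
move=> /box_co[h0 h1 _]; set y0 := (chart_co k 0 x, chart_co k 1 x).
have sy : square k y0 by apply/squareE.
have cy : (chart_co k 0 x', chart_co k 1 x') @[x' --> x] --> y0.
  have n0 : chart_co k 0 x' @[x' --> x] --> chart_co k 0 x by exact: chart_co_continuous.
  have n1 : chart_co k 1 x' @[x' --> x] --> chart_co k 1 x by exact: chart_co_continuous.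
  exact: cvg_pair n0 n1.
have [c1 c2] := square_dgE sy; have c3 := area_continuous sy.
have k1 := cvg_comp _ _ cy c1; have k2 := cvg_comp _ _ cy c2.
have k3 := cvg_comp _ _ cy c3.
apply: cvgM; first by apply: cvgV => //; rewrite gt_eqF// area_gt0.
by apply: cvgB; [apply: cvgB; [exact: cvg_cst|]|];
  (apply: cvgM; [|exact: cvg_cst]); [exact: k1|exact: k2].
Qed.

End OneChart.

Lemma open_continuous_measurable3 (E : set (space3 R)) (f : space3 R -> R) : open E ->
  (forall x, E x -> {for x, continuous f}) -> measurable_fun (E : set (mspace3 R)) f.
Proof.
move=> oE cf; apply: (measurability _ (RGenOpens.measurableE R)) => //.
move=> _ [_ [a [b ->]] <-]; apply: open_measurable3; rewrite openE => x [Ex fx].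
apply: filterI; first exact: open_nbhs_nbhs.
by apply: (cf x Ex); apply: open_nbhs_nbhs; split=> //; exact: itv_open.
Qed.

(** The area formula bounds the measure of the box by the largest area element times the area of the
    square. *)
Lemma box_sigma_finite (sigma : {measure set (mspace3 R) -> \bar R}) k :
  C11_chart Omega k -> is_surface_measure Omega sigma -> (sigma (box k) < +oo)%E.
Proof.
move=> ck [_ hs].
have ob := open_box ck.
rewrite (hs k ck _ (open_measurable3 ob))//.
have -> : square k `&` [set y | box k (chart_pt k y (gfun k y))] = square k.
  apply/seteqP; split=> [y []//|y sy]; split=> //; exists y, (gfun k y); split=> //.
  by case: ck => _ _ _ ->.
(* Measurability in the plane is obtained from that in space: sets and functions are extended to
   vertical cylinders and pulled back along y -> (y, 0). *)
have o3 : open [set x : space3 R | square k x.1].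
  by apply: open_comp => [x _|]; [exact: cvg_fst|exact: open_square].
have mi : measurable_fun [set: (measurableTypeR R * measurableTypeR R)%type]
    (fun y => (y, 0 : measurableTypeR R) : mspace3 R).
  by apply: measurable_fun_pair; [exact: measurable_id|exact: measurable_cst].
have ms : measurable (square k : set (measurableTypeR R * measurableTypeR R)).
  have := mi measurableT _ (open_measurable3 o3); rewrite setTI.
  by congr measurable; apply/seteqP.
have ma : measurable_fun (square k : set (measurableTypeR R * measurableTypeR R)) (area_elt k).
  have := @open_continuous_measurable3 [set x | square k x.1] (fun x => area_elt k x.1) o3.
  move=> /(_ _) h.
  have h' : measurable_fun ([set x | square k x.1] : set (mspace3 R)) (fun x => area_elt k x.1).
    apply: h => x sx; apply: (@continuous_comp _ _ _ fst (area_elt k)); first exact: cvg_fst.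
    exact: area_continuous ck _ sx.
  apply: (measurable_comp _ _ h' (measurable_funS measurableT (@subsetT _ _) mi)).
    exact: open_measurable3.
  by move=> _ [y sy <-].
have [M M0 hM] := area_bounded ck.
apply: (@le_lt_trans _ _ (\int[leb2]_(y in square k) (M%:E))%E).
  apply: ge0_le_integral => //.
  - by move=> y _; rewrite lee_fin ltW// area_gt0.
  - exact/measurable_EFinP.
rewrite integral_cst//.
have fs : (leb2 (square k : set (measurableTypeR R * measurableTypeR R)) < +oo)%E.
  pose J : set R := `]- Defs.rad k, Defs.rad k[%classic.
  have -> : square k = J `*` J.
    have JE (r : R) : J r <-> `|r| < Defs.rad k by rewrite /J /= in_itv/= ltr_norml.
    apply/seteqP; split=> y; first by move=> /squareE[h1 h2]; split; exact/JE.
    by move=> [/JE h1 /JE h2]; exact/squareE.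
  rewrite /leb2/= product_measure1E; [|exact: measurable_itv..].
  have fl : (@lebesgue_measure R J < +oo)%E.
    by rewrite lebesgue_measure_itv/=; case: ifP => _; rewrite ?ltry// -EFinB ltry.
  by apply: lte_mul_pinfty => //; rewrite ge0_fin_numE.
by rewrite lte_mul_pinfty.
Qed.

End Geometry.

(** * Compactness of the boundary, its finite area and the unit normal *)

Section Boundary.
Context {R : realType}.
Variables (Omega : set (space3 R)) (nu : space3 R -> 'rV[R]_3)
  (sigma : {measure set (mspace3 R) -> \bar R}).
Hypotheses (oOmega : open Omega) (bOmega : bounded_set Omega)
  (cOmega : C11_boundary Omega) (hnu : is_outer_normal Omega nu)
  (hsigma : is_surface_measure Omega sigma).

Local Notation co i x := (vec x 0 i).

Lemma closed_cbox (l u : 'I_3 -> R) : closed (cbox l u).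
Proof. apply: compact_closed; [exact: norm_hausdorff|exact: cbox_compact]. Qed.

Lemma bounded_closure : exists M : R, closure Omega `<=` cbox (fun=> - M) (fun=> M).
Proof.
have [M hM] : exists M : R, forall x, Omega x -> `|x| <= M.
  by have [M hM] := @filter_ex _ (pinfty_nbhs R) _ _ bOmega; exists M.
exists M; rewrite [X in _ `<=` X](closure_id _).1; last exact: closed_cbox.
apply: closure_subset => x Ox i; rewrite -ler_norml; apply: le_trans (hM x Ox).
rewrite !prod_normE coE !le_max.
by case: ifP => _; [rewrite lexx|case: ifP => _; rewrite lexx ?orbT].
Qed.

Lemma bdry_compact : compact (bdry Omega).
Proof.
have [M hM] := bounded_closure.
apply: (subclosed_compact _ (@cbox_compact R (fun=> - M) (fun=> M))).
  apply: closedI; first exact: closed_closure.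
  by apply: open_closedC; exact: open_interior.
by move=> x [/hM].
Qed.

Lemma measurable_bdry : measurable (bdry Omega : set (mspace3 R)).
Proof.
have c := compact_closed (@norm_hausdorff _ _) bdry_compact.
rewrite -[bdry Omega]setCK; apply: measurableC; apply: open_measurable3.
exact: closed_openC.
Qed.

Lemma leb3_Omega_finite : (leb3 (Omega : set (mspace3 R)) < +oo)%E.
Proof.
have [M hM] := bounded_closure.
pose J : set R := `[- M, M]%classic.
have mJ : measurable J by exact: measurable_itv.
have sub : Omega `<=` (J `*` J) `*` J.
  move=> x /subset_closure/hM h; have := h 0; have := h 1; have := h 2.
  by rewrite !coE/= => h2 h1 h0; split; [split|]; rewrite /J /= in_itv.
apply: (@le_lt_trans _ _ (leb3 ((J `*` J) `*` J : set (mspace3 R)))).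
  apply: le_measure => //; rewrite inE; first exact: open_measurable3.
  by apply: measurableX => //; exact: measurableX.
have fl : (@lebesgue_measure R J < +oo)%E.
  by rewrite lebesgue_measure_itv/=; case: ifP => _; rewrite ?ltry// -EFinB ltry.
rewrite /leb3/= product_measure1E//; last exact: measurableX.
rewrite /leb2/= product_measure1E//.
have f2 : (@lebesgue_measure R J * @lebesgue_measure R J < +oo)%E.
  by apply: lte_mul_pinfty => //; rewrite ge0_fin_numE.
by apply: lte_mul_pinfty => //; [exact: mule_ge0|rewrite ge0_fin_numE//; exact: mule_ge0].
Qed.

Lemma finite_charts : exists (N : nat) (ks : nat -> @chart R),
  (forall n, (n < N)%N -> C11_chart Omega (ks n)) /\
  (forall p, bdry Omega p -> exists2 n, (n < N)%N & box (ks n) p).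
Proof.
have /choice[K hK] : forall p : space3 R, exists k : @chart R,
    bdry Omega p -> ctr k = p /\ C11_chart Omega k.
  move=> p; have [bp|nbp] := pselect (bdry Omega p).
    by have [k hk] := cOmega bp; exists k.
  (* A dummy chart off the boundary makes the choice function total; nothing is claimed about it. *)
  by exists (Chart 0 (fun=> 0) 0 0 (fun=> 0)).
have cc : @cover_compact (space3 R) (bdry Omega).
  have H (V : normedModType R) (A : set V) : compact A -> @cover_compact V A.
    by rewrite -compact_cover.
  exact: (H (space3 R : normedModType R) (bdry Omega) bdry_compact).
have := cc (space3 R) (bdry Omega) (fun p => box (K p)).
case.
- by move=> p bp; have [_ ck] := hK p bp; exact: (open_box ck).
- move=> p bp; exists p => //; have [e ck] := hK p bp; apply/(box_co ck).
  have [[r0 h0] _ _ _ _] := ck.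
  have c0 j : chart_co (K p) j p = 0.
    rewrite /chart_co e subrr dotE.
    by rewrite !(coE (0 : space3 R)) /= !mul0r !addr0.
  by rewrite !c0 normr0.
move=> F FD cov; pose s := enum_fset F.
exists (size s), (fun n => K (nth 0 s n)); split.
  move=> n ns; have : nth 0 s n \in F by exact: mem_nth.
  by move/FD; rewrite inE => /hK[].
move=> p /cov[q /= qF bq]; exists (index q s); first by rewrite index_mem.
by rewrite nth_index.
Qed.

Lemma sigma_bdry_finite : (sigma (bdry Omega : set (mspace3 R)) < +oo)%E.
Proof.
have [N [ks [hc hb]]] := finite_charts.
pose B n : set (mspace3 R) := if (n < N)%N then box (ks n) else set0.
have mB n : measurable (B n).
  rewrite /B; case: ifPn => // nN; apply: open_measurable3; exact: open_box (hc n nN).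
apply: (@le_lt_trans _ _ (\sum_(n < N) sigma (B n))%E).
  apply: content_subadditive => //.
    exact: measurable_bdry.
  move=> p bp; have [n nN bn] := hb p bp.
  by rewrite -bigcup_mkord; exists n => //; rewrite /B nN.
apply: lte_sum_pinfty => n _; rewrite /B ltn_ord.
exact: box_sigma_finite (hc _ (ltn_ord n)) hsigma.
Qed.

Lemma nu_chart k x : C11_chart Omega k -> bdry Omega x -> box k x ->
  forall i, nu x 0 i = chart_normal k x i.
Proof.
move=> ck bx bkx; have [y sy E] := bdry_box_graph oOmega ck bx bkx.
have [e0 e1 e2] := chart_co_pt ck y (gfun k y).
move=> i; rewrite {1}E (hnu ck sy) /chart_normal E e0 e1 -surjective_pairing.
by rewrite coZ !coB !coZ.
Qed.

Lemma nu_unit x : bdry Omega x -> dot (nu x) (nu x) = 1.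
Proof.
move=> bx; have [N [ks [hc hb]]] := finite_charts.
have [n nN bn] := hb x bx; have ck := hc n nN; set k := ks n in bn ck.
have h := nu_chart ck bx bn.
rewrite dotE !h /chart_normal.
set y := (_, _); set a := area_elt k y.
have a0 : 0 < a by exact: area_gt0.
have o i j := chart_orth ck i j.
have := o 2 2; have := o 2 0; have := o 2 1; have := o 0 0; have := o 0 1; have := o 1 1.
rewrite !dotE !eqxx /=.
set f00 := co 0 (frame k 0); set f01 := co 1 (frame k 0); set f02 := co 2 (frame k 0).
set f10 := co 0 (frame k 1); set f11 := co 1 (frame k 1); set f12 := co 2 (frame k 1).
set f20 := co 0 (frame k 2); set f21 := co 1 (frame k 2); set f22 := co 2 (frame k 2).
move=> h11 h01 h00 h21 h20 h22.
have as2 : a ^+ 2 = 1 + dg1 k y ^+ 2 + dg2 k y ^+ 2 by exact: area_sqr.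
set d := dg1 k y in as2 *; set e := dg2 k y in as2 *.
(* Expansion of the squared length of frame 2 - d frame 0 - e frame 1 in the six inner products of
   the frame, each of which is 0 or 1. *)
transitivity (a ^- 2 * ((f20 * f20 + f21 * f21 + f22 * f22)
  + d ^+ 2 * (f00 * f00 + f01 * f01 + f02 * f02)
  + e ^+ 2 * (f10 * f10 + f11 * f11 + f12 * f12)
  - 2 * d * (f20 * f00 + f21 * f01 + f22 * f02)
  - 2 * e * (f20 * f10 + f21 * f11 + f22 * f12)
  + 2 * d * e * (f00 * f10 + f01 * f11 + f02 * f12))).
  rewrite (_ : a ^- 2 = a^-1 * a^-1); last by rewrite expr2 invfM.
  by move: a^-1 => ai; ring.
rewrite h11 h01 h00 h21 h20 h22 !mulr0 !mulr1 !subr0 addr0 -as2.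
by rewrite mulVf// expf_neq0// gt_eqF.
Qed.

(** [nu] is prescribed at boundary points only, but on each of finitely many boxes covering the
    boundary it agrees there with the continuous [chart_normal]. *)
Lemma measurable_nu i :
  measurable_fun (bdry Omega : set (mspace3 R)) (fun x => nu x 0 i).
Proof.
have [N [ks [hc hb]]] := finite_charts.
pose B n : set (mspace3 R) := bdry Omega `&` if (n < N)%N then box (ks n) else set0.
have mbox n : measurable ((if (n < N)%N then box (ks n) else set0) : set (mspace3 R)).
  case: ifPn => // nN; apply: open_measurable3; exact: open_box (hc n nN).
have -> : bdry Omega = \bigcup_n B n.
  apply/seteqP; split=> [p bp|p [n _ []]//].
  by have [n nN bn] := hb p bp; exists n => //; split=> //; rewrite nN.
have mB n : measurable (B n) by apply: measurableI => //; exact: measurable_bdry.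
apply/measurable_fun_bigcup => // n.
have [nN|nN] := boolP (n < N)%N; last first.
  rewrite /B (negPf nN) setI0; exact: measurable_fun_set0.
have ck := hc n nN.
apply: (@eq_measurable_fun _ _ _ _ _ (fun x => chart_normal (ks n) x i)).
  move=> x; rewrite inE /B nN => -[bx bkx].
  by rewrite (nu_chart ck bx bkx).
apply: (@measurable_funS _ _ _ _ (box (ks n))).
- by apply: open_measurable3; exact: open_box ck.
- by rewrite /B nN => x [].
- apply: open_continuous_measurable3; first exact: open_box ck.
  by move=> x bx; exact: (chart_normal_continuous ck bx).
Qed.

End Boundary.

(** * The space X_T and tangential traces *)

Section ComplexLimits.
Context {R : realType}.
Implicit Types (z w : nat -> R[i]) (l m a : R[i]).

Definition ccvg z l := forall e : R, 0 < e -> exists N, forall n, (N <= n)%N ->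
  absq (l - z n) <= e.

Lemma ccvg_unique z l m : ccvg z l -> ccvg z m -> l = m.
Proof.
move=> hl hm; apply: absq_small_eq => e e0.
have e4 : 0 < e / 4 by rewrite divr_gt0.
have [N hN] := hl _ e4; have [M hM] := hm _ e4.
have := hN (maxn N M) (leq_maxl _ _); have := hM (maxn N M) (leq_maxr _ _).
set p := z _ => h1 h2.
have := absqD_le (l - p) (- (m - p)); rewrite absqN opprB addrA subrK => h.
by apply: (le_trans h); lra.
Qed.

Lemma ccvgD z w l m : ccvg z l -> ccvg w m -> ccvg (fun n => z n + w n) (l + m).
Proof.
move=> hl hm e e0; have e4 : 0 < e / 4 by rewrite divr_gt0.
have [N hN] := hl _ e4; have [M hM] := hm _ e4.
exists (maxn N M) => n; rewrite geq_max => /andP[Nn Mn].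
have h1 := hN n Nn; have h2 := hM n Mn.
rewrite (_ : _ - _ = (l - z n) + (m - w n)); last by rewrite opprD addrACA.
by apply: (le_trans (absqD_le _ _)); lra.
Qed.

Lemma ccvg_cst l : ccvg (fun=> l) l.
Proof. by move=> e e0; exists 0%N => n _; rewrite subrr absq0 ltW. Qed.

Lemma ccvgZ a z l : ccvg z l -> ccvg (fun n => a * z n) (a * l).
Proof.
move=> hl e e0; have a1 : 0 < absq a + 1 by rewrite ltr_wpDl ?absq_ge0.
have [N hN] := hl (e / (absq a + 1)) (divr_gt0 e0 a1).
exists N => n Nn; rewrite -mulrBr absqM.
apply: (@le_trans _ _ ((absq a + 1) * absq (l - z n))).
  by rewrite ler_wpM2r ?absq_ge0// lerDl.
by rewrite mulrC -ler_pdivlMr// hN.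
Qed.

Lemma ccvg_ext z w l : (forall n, z n = w n) -> ccvg z l -> ccvg w l.
Proof. by move=> /funext ->. Qed.

End ComplexLimits.

Section L2Convergence.
Context {R : realType}.
Variables (mu : {measure set (mspace3 R) -> \bar R}) (D : set (space3 R)).
Hypothesis mD : measurable (D : set (mspace3 R)).

Local Notation nsq f := (fine (sqL2 mu D f)).
Local Notation nsqv f := (fine (sqL2v mu D f)).
Local Notation pair u v := (cint mu D (fun x => dot (u x) (v x))).

Definition scvg (f : nat -> space3 R -> R[i]) g := forall e : R, 0 < e ->
  exists N, forall n, (N <= n)%N -> nsq (g - f n) <= e.

Definition vcvg (f : nat -> cfield R) g := forall e : R, 0 < e ->
  exists N, forall n, (N <= n)%N -> nsqv (g - f n) <= e.

Lemma ccvg_bound (z : nat -> R[i]) (l : R[i]) (C : R) (s : nat -> R) : 0 <= C ->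
  (forall n, absq (l - z n) <= C * s n) ->
  (forall e : R, 0 < e -> exists N, forall n, (N <= n)%N -> s n <= e) -> ccvg z l.
Proof.
move=> C0 hz hs e e0; have C1 : 0 < C + 1 by rewrite ltr_wpDl.
have [N hN] := hs (e / (C + 1)) (divr_gt0 e0 C1).
exists N => n Nn; apply: (le_trans (hz n)).
have [s0|s0] := leP 0 (s n); last first.
  by apply: le_trans (ltW e0); rewrite mulr_ge0_le0// ltW.
apply: (@le_trans _ _ ((C + 1) * s n)); first by rewrite ler_wpM2r// lerDl.
by rewrite mulrC -ler_pdivlMr// hN.
Qed.

Lemma ccvg_pair (f : nat -> cfield R) (g v : cfield R) : (forall n, L2v mu D (f n)) ->
  L2v mu D g -> L2v mu D v -> vcvg f g -> ccvg (fun n => pair (f n) v) (pair g v).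
Proof.
move=> hf hg hv; apply: (@ccvg_bound _ _ (20 * nsqv v)).
  by rewrite mulr_ge0// fine_ge0// sqL2v_ge0.
move=> n; rewrite -[pair (f n) v]mul1r -mulNr -pairZl// -pairDl//; last exact: L2vZ.
rewrite scaleN1r mulrAC; apply: absq_pair_le => //; exact: L2vB.
Qed.

Lemma ccvg_spair (f : nat -> space3 R -> R[i]) (g v : space3 R -> R[i]) :
  (forall n, L2 mu D (f n)) -> L2 mu D g -> L2 mu D v -> scvg f g ->
  ccvg (fun n => cint mu D (fun x => f n x * v x)) (cint mu D (fun x => g x * v x)).
Proof.
move=> hf hg hv; apply: (@ccvg_bound _ _ (2 * nsq v)).
  by rewrite mulr_ge0// fine_ge0// sqL2_ge0.
move=> n; rewrite -[cint mu D (fun x => f n x * v x)]mul1r -mulNr -cint_mulZl//.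
rewrite -cint_mulDl//; last exact: L2Z.
rewrite mulrAC; have := absq_cint_mul_le mD (L2B mD hg (hf n)) hv.
by congr (absq _ <= _); apply: eq_cint => x _; rewrite mulN1r.
Qed.

Lemma pair_null (u u' v : cfield R) : L2v mu D u -> L2v mu D u' -> L2v mu D v ->
  sqL2v mu D (u - u') = 0%E -> pair u v = pair u' v.
Proof.
move=> hu hu' hv h0; apply/eqP; rewrite -subr_eq0; apply/eqP/absq_eq0.
rewrite -[pair u' v]mul1r -mulNr -pairZl// -pairDl//; last exact: L2vZ.
apply/eqP; rewrite eq_le absq_ge0 andbT scaleN1r.
have := absq_pair_le mD (L2vB mD hu hu') hv.
by rewrite h0 /= mulr0 mul0r.
Qed.

Lemma spair_null (u u' v : space3 R -> R[i]) : L2 mu D u -> L2 mu D u' -> L2 mu D v ->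
  sqL2 mu D (u - u') = 0%E ->
  cint mu D (fun x => u x * v x) = cint mu D (fun x => u' x * v x).
Proof.
move=> hu hu' hv h0; apply/eqP; rewrite -subr_eq0; apply/eqP/absq_eq0.
rewrite -[cint mu D (fun x => u' x * v x)]mul1r -mulNr -cint_mulZl//.
rewrite -cint_mulDl//; last exact: L2Z.
apply/eqP; rewrite eq_le absq_ge0 andbT.
have := absq_cint_mul_le mD (L2B mD hu hu') hv.
rewrite h0 /= mulr0 mul0r; congr (absq _ <= _).
by apply: eq_cint => x _; rewrite mulN1r.
Qed.

Lemma L2_bounded_mul (b : space3 R -> R) (M : R) (f : space3 R -> R[i]) :
  measurable_fun (D : set (mspace3 R)) b -> (forall x, D x -> `|b x| <= M) ->
  L2 mu D f -> L2 mu D (fun x => (b x)%:C%C * f x).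
Proof.
move=> mb hb hf; have [mR mI fin] := hf; split.
- by under eq_fun do rewrite ReM /= mul0r subr0; exact: measurable_funM.
- by under eq_fun do rewrite ImM /= mul0r addr0; exact: measurable_funM.
have ma : measurable_fun (D : set (mspace3 R)) (fun x => (absq (f x))%:E).
  exact: measurable_absq hf.
apply: (@le_lt_trans _ _ (\int[mu]_(x in D) ((M ^+ 2)%:E * (absq (f x))%:E))%E).
  apply: ge0_le_integral => //.
  - by move=> x _; rewrite lee_fin absq_ge0.
  - under eq_fun do rewrite absqM absq_real EFinM.
    apply: emeasurable_funM => //; apply/measurable_EFinP; exact: measurable_funX.
  - exact: measurable_funeM.
  - move=> x Dx; rewrite absqM absq_real -EFinM lee_fin ler_wpM2r ?absq_ge0//.
    rewrite -(real_normK (num_real (b x))) ler_pXn2r ?nnegrE ?hb//.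
    exact: le_trans (hb x Dx).
rewrite ge0_integralZl_EFin ?sqr_ge0//; last first.
  by move=> x _; rewrite lee_fin absq_ge0.
by rewrite -/(sqL2 mu D f) (sqL2_fineK mD hf) -EFinM ltry.
Qed.

Hypothesis finD : (mu D < +oo)%E.

Lemma L2_cst (c : R[i]) : L2 mu D (fun=> c).
Proof.
split; [exact: measurable_cst..|].
by rewrite /sqL2 integral_cst// lte_mul_pinfty// lee_fin absq_ge0.
Qed.

Lemma L2_bounded (b : space3 R -> R) (M : R) :
  measurable_fun (D : set (mspace3 R)) b -> (forall x, D x -> `|b x| <= M) ->
  L2 mu D (fun x => (b x)%:C%C).
Proof.
move=> mb hb; have := L2_bounded_mul mb hb (L2_cst 1); congr (L2 _ _ _).
by apply/funext => x; rewrite mulr1.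
Qed.

End L2Convergence.

Section Differences.
Context {R : realType}.
Variables (mu : {measure set (mspace3 R) -> \bar R}) (D : set (space3 R)).
Hypothesis mD : measurable (D : set (mspace3 R)).

Lemma pairBl (u v w : cfield R) : L2v mu D u -> L2v mu D v -> L2v mu D w ->
  cint mu D (fun x => dot ((u - v) x) (w x)) =
  cint mu D (fun x => dot (u x) (w x)) - cint mu D (fun x => dot (v x) (w x)).
Proof.
move=> hu hv hw; rewrite -scaleN1r pairDl//; last exact: L2vZ.
by rewrite pairZl// mulN1r.
Qed.

Lemma cint_mulBl (f g h : space3 R -> R[i]) : L2 mu D f -> L2 mu D g -> L2 mu D h ->
  cint mu D (fun x => (f x - g x) * h x) =
  cint mu D (fun x => f x * h x) - cint mu D (fun x => g x * h x).
Proof.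
move=> hf hg hh; rewrite cint_mulDl//; last exact: L2N.
congr (_ + _); rewrite -mulN1r -cint_mulZl//.
by apply: eq_cint => x _; rewrite mulN1r.
Qed.

End Differences.

Section TestFields.
Context {R : realType}.

Lemma smooth_continuous (phi : space3 R -> R) : smooth phi -> continuous phi.
Proof. by move=> /(_ [::])[]. Qed.

Lemma smooth_pd_continuous (phi : space3 R -> R) i : smooth phi -> continuous (pd i phi).
Proof. by move=> /(_ [:: i])[]. Qed.

Lemma continuous_cbox_bounded (f : space3 R -> R) l u : continuous f ->
  exists M : R, forall x, cbox l u x -> `|f x| <= M.
Proof.
move=> cf; have : compact (f @` cbox l u).
  apply: continuous_compact; last exact: cbox_compact.
  exact: continuous_subspaceT.
move=> /compact_bounded h; have [M hM] := @filter_ex _ (pinfty_nbhs R) _ _ h.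
by exists M => x hx; apply: hM; exists x.
Qed.

Variables (mu : {measure set (mspace3 R) -> \bar R}) (D : set (space3 R)) (l u : 'I_3 -> R).
Hypothesis mD : measurable (D : set (mspace3 R)).
Hypothesis finD : (mu D < +oo)%E.
Hypothesis subD : D `<=` cbox l u.

Lemma L2_test (f : space3 R -> R) : continuous f -> L2 mu D (fun x => (f x)%:C%C).
Proof.
move=> cf; have [M hM] := continuous_cbox_bounded l u cf.
apply: (@L2_bounded _ _ _ mD finD f M); first exact: smooth_measurable.
by move=> x /subD; exact: hM.
Qed.

Lemma L2v_test (psi : space3 R -> 'rV[R]_3) : (forall i, continuous (fun x => psi x 0 i)) ->
  L2v mu D (fun x => toC (psi x)).
Proof.
move=> cpsi i; have := L2_test (cpsi i); congr (L2 _ _ _).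
by apply/funext => x; rewrite mxE.
Qed.

Lemma L2v_smooth psi : smoothv psi -> L2v mu D (fun x => toC (psi x)).
Proof. by move=> sp; apply: L2v_test => i; exact: smooth_continuous. Qed.

Lemma L2v_curl_test psi : smoothv psi -> L2v mu D (fun x => toC (curl_cl psi x)).
Proof.
move=> sp; apply: L2v_test => i.
have -> : (fun x => curl_cl psi x 0 i) = fun x => pd (i + 1) (fun y => psi y 0 (i + 2)) x
          - pd (i + 2) (fun y => psi y 0 (i + 1)) x.
  by apply/funext => x; rewrite mxE.
by move=> x; apply: cvgB; exact: smooth_pd_continuous.
Qed.

Lemma L2v_grad_test phi : smooth phi -> L2v mu D (fun x => toC (grad_cl phi x)).
Proof.
move=> sp; apply: L2v_test => i.
have -> : (fun x => grad_cl phi x 0 i) = pd i phi by apply/funext => x; rewrite mxE.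
exact: smooth_pd_continuous.
Qed.

Lemma L2_smooth phi : smooth phi -> L2 mu D (fun x => (phi x)%:C%C).
Proof. by move=> sp; apply: L2_test; exact: smooth_continuous. Qed.

End TestFields.

(** * The space X_T with explicit weak curls and divergences *)

Section WeakSpace.
Context {R : realType}.
Variable Omega : set (space3 R).
Hypotheses (oOmega : open Omega) (bOmega : bounded_set Omega).
Implicit Types (u v w : cfield R) (d : space3 R -> R[i]) (a : R[i]).

Let mO : measurable (Omega : set (mspace3 R)) := open_measurable3 oOmega.
Let fO := leb3_Omega_finite oOmega bOmega.

Local Notation L2vO := (L2v leb3 Omega).
Local Notation L2O := (L2 leb3 Omega).
Local Notation pair u v := (cint leb3 Omega (fun x => dot (u x) (v x))).
Local Notation spair f g := (cint leb3 Omega (fun x => f x * g x)).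
Local Notation nullv u := (sqL2v leb3 Omega u = 0%E).
Local Notation nulls f := (sqL2 leb3 Omega f = 0%E).

Lemma Omega_cbox : exists M : R, Omega `<=` cbox (fun=> - M) (fun=> M).
Proof.
by have [M hM] := bounded_closure bOmega; exists M => x /subset_closure/hM.
Qed.

Lemma test_curl psi : smoothv psi -> L2vO (fun x => toC (curl_cl psi x)).
Proof. by have [M hM] := Omega_cbox; exact: (L2v_curl_test mO fO hM). Qed.

Lemma test_smoothv psi : smoothv psi -> L2vO (fun x => toC (psi x)).
Proof. by have [M hM] := Omega_cbox; exact: (L2v_smooth mO fO hM). Qed.

Lemma test_grad phi : smooth phi -> L2vO (fun x => toC (grad_cl phi x)).
Proof. by have [M hM] := Omega_cbox; exact: (L2v_grad_test mO fO hM). Qed.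

Lemma test_smooth phi : smooth phi -> L2O (fun x => (phi x)%:C%C).
Proof. by have [M hM] := Omega_cbox; exact: (L2_smooth mO fO hM). Qed.

Definition normal0 u d := forall phi : space3 R -> R, smooth phi ->
  pair u (fun x => toC (grad_cl phi x)) + spair d (fun x => (phi x)%:C%C) = 0.

(* [curl] and [div] are representatives selected up to null sets, hence not
   additive on the nose; [w] and [d] stand for arbitrary representatives. *)
Definition XTw u w d := [/\ [/\ L2vO u, L2vO w & L2O d],
  weak_curl Omega u w, weak_div Omega u d & normal0 u d].

Lemma weak_curl_null u w w' : L2vO w -> L2vO w' ->
  weak_curl Omega u w -> weak_curl Omega u w' -> nullv (w - w').
Proof.
move=> hw hw' h h'; apply: (L2v_test_eq0 mO fO oOmega (@subset_refl _ _)).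
  exact: L2vB.
move=> psi sp su; have tp := test_smoothv sp.
by rewrite pairBl// h// h'// subrr.
Qed.

Lemma weak_div_null u d d' : L2O d -> L2O d' ->
  weak_div Omega u d -> weak_div Omega u d' -> nulls (d - d').
Proof.
move=> hd hd' h h'; apply: (L2_test_eq0 mO fO oOmega (@subset_refl _ _)).
  exact: L2B.
move=> phi sp su; have tp := test_smooth sp.
by rewrite cint_mulBl// h// h'// subrr.
Qed.

Lemma curlP u : (exists w, L2vO w /\ weak_curl Omega u w) ->
  L2vO (curl Omega u) /\ weak_curl Omega u (curl Omega u).
Proof. by move=> h; exact: (@xgetPex _ 0 [set w | L2vO w /\ weak_curl Omega u w] h). Qed.

Lemma divP u : (exists d, L2O d /\ weak_div Omega u d) ->
  L2O (div Omega u) /\ weak_div Omega u (div Omega u).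
Proof. by move=> h; exact: (@xgetPex _ 0 [set w | L2O w /\ weak_div Omega u w] h). Qed.

Lemma XT_XTw u : XT Omega u -> XTw u (curl Omega u) (div Omega u).
Proof. by case=> hu /curlP[c1 c2] /divP[d1 d2] n0. Qed.

(** The bridge back to the selected [curl] and [div]: the existence of [w] and [d] makes both
    selections succeed, and weak derivatives are unique up to null sets. *)
Lemma XTw_XT u w d : XTw u w d -> [/\ XT Omega u, nullv (curl Omega u - w) &
  nulls (div Omega u - d)].
Proof.
case=> -[hu hw hd] cw dd n0.
have ec : exists w, L2vO w /\ weak_curl Omega u w by exists w.
have ed : exists d, L2O d /\ weak_div Omega u d by exists d.
have [c1 c2] := curlP ec; have [d1 d2] := divP ed.
have nc := weak_curl_null c1 hw c2 cw; have nd := weak_div_null d1 hd d2 dd.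
split=> //; split; [by []|by []|by []|] => phi sp.
by rewrite (spair_null mO d1 hd (test_smooth sp) nd); exact: n0.
Qed.

Lemma XTw_lin a u w d u' w' d' : XTw u w d -> XTw u' w' d' ->
  XTw (a *: u + u') (a *: w + w') (fun x => a * d x + d' x).
Proof.
case=> -[hu hw hd] cw dd n0; case=> -[hu' hw' hd'] cw' dd' n0'.
have au := L2vZ mO a hu; have aw := L2vZ mO a hw; have ad := L2Z mO a hd.
split.
- by split; [exact: L2vD|exact: L2vD|exact: L2D].
- move=> psi sp su; have t1 := test_smoothv sp; have t2 := test_curl sp.
  rewrite (pairDl mO aw hw' t1) (pairDl mO au hu' t2) (pairZl mO a hw t1) (pairZl mO a hu t2).
  by rewrite (cw _ sp su) (cw' _ sp su).
- move=> phi sp su; have t1 := test_smooth sp; have t2 := test_grad sp.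
  rewrite (pairDl mO au hu' t2) (pairZl mO a hu t2).
  rewrite (cint_mulDl mO ad hd' t1) (cint_mulZl mO a hd t1) opprD -mulrN.
  by rewrite (dd _ sp su) (dd' _ sp su).
- move=> phi sp; have t1 := test_smooth sp; have t2 := test_grad sp.
  rewrite (pairDl mO au hu' t2) (pairZl mO a hu t2).
  rewrite (cint_mulDl mO ad hd' t1) (cint_mulZl mO a hd t1).
  by rewrite addrACA -mulrDr (n0 _ sp) (n0' _ sp) mulr0 addr0.
Qed.

(** Every clause equates pairings with a fixed L2 test field, and such pairings pass to L2
    limits. *)
Lemma XTw_lim (u w : nat -> cfield R) (d : nat -> space3 R -> R[i]) u0 w0 d0 :
  (forall n, XTw (u n) (w n) (d n)) -> L2vO u0 -> L2vO w0 -> L2O d0 ->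
  vcvg leb3 Omega u u0 -> vcvg leb3 Omega w w0 -> scvg leb3 Omega d d0 -> XTw u0 w0 d0.
Proof.
move=> h hu hw hd cu cw cd.
have lu n : L2vO (u n) by have [[]] := h n.
have lw n : L2vO (w n) by have [[]] := h n.
have ld n : L2O (d n) by have [[]] := h n.
split; first by split.
- move=> psi sp su; have t1 := test_smoothv sp; have t2 := test_curl sp.
  apply: (ccvg_unique (ccvg_pair mO lw hw t1 cw)).
  apply: ccvg_ext (ccvg_pair mO lu hu t2 cu) => n.
  by have [_ + _ _] := h n => ->.
- move=> phi sp su; have t1 := test_smooth sp; have t2 := test_grad sp.
  apply: (ccvg_unique (ccvg_spair mO ld hd t1 cd)).
  rewrite -mulN1r; apply: ccvg_ext (ccvgZ (-1) (ccvg_pair mO lu hu t2 cu)) => n.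
  by have [_ _ + _] := h n => ->//; rewrite mulN1r.
- move=> phi sp; have t1 := test_smooth sp; have t2 := test_grad sp.
  apply: (ccvg_unique (ccvgD (ccvg_pair mO lu hu t2 cu) (ccvg_spair mO ld hd t1 cd))).
  by apply: ccvg_ext (ccvg_cst 0) => n; have [_ _ _ ->] := h n.
Qed.

Lemma conj_test (psi : space3 R -> 'rV[R]_3) :
  conj_field (fun x => toC (psi x)) = (fun x => toC (psi x)).
Proof. by apply/funext => x; apply/rowP => i; rewrite !mxE /= oppr0. Qed.

Lemma conj_fieldK : involutive (@conj_field R).
Proof. by move=> u; apply/funext => x; apply/rowP => i; rewrite !mxE conjcK. Qed.

Lemma spair_conj f g : L2O f -> L2O g ->
  spair (fun x => conjc (f x)) (fun x => conjc (g x)) = conjc (spair f g).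
Proof.
move=> hf hg; rewrite -(cint_conj mO); last exact: L2_mul.
by apply: eq_cint => x _; rewrite rmorphM.
Qed.

Lemma pair_conj_test u (psi : space3 R -> 'rV[R]_3) :
  L2vO u -> L2vO (fun x => toC (psi x)) ->
  cint leb3 Omega (fun x => dot (conj_field u x) (toC (psi x))) =
  conjc (cint leb3 Omega (fun x => dot (u x) (toC (psi x)))).
Proof. by move=> hu ht; have := pair_conj mO hu ht; rewrite conj_test. Qed.

Lemma spair_conj_test f (phi : space3 R -> R) : L2O f -> L2O (fun x => (phi x)%:C%C) ->
  cint leb3 Omega (fun x => conjc (f x) * (phi x)%:C%C) =
  conjc (cint leb3 Omega (fun x => f x * (phi x)%:C%C)).
Proof.
move=> hf ht; rewrite -(spair_conj hf ht).
by apply: eq_cint => x _; congr (_ * _); rewrite /= oppr0.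
Qed.

Lemma XTw_conj u w d : XTw u w d ->
  XTw (conj_field u) (conj_field w) (fun x => conjc (d x)).
Proof.
case=> -[hu hw hd] cw dd n0.
have cu := L2v_conj mO hu; have cw' := L2v_conj mO hw; have cd := L2_conj mO hd.
split; first by split.
- move=> psi sp su; have t1 := test_smoothv sp; have t2 := test_curl sp.
  by rewrite (pair_conj_test hw t1) (pair_conj_test hu t2) (cw _ sp su).
- move=> phi sp su; have t1 := test_smooth sp; have t2 := test_grad sp.
  by rewrite (pair_conj_test hu t2) (spair_conj_test hd t1) (dd _ sp su) rmorphN.
- move=> phi sp; have t1 := test_smooth sp; have t2 := test_grad sp.
  by rewrite (pair_conj_test hu t2) (spair_conj_test hd t1) -rmorphD (n0 _ sp) rmorph0.
Qed.

(** This is [form_a] with curls and divergences as arguments, which makes it linear in each triple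
    without any choice of representatives. *)
Definition frm (alpha theta : R) u w d v w' d' : R[i] :=
  pair w w' - alpha%:C%C * pair u v + theta%:C%C * spair d d'.

Lemma form_aE alpha theta u w d v w' d' : XTw u w d -> XTw v w' d' ->
  form_a Omega alpha theta u v = frm alpha theta u w d v w' d'.
Proof.
move=> h h'; have [/XT_XTw[[_ hc hdi] _ _ _] nc nd] := XTw_XT h.
have [/XT_XTw[[_ hc' hdi'] _ _ _] nc' nd'] := XTw_XT h'.
have [[hu hw hd] _ _ _] := h; have [[hv hw' hd'] _ _ _] := h'.
rewrite /form_a /frm; congr (_ - _ + _ * _).
  rewrite (pair_null mO hc hw hc' nc) pairC (pair_null mO hc' hw' hw nc').
  exact: pairC.
rewrite (spair_null mO hdi hd hdi' nd) cint_mulC (spair_null mO hdi' hd' hd nd').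
exact: cint_mulC.
Qed.

Lemma frm_linl alpha theta a u w d u2 w2 d2 v w' d' :
  XTw u w d -> XTw u2 w2 d2 -> XTw v w' d' ->
  frm alpha theta (a *: u + u2) (a *: w + w2) (fun x => a * d x + d2 x) v w' d' =
  a * frm alpha theta u w d v w' d' + frm alpha theta u2 w2 d2 v w' d'.
Proof.
move=> [[hu hw hd] _ _ _] [[hu2 hw2 hd2] _ _ _] [[hv hw' hd'] _ _ _].
have au := L2vZ mO a hu; have aw := L2vZ mO a hw; have ad := L2Z mO a hd.
rewrite /frm (pairDl mO aw hw2 hw') (pairDl mO au hu2 hv) (pairZl mO a hw hw').
rewrite (pairZl mO a hu hv) (cint_mulDl mO ad hd2 hd') (cint_mulZl mO a hd hd').
have aux (A B C A' B' C' x y : R[i]) : (a * A + A') - x * (a * B + B') + y * (a * C + C') =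
    a * (A - x * B + y * C) + (A' - x * B' + y * C') by ring.
exact: aux.
Qed.

Lemma frmC alpha theta u w d v w' d' :
  frm alpha theta u w d v w' d' = frm alpha theta v w' d' u w d.
Proof. by rewrite /frm (pairC _ _ w w') (pairC _ _ u v) (cint_mulC _ _ d d'). Qed.

Lemma form_a_linl alpha theta a u v phi : XT Omega u -> XT Omega v -> XT Omega phi ->
  form_a Omega alpha theta (a *: u + v) phi =
  a * form_a Omega alpha theta u phi + form_a Omega alpha theta v phi.
Proof.
move=> /XT_XTw hu /XT_XTw hv /XT_XTw hp.
rewrite (form_aE _ _ (XTw_lin a hu hv) hp) (frm_linl _ _ a hu hv hp).
by rewrite -(form_aE alpha theta hu hp) -(form_aE alpha theta hv hp).
Qed.

Lemma form_aC alpha theta u v :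
  form_a Omega alpha theta u v = form_a Omega alpha theta v u.
Proof. exact: frmC. Qed.

Lemma XT_lin a u v : XT Omega u -> XT Omega v -> XT Omega (a *: u + v).
Proof. by move=> /XT_XTw hu /XT_XTw hv; have [] := XTw_XT (XTw_lin a hu hv). Qed.

Lemma XT_conj u : XT Omega u -> XT Omega (conj_field u).
Proof. by move=> /XT_XTw/XTw_conj/XTw_XT[]. Qed.

End WeakSpace.

Section CrossAlgebra.
Context {K : comNzRingType}.
Implicit Types (a b c : 'rV[K]_3).

Lemma cross0E a b : cross a b 0 0 = a 0 1 * b 0 2 - a 0 2 * b 0 1.
Proof. by rewrite mxE; congr (a _ _ * b _ _ - a _ _ * b _ _); apply: val_inj. Qed.

Lemma cross1E a b : cross a b 0 1 = a 0 2 * b 0 0 - a 0 0 * b 0 2.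
Proof. by rewrite mxE; congr (a _ _ * b _ _ - a _ _ * b _ _); apply: val_inj. Qed.

Lemma cross2E a b : cross a b 0 2 = a 0 0 * b 0 1 - a 0 1 * b 0 0.
Proof. by rewrite mxE; congr (a _ _ * b _ _ - a _ _ * b _ _); apply: val_inj. Qed.

Lemma dot_cross a b c : dot (cross a b) c = dot b (cross c a).
Proof. by rewrite !dotE !cross0E !cross1E !cross2E; ring. Qed.

Lemma cross_cross a b : cross a (cross a b) = dot a b *: a - dot a a *: b.
Proof.
apply/rowP => i; have -> x y : (x *: a - y *: b) 0 i = x * a 0 i - y * b 0 i by rewrite !mxE.
by case: (ord3P i) => ->; rewrite !dotE !(cross0E, cross1E, cross2E); ring.
Qed.

End CrossAlgebra.

(** * Hermitian forms on finite combinations of an orthonormal family *)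

Section OrthonormalForms.
Context {R : realType} {V : lmodType R[i]}.
Variables (P : V -> Prop) (B : V -> V -> R[i]) (e : nat -> V).
Hypothesis P0 : P 0.
Hypothesis Plin : forall a u v, P u -> P v -> P (a *: u + v).
Hypothesis Blin : forall a u v w, P u -> P v -> P w ->
  B (a *: u + v) w = a * B u w + B v w.
Hypothesis Bherm : forall u v, P u -> P v -> B v u = conjc (B u v).
Hypothesis Pe : forall n, P (e n).
Hypothesis Be : forall n m, B (e n) (e m) = (n == m)%:R.

Lemma closed_lincomb (s : seq nat) (a : nat -> R[i]) : P (\sum_(i <- s) a i *: e i).
Proof.
elim: s => [|n s IH]; first by rewrite big_nil.
by rewrite big_cons; exact: Plin.
Qed.

Lemma form0l w : P w -> B 0 w = 0.
Proof.
move=> Pw; have := Blin (-1) P0 P0 Pw.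
by rewrite scaler0 addr0 mulN1r addNr.
Qed.

Lemma form_suml (s : seq nat) (a : nat -> R[i]) w : P w ->
  B (\sum_(i <- s) a i *: e i) w = \sum_(i <- s) a i * B (e i) w.
Proof.
move=> Pw; elim: s => [|n s IH]; first by rewrite !big_nil form0l.
by rewrite !big_cons Blin ?IH//; exact: closed_lincomb.
Qed.

(** Stated for an abstract domain [P] because it serves twice: for [inner] on the fields that have a
    trace, and for the boundary pairing on L2 fields. Distinctness of the indices reduces the double
    sum to its diagonal. *)
Lemma orthonormal_form_sum (s : seq nat) (a : nat -> R[i]) : uniq s ->
  B (\sum_(i <- s) a i *: e i) (\sum_(i <- s) a i *: e i) =
  (\sum_(i <- s) absq (a i))%:C%C.
Proof.
move=> us; set S := \sum_(i <- s) _.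
have PS : P S by exact: closed_lincomb.
rewrite form_suml// rmorph_sum/=; apply: eq_big_seq => i si.
rewrite Bherm// form_suml// (bigD1_seq i)//= Be eqxx mulr1 big1 ?addr0 ?mulc_conj//.
by move=> j ji; rewrite Be (negPf ji) mulr0.
Qed.

End OrthonormalForms.

(** * Tangential traces *)

Section Traces.
Context {R : realType}.
Variables (Omega : set (space3 R)) (nu : space3 R -> 'rV[R]_3)
  (sigma : {measure set (mspace3 R) -> \bar R}).
Hypotheses (oOmega : open Omega) (bOmega : bounded_set Omega)
  (cOmega : C11_boundary Omega) (hnu : is_outer_normal Omega nu)
  (hsigma : is_surface_measure Omega sigma).
Implicit Types (u v w g h : cfield R) (d : space3 R -> R[i]) (a : R[i]).

Let mO : measurable (Omega : set (mspace3 R)) := open_measurable3 oOmega.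
Let mG : measurable (bdry Omega : set (mspace3 R)) := measurable_bdry bOmega.
Let fG : (sigma (bdry Omega : set (mspace3 R)) < +oo)%E :=
  sigma_bdry_finite bOmega cOmega hsigma.

Local Notation L2vG := (L2v sigma (bdry Omega)).
Local Notation L2G := (L2 sigma (bdry Omega)).
Local Notation pO u v := (cint leb3 Omega (fun x => dot (u x) (v x))).
Local Notation pG u v := (cint sigma (bdry Omega) (fun x => dot (u x) (v x))).
Local Notation nullG u := (sqL2v sigma (bdry Omega) u = 0%E).
Local Notation tC psi := (fun x => toC (psi x)).

(* The triple product identity [(nu x g) . psi = g . (psi x nu)] turns the
   boundary term of Green's formula into a pairing of [g] with an L2 field. *)
Definition gtest (psi : space3 R -> 'rV[R]_3) : cfield R :=
  fun x => cross (toC (psi x)) (toC (nu x)).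

Lemma nu_le1 i x : bdry Omega x -> `|nu x 0 i| <= 1.
Proof.
move=> bx; have := nu_unit oOmega bOmega cOmega hnu bx; rewrite dotE => e.
rewrite -(ler_pXn2r (ltn0Sn 1)) ?nnegrE// expr1n real_normK ?num_real// -e.
have h0 := sqr_ge0 (nu x 0 0); have h1 := sqr_ge0 (nu x 0 1); have h2 := sqr_ge0 (nu x 0 2).
by case: (ord3P i) => ->; nra.
Qed.

Lemma L2_nu_mul i (f : space3 R -> R[i]) : L2G f -> L2G (fun x => (nu x 0 i)%:C%C * f x).
Proof.
move=> hf; apply: (L2_bounded_mul mG (M := 1)) => //.
  exact: measurable_nu.
by move=> x; exact: nu_le1.
Qed.

Lemma bdry_cbox : exists M : R, bdry Omega `<=` cbox (fun=> - M) (fun=> M).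
Proof. by have [M hM] := bounded_closure bOmega; exists M => x [/hM]. Qed.

Lemma testG_smooth phi : smooth phi -> L2G (fun x => (phi x)%:C%C).
Proof. by have [M hM] := bdry_cbox; exact: (L2_smooth mG fG hM). Qed.

Lemma L2v_gtest psi : smoothv psi -> L2vG (gtest psi).
Proof.
move=> sp i; have t j : L2G (fun x => (psi x 0 j)%:C%C) by exact: testG_smooth.
have := L2B mG (L2_nu_mul (i + 2) (t (i + 1))) (L2_nu_mul (i + 1) (t (i + 2))).
congr (L2 _ _ _); apply/funext => x; rewrite !mxE.
by congr (_ - _); rewrite mulrC.
Qed.

Lemma L2v_cross_nu g : L2vG g -> L2vG (fun x => cross (toC (nu x)) (g x)).
Proof.
move=> hg i; have := L2B mG (L2_nu_mul (i + 1) (hg (i + 2))) (L2_nu_mul (i + 2) (hg (i + 1))).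
by congr (L2 _ _ _); apply/funext => x; rewrite !mxE.
Qed.

Lemma L2_dot_nu g : L2vG g -> L2G (fun x => dot (toC (nu x)) (g x)).
Proof.
move=> hg; have := L2D mG (L2D mG (L2_nu_mul 0 (hg 0)) (L2_nu_mul 1 (hg 1))) (L2_nu_mul 2 (hg 2)).
by congr (L2 _ _ _); apply/funext => x; rewrite dotE !mxE.
Qed.

(** The curl is an argument here, as in [XTw], and the boundary term is a pairing with [g] itself,
    so the relation is linear and closed in the triple. *)
Definition Tr u w g := TL2 Omega nu sigma g /\
  forall psi : space3 R -> 'rV[R]_3, smoothv psi ->
    pO w (tC psi) - pO u (fun x => toC (curl_cl psi x)) = pG g (gtest psi).

Lemma is_traceE u g : is_tangential_trace Omega nu sigma u g <-> Tr u (curl Omega u) g.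
Proof.
have E psi : cint sigma (bdry Omega) (fun x => dot (cross (toC (nu x)) (g x)) (toC (psi x)))
    = pG g (gtest psi) by apply: eq_cint => x _; rewrite dot_cross.
split=> -[h1 h2]; (split; first exact: h1) => psi sp.
  by rewrite -E; exact: (h2 _ sp).
by rewrite E; exact: (h2 _ sp).
Qed.

Lemma TL2_lin a g h : TL2 Omega nu sigma g -> TL2 Omega nu sigma h ->
  TL2 Omega nu sigma (a *: g + h).
Proof.
move=> [g1 g2] [h1 h2]; split; first by apply: L2vD => //; exact: L2vZ.
apply: aeS2 g2 h2 => x /= e1 e2 bx.
by rewrite dotC dotDl dotZl dotC (e1 bx) mulr0 add0r dotC (e2 bx).
Qed.

Lemma TL2_conj g : TL2 Omega nu sigma g -> TL2 Omega nu sigma (conj_field g).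
Proof.
move=> [g1 g2]; split; first exact: L2v_conj.
apply: aeS g2 => x /= e bx; have := congr1 conjc (e bx); rewrite rmorph0 => <-.
rewrite rmorph_sum; apply: eq_bigr => i _; rewrite !mxE rmorphM; congr (_ * _).
by rewrite /= oppr0.
Qed.

(** Tangency is an almost everywhere condition. To pass to the limit it is expressed as the
    vanishing of the pairings with phi nu for smooth phi, and it is recovered by the fundamental
    lemma with the whole space as open set. *)
Lemma TL2_lim (g : nat -> cfield R) g0 : (forall n, TL2 Omega nu sigma (g n)) ->
  L2vG g0 -> vcvg sigma (bdry Omega) g g0 -> TL2 Omega nu sigma g0.
Proof.
move=> hg h0 cg; split=> //; apply/(sqL2_ae0 mG (L2_dot_nu h0)).
apply: (L2_test_eq0 mG fG (@openT _) (@subsetT _ _)); first exact: L2_dot_nu.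
move=> phi sp _.
pose nphi : cfield R := fun x => (phi x)%:C%C *: toC (nu x).
have hn : L2vG nphi.
  move=> i; have := L2_nu_mul i (testG_smooth sp); congr (L2 _ _ _).
  by apply/funext => x; rewrite !mxE mulrC.
have E h : cint sigma (bdry Omega) (fun x => dot (toC (nu x)) (h x) * (phi x)%:C%C) = pG h nphi.
  by apply: eq_cint => x _; rewrite /nphi dotC [RHS]dotC dotZl mulrC [dot (toC _) _]dotC.
rewrite E; apply: (ccvg_unique (ccvg_pair mG (fun n => (hg n).1) h0 hn cg)).
apply: ccvg_ext (ccvg_cst 0) => n; rewrite -E.
have ae0 : sqL2 sigma (bdry Omega) (fun x => dot (toC (nu x)) (g n x)) = 0%E.
  by apply/(sqL2_ae0 mG (L2_dot_nu (hg n).1)); exact: (hg n).2.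
apply/esym/absq_eq0/eqP; rewrite eq_le absq_ge0 andbT.
have := absq_cint_mul_le mG (L2_dot_nu (hg n).1) (testG_smooth sp).
by rewrite ae0 /= mulr0 mul0r.
Qed.

Lemma Tr_lin a u w d g u' w' d' g' : XTw Omega u w d -> XTw Omega u' w' d' ->
  Tr u w g -> Tr u' w' g' -> Tr (a *: u + u') (a *: w + w') (a *: g + g').
Proof.
move=> [[hu hw _] _ _ _] [[hu' hw' _] _ _ _] [t1 h1] [t2 h2].
split; first exact: TL2_lin.
move=> psi sp; have s1 := test_smoothv oOmega bOmega sp; have s2 := test_curl oOmega bOmega sp.
have s3 := L2v_gtest sp.
have au := L2vZ mO a hu; have aw := L2vZ mO a hw; have ag := L2vZ mG a t1.1.
rewrite (pairDl mO aw hw' s1) (pairZl mO a hw s1) (pairDl mO au hu' s2) (pairZl mO a hu s2).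
rewrite (pairDl mG ag t2.1 s3) (pairZl mG a t1.1 s3) -(h1 _ sp) -(h2 _ sp).
by rewrite mulrBr opprD addrACA.
Qed.

Lemma Tr_conj u w d g : XTw Omega u w d -> Tr u w g ->
  Tr (conj_field u) (conj_field w) (conj_field g).
Proof.
move=> [[hu hw _] _ _ _] [t1 h1]; split; first exact: TL2_conj.
move=> psi sp; have s1 := test_smoothv oOmega bOmega sp; have s2 := test_curl oOmega bOmega sp.
have s3 := L2v_gtest sp.
transitivity (conjc (pG g (gtest psi))).
  by rewrite (pair_conj_test oOmega hw s1) (pair_conj_test oOmega hu s2) -(h1 _ sp) rmorphB.
rewrite -(pair_conj mG t1.1 s3); apply: eq_cint => x _; congr dot.
apply/rowP => i; rewrite !mxE.
by rewrite rmorphB !rmorphM /= !oppr0.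
Qed.

Lemma Tr_lim (u w g : nat -> cfield R) (d : nat -> space3 R -> R[i]) u0 w0 d0 g0 :
  (forall n, XTw Omega (u n) (w n) (d n)) -> (forall n, Tr (u n) (w n) (g n)) ->
  XTw Omega u0 w0 d0 -> L2vG g0 -> vcvg leb3 Omega u u0 -> vcvg leb3 Omega w w0 ->
  vcvg sigma (bdry Omega) g g0 -> Tr u0 w0 g0.
Proof.
move=> hx ht [[hu hw _] _ _ _] hg cu cw cg; split.
  by apply: TL2_lim hg cg => n; have [] := ht n.
move=> psi sp; have s1 := test_smoothv oOmega bOmega sp; have s2 := test_curl oOmega bOmega sp.
have s3 := L2v_gtest sp.
have lu n : L2v leb3 Omega (u n) by have [[]] := hx n.
have lw n : L2v leb3 Omega (w n) by have [[]] := hx n.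
have lg n : L2vG (g n) by have [[]] := ht n.
rewrite -mulN1r.
apply: (ccvg_unique (ccvgD (ccvg_pair mO lw hw s1 cw) (ccvgZ (-1) (ccvg_pair mO lu hu s2 cu)))).
apply: ccvg_ext (ccvg_pair mG lg hg s3 cg) => n.
by have [_ h] := ht n; rewrite mulN1r (h _ sp).
Qed.

(* The boundary values of smooth fields determine [nu x (g - g')], and
   [(nu x .)] is injective on tangential fields because [|nu| = 1]. *)
Lemma Tr_unique u w g g' : Tr u w g -> Tr u w g' -> nullG (g - g').
Proof.
move=> [[l1 n1] h1] [[l2 n2] h2]; have lB : L2vG (g - g') by exact: L2vB.
have c0 : nullG (fun x => cross (toC (nu x)) ((g - g') x)).
  apply: (L2v_test_eq0 mG fG (@openT _) (@subsetT _ _)); first exact: L2v_cross_nu.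
  move=> psi sp _; have s3 := L2v_gtest sp.
  rewrite (_ : cint _ _ _ = pG (g - g') (gtest psi)); last first.
    by apply: eq_cint => x _; rewrite dot_cross.
  by rewrite (pairBl mG l1 l2 s3) -(h1 _ sp) -(h2 _ sp) subrr.
have {}c0 := (sqL2v_ae0 mG (L2v_cross_nu lB)).1 c0.
apply/(sqL2v_ae0 mG lB).
have d0 : {ae sigma, forall x, bdry Omega x -> dot (toC (nu x)) ((g - g') x) = 0}.
  apply: aeS2 n1 n2 => x /= e1 e2 bx.
  by rewrite dotC -scaleN1r dotDl dotZl dotC (e1 bx) dotC (e2 bx) mulr0 addr0.
apply: aeS2 c0 d0 => x /= e1 e2 bx.
have := cross_cross (toC (nu x)) ((g - g') x).
rewrite (e1 bx) (e2 bx) scale0r sub0r.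
have -> : dot (toC (nu x)) (toC (nu x)) = 1.
  rewrite -[RHS](rmorph1 (real_complex R)) -(nu_unit oOmega bOmega cOmega hnu bx) rmorph_sum.
  by apply: eq_bigr => i _; rewrite !mxE rmorphM.
have c00 : cross (toC (nu x)) 0 = 0 by apply/rowP => i; rewrite !mxE !mulr0 subrr.
by rewrite c00 scale1r => /eqP; rewrite eq_sym oppr_eq0 => /eqP.
Qed.

Local Notation pT := (pi_T Omega nu sigma).
Local Notation nullO u := (sqL2v leb3 Omega u = 0%E).

Lemma Tr_null u w d u' w' d' g : XTw Omega u w d -> XTw Omega u' w' d' ->
  nullO (u - u') -> nullO (w - w') -> Tr u' w' g -> Tr u w g.
Proof.
move=> [[hu hw _] _ _ _] [[hu' hw' _] _ _ _] nu0 nw [t h]; split; first exact: t.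
move=> psi sp.
have s1 := test_smoothv oOmega bOmega sp; have s2 := test_curl oOmega bOmega sp.
by rewrite (pair_null mO hw hw' s1 nw) (pair_null mO hu hu' s2 nu0) (h _ sp).
Qed.

Lemma nullO_refl u : L2v leb3 Omega u -> nullO (u - u).
Proof.
by move=> hu; rewrite subrr (sqL2v_ae0 mO (L2v0 leb3 Omega)); exact: aeW.
Qed.

(** Any explicit trace makes the selection in [pi_T] succeed; uniqueness of traces then compares the
    selected value with it. *)
Lemma piTP u w d g : XTw Omega u w d -> Tr u w g ->
  Tr u w (pT u) /\ nullG (pT u - g).
Proof.
move=> hx ht; have [xu nc _] := XTw_XT oOmega bOmega hx.
have hx' := XT_XTw xu.
have lu : L2v leb3 Omega u by case: hx => -[].
have nc' : nullO (w - curl Omega u) by rewrite sqL2vBC.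
have t1 : is_tangential_trace Omega nu sigma u g.
  exact: ((is_traceE u g).2 (Tr_null hx' hx (nullO_refl lu) nc ht)).
have t2 : is_tangential_trace Omega nu sigma u (pT u).
  exact: (@xgetPex _ 0 [set g | is_tangential_trace Omega nu sigma u g]
    (ex_intro _ g t1)).
have t3 : Tr u w (pT u).
  exact: (Tr_null hx hx' (nullO_refl lu) nc' ((is_traceE u (pT u)).1 t2)).
by split=> //; exact: Tr_unique t3 ht.
Qed.

Lemma piT_none u : ~ (exists g, is_tangential_trace Omega nu sigma u g) -> pT u = 0.
Proof. by move=> h; rewrite /pi_T xgetPN// => g hg; apply: h; exists g. Qed.

Lemma piT_L2 u : L2vG (pT u).
Proof.
have [h|/piT_none ->] := pselect (exists g, is_tangential_trace Omega nu sigma u g).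
  by have [[]] := @xgetPex _ 0 [set g | is_tangential_trace Omega nu sigma u g] h.
exact: L2v0.
Qed.

Local Opaque pi_T curl div.
(** On this class [pi_T] is an actual trace, and it commutes with linear combinations and
    conjugation up to null sets. Existence of a trace is a clause because it is established only for
    the eigenfunctions and what is built from them. *)
Definition hasT u := XT Omega u /\ exists g, Tr u (curl Omega u) g.

Lemma hasTP u : hasT u -> Tr u (curl Omega u) (pT u).
Proof. by move=> [/XT_XTw hx [g hg]]; have [] := piTP hx hg. Qed.

Lemma hasT_Tr u w d g : XTw Omega u w d -> Tr u w g -> hasT u.
Proof.
move=> hx ht; have [xu nc _] := XTw_XT oOmega bOmega hx; split=> //; exists g.
have lu : L2v leb3 Omega u by case: hx => -[].
exact: Tr_null (XT_XTw xu) hx (nullO_refl lu) nc ht.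
Qed.

Lemma piT_lin a u v : hasT u -> hasT v ->
  hasT (a *: u + v) /\ nullG (pT (a *: u + v) - (a *: pT u + pT v)).
Proof.
move=> hu hv; have xu := XT_XTw hu.1; have xv := XT_XTw hv.1.
have xl := XTw_lin oOmega bOmega a xu xv.
have tl := Tr_lin a xu xv (hasTP hu) (hasTP hv).
by split; [exact: hasT_Tr xl tl|exact: (piTP xl tl).2].
Qed.

Lemma piT_conj u : hasT u ->
  hasT (conj_field u) /\ nullG (pT (conj_field u) - conj_field (pT u)).
Proof.
move=> hu; have xu := XT_XTw hu.1.
have xl := XTw_conj oOmega bOmega xu; have tl := Tr_conj xu (hasTP hu).
by split; [exact: hasT_Tr xl tl|exact: (piTP xl tl).2].
Qed.

Lemma form_a_conj alpha theta u v : XT Omega u -> XT Omega v ->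
  form_a Omega alpha theta (conj_field u) (conj_field v) =
  conjc (form_a Omega alpha theta u v).
Proof.
move=> /XT_XTw xu /XT_XTw xv.
have cu := XTw_conj oOmega bOmega xu; have cv := XTw_conj oOmega bOmega xv.
rewrite (form_aE oOmega bOmega _ _ cu cv).
have [[l1 l2 l3] _ _ _] := xu; have [[k1 k2 k3] _ _ _] := xv.
rewrite /frm (pair_conj mO l1 k1) (pair_conj mO l2 k2) (spair_conj oOmega l3 k3).
have aux (r s : R) (x y z : R[i]) : conjc x - r%:C%C * conjc y + s%:C%C * conjc z =
    conjc (x - r%:C%C * y + s%:C%C * z).
  rewrite rmorphD rmorphB !rmorphM; congr (_ - _ * _ + _ * _);
  by apply: complexP; rewrite /= ?oppr0.
exact: aux.
Qed.

Lemma inner_lin alpha theta eta a u v w : hasT u -> hasT v -> hasT w ->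
  inner Omega nu sigma alpha theta eta (a *: u + v) w =
  a * inner Omega nu sigma alpha theta eta u w + inner Omega nu sigma alpha theta eta v w.
Proof.
move=> hu hv hw; rewrite /inner /int_Gamma.
have xc := XT_conj oOmega bOmega hw.1.
have [_ n] := piT_lin a hu hv.
have lu := piT_L2 u; have lv := piT_L2 v; have lc := piT_L2 (conj_field w).
have al := L2vZ mG a lu.
have E : pG (pT (a *: u + v)) (pT (conj_field w)) =
    a * pG (pT u) (pT (conj_field w)) + pG (pT v) (pT (conj_field w)).
  apply: (etrans (pair_null mG (piT_L2 (a *: u + v)) (L2vD mG al lv) lc n)).
  apply: (etrans (pairDl mG al lv lc)).
  exact: (congr1 (fun t => t + _) (pairZl mG a lu lc)).
have aux (x y z t e : R[i]) : a * x + y + e * (a * z + t) = a * (x + e * z) + (y + e * t) by ring.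
exact: (etrans (congr2 (fun s t => s + eta%:C%C * t)
  (form_a_linl oOmega bOmega alpha theta a hu.1 hv.1 xc) E) (aux _ _ _ _ _)).
Qed.

Lemma pG_conj u v : hasT v -> pG (pT u) (pT (conj_field v)) = pG (pT u) (conj_field (pT v)).
Proof.
move=> hv; have [_ n] := piT_conj hv.
have lc := L2v_conj mG (piT_L2 v).
exact: (etrans (pairC _ _ _ _) (etrans
  (pair_null mG (piT_L2 _) lc (piT_L2 u) n) (pairC _ _ _ _))).
Qed.

Lemma inner_herm alpha theta eta u v : hasT u -> hasT v ->
  inner Omega nu sigma alpha theta eta v u =
  conjc (inner Omega nu sigma alpha theta eta u v).
Proof.
move=> hu hv; rewrite /inner /int_Gamma.
have lu := piT_L2 u; have lv := L2v_conj mG (piT_L2 v).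
have E1 : form_a Omega alpha theta v (conj_field u) =
    conjc (form_a Omega alpha theta u (conj_field v)).
  rewrite -(form_a_conj alpha theta hu.1 (XT_conj oOmega bOmega hv.1)) conj_fieldK.
  exact: form_aC.
have E2 : pG (pT v) (pT (conj_field u)) = conjc (pG (pT u) (pT (conj_field v))).
  apply: (etrans (pG_conj v hu)).
  apply: (etrans _ (congr1 conjc (esym (pG_conj u hv)))).
  apply: (etrans _ (pair_conj mG lu lv)); rewrite conj_fieldK; exact: pairC.
have aux (r : R) (x y : R[i]) : conjc x + r%:C%C * conjc y = conjc (x + r%:C%C * y).
  by apply: complexP; rewrite ?ReD ?ImD ?ReM ?ImM ?ReConj ?ImConj ?ReD ?ImD ?ReM ?ImM
    ?ReConj ?ImConj /=; ring.
exact: (etrans (congr2 (fun s t => s + eta%:C%C * t) E1 E2) (aux _ _ _)).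
Qed.

End Traces.

(** * Steklov expansions *)

Section NullEstimates.
Context {R : realType}.
Variables (mu : {measure set (mspace3 R) -> \bar R}) (D : set (space3 R)).
Hypothesis mD : measurable (D : set (mspace3 R)).

Local Notation nsq f := (fine (sqL2 mu D f)).
Local Notation nsqv f := (fine (sqL2v mu D f)).

Lemma nsqv_null_le (p q : cfield R) : L2v mu D p -> L2v mu D q ->
  sqL2v mu D (p - q) = 0%E -> nsqv p <= 2 * nsqv q.
Proof.
move=> hp hq h0; have := nsqvD_le mD (L2vB mD hp hq) hq.
by rewrite subrK h0 mulr0 add0r.
Qed.

Lemma nsq_null_le (p q : space3 R -> R[i]) : L2 mu D p -> L2 mu D q ->
  sqL2 mu D (p - q) = 0%E -> nsq p <= 2 * nsq q.
Proof.
move=> hp hq h0; have := sqL2D_le mD (L2B mD hp hq) hq.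
have -> : (fun x => p x - q x + q x) = p by apply/funext => x; rewrite subrK.
by rewrite -/(p - q) h0 mulr0 add0r.
Qed.

Lemma sqL2BC (f g : space3 R -> R[i]) : sqL2 mu D (f - g) = sqL2 mu D (g - f).
Proof.
rewrite -(sqL2N mu D (f - g)); apply: eq_integral => x _; congr (absq _)%:E.
exact: opprB.
Qed.

End NullEstimates.

Section RealSequences.
Context {R : realType}.

Lemma EFin_cvg0P (s : nat -> R) : (forall n, 0 <= s n) ->
  (fun n => (s n)%:E) @ \oo --> (0 : \bar R)%E <->
  (forall e : R, 0 < e -> exists N, forall n, (N <= n)%N -> s n <= e).
Proof.
move=> s0; split=> [h e e0|h].
  have /fine_cvg/cvgrPdist_le/(_ _ e0)[N _ hN] := h.
  by exists N => n Nn; have := hN n Nn; rewrite sub0r normrN ger0_norm.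
apply: cvg_EFin; first exact: nearW.
apply/cvgrPdist_le => e e0; have [N hN] := h e e0.
by exists N => // n /hN; rewrite sub0r normrN ger0_norm.
Qed.

Lemma ell2_cauchy (c : nat -> R[i]) : ell2 c -> forall e : R, 0 < e ->
  exists N, forall n m, (N <= n)%N -> (n <= m)%N -> \sum_(n <= i < m) absq (c i) <= e.
Proof.
move=> hc e e0; pose S n := \sum_(0 <= i < n) absq (c i).
have nd : nondecreasing_seq S.
  by apply/nondecreasing_seqP => n; rewrite /S big_nat_recr//= lerDl absq_ge0.
have : cvgn S.
  apply: nondecreasing_is_cvgn => //.
  exists (fine (\sum_(0 <= n <oo) (absq (c n))%:E)%E) => _ [n _ <-].
  rewrite -lee_fin fineK; last first.
    by rewrite ge0_fin_numE//; apply: nneseries_ge0 => k _ _; rewrite lee_fin absq_ge0.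
  by rewrite -sumEFin; apply: nneseries_lim_ge => k _; rewrite lee_fin absq_ge0.
move=> cS; have /cvgrPdist_le/(_ _ e0)[N _ hN] := cS.
exists N => n m Nn nm.
have hs : S m - S n = \sum_(n <= i < m) absq (c i).
  by apply/eqP; rewrite subr_eq addrC; apply/eqP; exact: (big_cat_nat (leq0n n) nm).
rewrite -hs; have := hN n Nn; have := nondecreasing_cvgn_le nd cS m.
have := nondecreasing_cvgn_le nd cS n.
rewrite ler_norml => h1 h2 /andP[h3 h4].
by apply: le_trans h4; rewrite lerD2r.
Qed.

End RealSequences.

(** * Eigenfunctions, their boundary traces and finite sums *)

Section SteklovExpansion.
Context {R : realType}.
Variables (Omega : set (space3 R)) (nu : space3 R -> 'rV[R]_3)
  (sigma : {measure set (mspace3 R) -> \bar R}).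
Hypotheses (oOmega : open Omega) (bOmega : bounded_set Omega)
  (cOmega : C11_boundary Omega) (hnu : is_outer_normal Omega nu)
  (hsigma : is_surface_measure Omega sigma).
Variables (alpha theta eta : R) (lambda : nat -> R) (uO : nat -> cfield R).
Hypothesis hco : coercive_XT Omega nu sigma alpha theta eta.
Hypothesis hS : steklov_system Omega nu sigma alpha theta eta lambda uO.
Implicit Types (u v w g : cfield R) (a : nat -> R[i]).

Let mO : measurable (Omega : set (mspace3 R)) := open_measurable3 oOmega.
Let mG : measurable (bdry Omega : set (mspace3 R)) := measurable_bdry bOmega.
Let fO := leb3_Omega_finite oOmega bOmega.
Let fG : (sigma (bdry Omega : set (mspace3 R)) < +oo)%E :=
  sigma_bdry_finite bOmega cOmega hsigma.

Local Notation L2vG := (L2v sigma (bdry Omega)).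
Local Notation L2vO := (L2v leb3 Omega).
Local Notation pO u v := (cint leb3 Omega (fun x => dot (u x) (v x))).
Local Notation pG u v := (cint sigma (bdry Omega) (fun x => dot (u x) (v x))).
Local Notation nullG u := (sqL2v sigma (bdry Omega) u = 0%E).
Local Notation nullO u := (sqL2v leb3 Omega u = 0%E).
Local Notation nO u := (fine (sqL2v leb3 Omega u)).
Local Notation nOs u := (fine (sqL2 leb3 Omega u)).
Local Notation nG u := (fine (sqL2v sigma (bdry Omega) u)).
Local Notation pT := (pi_T Omega nu sigma).
Local Notation inn := (inner Omega nu sigma alpha theta eta).
Local Notation hasT := (hasT Omega nu sigma).
Local Notation Tr := (Tr Omega nu sigma).
Local Notation uG := (uGamma Omega nu sigma eta lambda uO).

Let XTO n : XT Omega (uO n).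
Proof. by have [] := steklov_eig hS n. Qed.

(** The eigenvalue equation, tested with the conjugate of the m-th eigenfunction, turns the volume
    terms into -lambda_n times the boundary pairing. *)
Lemma steklov_inner n m :
  inn (uO n) (uO m) = (eta - lambda n)%:C%C * pG (pT (uO n)) (pT (conj_field (uO m))).
Proof.
have [_ _ h] := steklov_eig hS n.
rewrite /inner (h _ (XT_conj oOmega bOmega (XTO m))) /int_Gamma.
by rewrite rmorphB mulrBl addrC.
Qed.

(* Without a trace, [pi_T] takes its default value [0], contradicting
   [(eta - lambda_n) |pi_T u_n|^2 = 1]. *)
Lemma steklov_hasT n : hasT (uO n).
Proof.
split; first exact: XTO.
have [[g /is_traceE hg]|hn] := pselect (exists g, is_tangential_trace Omega nu sigma (uO n) g).
  by exists g.
have p0 := piT_none hn.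
have := steklov_orthonormal hS n n; rewrite steklov_inner p0 eqxx.
rewrite (@eq_cint _ _ _ _ (fun=> 0)); last first.
  by move=> x _; rewrite /dot big1// => i _; rewrite mxE mul0r.
have -> : cint sigma (bdry Omega) (fun=> 0) = 0.
  by apply: complexP; rewrite /cint /= /Rintegral /= integral0.
by rewrite mulr0 => /esym/eqP; rewrite oner_eq0.
Qed.

Lemma pT_L2 u : L2vG (pT u).
Proof. exact: piT_L2. Qed.

Lemma uGamma_L2 n : L2vG (uG n).
Proof. by apply: (L2vZ mG); exact: pT_L2. Qed.

(** Since lambda_n < eta, the square of the normalizing root is eta - lambda_n, exactly the factor
    in [steklov_inner]. Off the diagonal this factor is nonzero, so the boundary pairing itself must
    vanish. *)
Lemma uGamma_orthonormal n m : pG (uG n) (conj_field (uG m)) = (n == m)%:R.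
Proof.
have := steklov_orthonormal hS n m; rewrite steklov_inner.
rewrite (pG_conj oOmega bOmega cOmega hnu hsigma (uO n) (steklov_hasT m)).
set P := pG _ _ => hP.
have lt0 k : 0 < eta - lambda k by rewrite subr_gt0; exact: (steklov_lt hS).
have s2 k : Num.sqrt `|lambda k - eta| ^+ 2 = eta - lambda k.
  by rewrite sqr_sqrtr// distrC gtr0_norm.
have -> : pG (uG n) (conj_field (uG m)) =
    (Num.sqrt `|lambda n - eta| * Num.sqrt `|lambda m - eta|)%:C%C * P.
  have cc : conj_field (uG m) = (Num.sqrt `|lambda m - eta|)%:C%C *: conj_field (pT (uO m)).
    apply/funext => x; apply/rowP => i; rewrite !mxE rmorphM; congr (_ * _).
    by apply: complexP; rewrite /= ?oppr0.
  have lc := L2v_conj mG (pT_L2 (uO m)).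
  rewrite cc (pairZl mG _ (pT_L2 (uO n)) (L2vZ mG _ lc)).
  rewrite (pairC _ _ (pT (uO n)) _) (pairZl mG _ lc (pT_L2 (uO n))) rmorphM -mulrA.
  by rewrite (pairC _ _ (conj_field _) _).
have [nm|nm] := eqVneq n m.
  by rewrite -nm -expr2 s2 hP nm eqxx.
move: hP; rewrite (negPf nm) => /eqP; rewrite mulf_eq0 => /orP[|/eqP ->]; last by rewrite mulr0.
by move=> /eqP/(congr1 (@complex.Re R))/= h; have := lt0 n; rewrite h ltxx.
Qed.

Definition psum a (s : seq nat) : cfield R := \sum_(i <- s) a i *: uO i.

Lemma psum_hasT a s : hasT (psum a s).
Proof.
apply: (closed_lincomb (P := hasT)) => [|b u v hu hv|n]; last exact: steklov_hasT.
  have := (piT_lin oOmega bOmega cOmega hnu hsigma (-1) (steklov_hasT 0) (steklov_hasT 0)).1.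
  by rewrite scaleN1r addNr.
by have [] := piT_lin oOmega bOmega cOmega hnu hsigma b hu hv.
Qed.

(** By orthonormality the coercive form of a finite sum is the sum of the |a_i|^2. The constant is
    the inverse of the coercivity constant, so it does not depend on the coefficients or on the
    indices. *)
Lemma psum_coercive : exists2 C : R, 0 < C & forall a s, uniq s ->
  [/\ nO (psum a s) <= C * \sum_(i <- s) absq (a i),
      nO (curl Omega (psum a s)) <= C * \sum_(i <- s) absq (a i) &
      nOs (div Omega (psum a s)) <= C * \sum_(i <- s) absq (a i)].
Proof.
have [k k0 hk] := hco; exists k^-1; first by rewrite invr_gt0.
move=> a s us; have hP := psum_hasT a s.
have := hk _ hP.1.
have hT0 : hasT 0.
  by have := psum_hasT a [::]; rewrite /psum big_nil.
have -> : inn (psum a s) (psum a s) = (\sum_(i <- s) absq (a i))%:C%C.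
  have Pl b u v (hu : hasT u) (hv : hasT v) : hasT (b *: u + v).
    exact: (piT_lin oOmega bOmega cOmega hnu hsigma b hu hv).1.
  have Bl b u v w (hu : hasT u) (hv : hasT v) (hw : hasT w) :
      inn (b *: u + v) w = b * inn u w + inn v w.
    exact: (inner_lin oOmega bOmega cOmega hnu hsigma).
  have Bh u v (hu : hasT u) (hv : hasT v) : inn v u = conjc (inn u v).
    exact: (inner_herm oOmega bOmega cOmega hnu hsigma).
  exact: (orthonormal_form_sum hT0 Pl Bl Bh steklov_hasT (steklov_orthonormal hS) a us).
have [[lu lw ld] _ _ _] := XT_XTw hP.1.
rewrite /sqXT (sqL2v_fineK mO lu) (sqL2v_fineK mO lw) (sqL2_fineK mO ld) -!EFinD -EFinM lee_fin /=.
have h1 : 0 <= nO (psum a s) by rewrite fine_ge0// sqL2v_ge0.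
have h2 : 0 <= nO (curl Omega (psum a s)) by rewrite fine_ge0// sqL2v_ge0.
have h3 : 0 <= nOs (div Omega (psum a s)) by rewrite fine_ge0// sqL2_ge0.
rewrite -ler_pdivlMl// => h.
by split; apply: le_trans h; lra.
Qed.

Lemma uGamma_sum_norm a s : uniq s ->
  nG (\sum_(i <- s) a i *: uG i) = \sum_(i <- s) absq (a i).
Proof.
move=> us; have lS : L2vG (\sum_(i <- s) a i *: uG i).
  apply: (closed_lincomb (P := L2vG)); [exact: L2v0| |exact: uGamma_L2].
  by move=> b u v hu hv; apply: (L2vD mG) => //; exact: L2vZ.
have Pl b u v (hu : L2vG u) (hv : L2vG v) : L2vG (b *: u + v).
  by apply: (L2vD mG) => //; exact: L2vZ.
have Bl b u v w (hu : L2vG u) (hv : L2vG v) (hw : L2vG w) :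
    pG (b *: u + v) (conj_field w) = b * pG u (conj_field w) + pG v (conj_field w).
  have hc := L2v_conj mG hw.
  exact: (etrans (pairDl mG (L2vZ mG b hu) hv hc)
    (congr1 (fun t => t + _) (pairZl mG b hu hc))).
have Bh u v (hu : L2vG u) (hv : L2vG v) : pG v (conj_field u) = conjc (pG u (conj_field v)).
  have hc := L2v_conj mG hv.
  by apply: (etrans _ (pair_conj mG hu hc)); rewrite conj_fieldK; exact: pairC.
have := orthonormal_form_sum (L2v0 _ _) Pl Bl Bh uGamma_L2 uGamma_orthonormal a us.
by rewrite (pair_self mG lS) => /(congr1 (@complex.Re R)).
Qed.

Lemma XTwB u w d v w' d' : XTw Omega u w d -> XTw Omega v w' d' ->
  XTw Omega (u - v) (w - w') (d - d').
Proof.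
move=> hu hv; have := XTw_lin oOmega bOmega (-1) hv hu.
rewrite !scaleN1r ![- _ + _]addrC.
have -> : (fun x => -1 * d' x + d x) = d - d' by apply/funext => x; rewrite mulN1r addrC.
by [].
Qed.

(** The selected curl of a difference equals the difference of the selected curls only up to a null
    set; the factor 2 is the cost of that comparison. *)
Lemma curl_divB u v : XT Omega u -> XT Omega v ->
  nO (curl Omega u - curl Omega v) <= 2 * nO (curl Omega (u - v)) /\
  nOs (div Omega u - div Omega v) <= 2 * nOs (div Omega (u - v)).
Proof.
move=> /XT_XTw hu /XT_XTw hv; have hB := XTwB hu hv.
have [xB nc nd] := XTw_XT oOmega bOmega hB.
have [[_ l2 l3] _ _ _] := XT_XTw xB; have [[_ k2 k3] _ _ _] := hB.
split; first by apply: (nsqv_null_le mO k2 l2); rewrite sqL2vBC.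
by apply: (nsq_null_le mO k3 l3); rewrite sqL2BC.
Qed.

Lemma Tr_curl u w d g : XTw Omega u w d -> Tr u w g -> Tr u (curl Omega u) g.
Proof.
move=> hx ht; have [xu nc _] := XTw_XT oOmega bOmega hx.
have lu : L2vO u by case: hx => -[].
exact: (Tr_null oOmega bOmega (XT_XTw xu) hx (nullO_refl oOmega lu) nc ht).
Qed.

(** The trace is given as an explicit sum, in place of the value selected by [pi_T], so that its
    convergence can be read off on the boundary. *)
Lemma Tr_psum a s : Tr (psum a s) (curl Omega (psum a s)) (\sum_(i <- s) a i *: pT (uO i)).
Proof.
have T n : Tr (uO n) (curl Omega (uO n)) (pT (uO n)).
  exact: (hasTP oOmega bOmega cOmega hnu hsigma (steklov_hasT n)).
rewrite /psum; elim: s => [|n s IH].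
  rewrite !big_nil; have X0 := XT_XTw (XTO 0).
  have := Tr_lin oOmega bOmega cOmega hnu hsigma (-1) X0 X0 (T 0%N) (T 0%N).
  have := XTw_lin oOmega bOmega (-1) X0 X0.
  rewrite !scaleN1r !addNr => hx ht; exact: Tr_curl hx ht.
rewrite !big_cons; have Xn := XT_XTw (XTO n).
have Xs := XT_XTw (psum_hasT a s).1.
exact: Tr_curl (XTw_lin oOmega bOmega (a n) Xn Xs)
  (Tr_lin oOmega bOmega cOmega hnu hsigma (a n) Xn Xs (T n) IH).
Qed.

Lemma form_a_psum a s phi : XT Omega phi ->
  form_a Omega alpha theta (psum a s) phi =
  - \sum_(i <- s) a i * ((lambda i)%:C%C * pG (pT (uO i)) (pT phi)).
Proof.
move=> hp; rewrite /psum; elim: s => [|n s IH].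
  rewrite !big_nil oppr0.
  have := form_a_linl oOmega bOmega alpha theta (-1) (XTO 0) (XTO 0) hp.
  by rewrite scaleN1r addNr mulN1r addNr.
rewrite !big_cons (form_a_linl oOmega bOmega alpha theta (a n) (XTO n) (psum_hasT a s).1 hp).
rewrite IH; have [_ _ h] := steklov_eig hS n.
by rewrite (h _ hp) mulrN opprD.
Qed.

(** * Convergence of the series and the boundary value problem *)

Hypothesis lambda_neq0 : forall n, lambda n != 0.
Variable c : nat -> R[i].
Hypothesis ell2c : ell2 c.

Definition coef n : R[i] := (Num.sqrt `|lambda n - eta| / lambda n)%:C%C * c n.

(** The eigenvalues tend to minus infinity, so lambda_n <= -1 from some index on; there |lambda_n -
    eta| / lambda_n^2 <= 1 + |eta| and 1 / lambda_n^2 <= 1. The finitely many earlier terms do not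
    affect the Cauchy property. *)
Lemma coef_tail : exists (K : R) (N : nat), 0 < K /\ forall n, (N <= n)%N ->
  absq (coef n) <= K * absq (c n) /\ absq (c n / (lambda n)%:C%C) <= absq (c n).
Proof.
have [N _ hN] : \forall n \near \oo, lambda n <= -1.
  by have /cvgrNyPle := steklov_ninfty hS; apply.
exists (`|eta| + 1), N; split; first by rewrite ltr_wpDl.
move=> n /hN /= l1; have c0 := absq_ge0 (c n).
have l0 := lambda_neq0 n.
have ll : 1 <= lambda n ^+ 2 by nra.
split.
  rewrite /coef absqM absq_real ler_wpM2r// exprMn sqr_sqrtr// exprVn.
  rewrite ler_pdivrMr ?(lt_le_trans ltr01 ll)//.
  apply: (le_trans (ler_normB _ _)).
  have := normr_ge0 eta; rewrite (ler0_norm (_ : lambda n <= 0)); first by nra.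
  exact: le_trans l1 (lerN10 _).
have -> : c n / (lambda n)%:C%C = (lambda n)^-1%:C%C * c n.
  by rewrite mulrC fmorphV.
rewrite absqM absq_real exprVn ler_piMl//.
by rewrite invf_le1// (lt_le_trans ltr01 ll).
Qed.

Lemma cauchy_wlogv (mu : {measure set (mspace3 R) -> \bar R}) (D : set (space3 R))
  (f : nat -> cfield R) :
  (forall e : R, 0 < e -> exists N, forall n m, (N <= n)%N -> (n <= m)%N ->
    fine (sqL2v mu D (f m - f n)) <= e) ->
  forall e : R, 0 < e -> exists N, forall m n, (N <= m)%N -> (N <= n)%N ->
    fine (sqL2v mu D (f m - f n)) <= e.
Proof.
move=> h e e0; have [N hN] := h e e0; exists N => m n Nm Nn.
have [nm|/ltnW mn] := leqP n m; first exact: hN.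
by rewrite sqL2vBC; exact: hN.
Qed.

Lemma cauchy_wlogs (mu : {measure set (mspace3 R) -> \bar R}) (D : set (space3 R))
  (f : nat -> space3 R -> R[i]) :
  (forall e : R, 0 < e -> exists N, forall n m, (N <= n)%N -> (n <= m)%N ->
    fine (sqL2 mu D (f m - f n)) <= e) ->
  forall e : R, 0 < e -> exists N, forall m n, (N <= m)%N -> (N <= n)%N ->
    fine (sqL2 mu D (f m - f n)) <= e.
Proof.
move=> h e e0; have [N hN] := h e e0; exists N => m n Nm Nn.
have [nm|/ltnW mn] := leqP n m; first exact: hN.
by rewrite sqL2BC; exact: hN.
Qed.

Definition partial N := psum coef (index_iota 0 N).
Definition gpartial N : cfield R := \sum_(0 <= n < N) (c n / (lambda n)%:C%C) *: uG n.

Lemma partialB n m : (n <= m)%N -> partial m - partial n = psum coef (index_iota n m).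
Proof.
move=> nm; apply/eqP; rewrite subr_eq addrC; apply/eqP.
exact: (big_cat_nat (leq0n n) nm).
Qed.

(** The square root in [coef] is the one that normalizes [uGamma], hence the coefficients c_n /
    lambda_n of the Calderon series. *)
Lemma gpartialE N : gpartial N = \sum_(i <- index_iota 0 N) coef i *: pT (uO i).
Proof.
apply: eq_bigr => n _; rewrite /uGamma scalerA; congr (_ *: _).
by rewrite /coef rmorphM fmorphV /= mulrC -mulrA; congr (_ * _); rewrite mulrC.
Qed.

Lemma tail_sum (K : R) (f : nat -> R) (N : nat) : 0 < K ->
  (forall n, (N <= n)%N -> f n <= K * absq (c n)) -> forall e : R, 0 < e ->
  exists M, forall n m, (M <= n)%N -> (n <= m)%N -> \sum_(n <= i < m) f i <= e.
Proof.
move=> K0 hf e e0; have [M hM] := ell2_cauchy ell2c (divr_gt0 e0 K0).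
exists (maxn M N) => n m; rewrite geq_max => /andP[Mn Nn] nm.
apply: (@le_trans _ _ (K * \sum_(n <= i < m) absq (c i))).
  rewrite mulr_sumr !big_nat; apply: ler_sum => i /andP[ni _].
  by apply: hf; exact: leq_trans ni.
by rewrite mulrC -ler_pdivlMr// hM.
Qed.

(** Fields, curls, divergences and boundary sums are Cauchy in separate L2 spaces, the first three
    by coercivity and the last by orthonormality on the boundary. Each gets a limit of its own; the
    closedness of [XTw] and [Tr] then ties the four limits together. *)
Lemma expansion_limit : exists u0 w0 d0 g0,
  [/\ XTw Omega u0 w0 d0, Tr u0 w0 g0,
      [/\ L2vG g0, vcvg sigma (bdry Omega) gpartial g0 & vcvg leb3 Omega partial u0],
      vcvg leb3 Omega (fun n => curl Omega (partial n)) w0 &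
      scvg leb3 Omega (fun n => div Omega (partial n)) d0].
Proof.
have [K [N0 [K0 hK]]] := coef_tail.
have [C C0 hC] := psum_coercive.
have X n : XTw Omega (partial n) (curl Omega (partial n)) (div Omega (partial n)).
  exact: XT_XTw (psum_hasT _ _).1.
have lu n : L2vO (partial n) by case: (X n) => -[].
have lw n : L2vO (curl Omega (partial n)) by case: (X n) => -[].
have ld n : L2 leb3 Omega (div Omega (partial n)) by case: (X n) => -[].
have lg n : L2vG (gpartial n).
  apply: (closed_lincomb (P := L2vG) _ _ _ (index_iota 0 n)); [exact: L2v0| |exact: uGamma_L2].
  by move=> b u v hu hv; apply: (L2vD mG) => //; exact: L2vZ.
have small e : 0 < e -> exists M, forall n m, (M <= n)%N -> (n <= m)%N ->
    2 * (C * \sum_(n <= i < m) absq (coef i)) <= e.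
  move=> e0; have C2 : 0 < 2 * C by rewrite mulr_gt0.
  have [M hM] := tail_sum K0 (fun n Nn => (hK n Nn).1) (divr_gt0 e0 C2).
  by exists M => n m Mn nm; rewrite mulrA mulrC -ler_pdivlMr// hM.
(* A harmless factor 2: the bound [small] is doubled for the curls and divergences, and this lets it
   serve the fields too. *)
have nn (x : \bar R) : (0 <= x)%E -> fine x <= 2 * fine x.
  by move=> /fine_ge0; lra.
have [|u0 hu0 cu] := L2v_complete mO fO lu.
  apply: cauchy_wlogv => e e0; have [M hM] := small e e0; exists M => n m Mn nm.
  apply: le_trans (hM n m Mn nm); rewrite partialB//.
  apply: le_trans (nn _ (sqL2v_ge0 _ _ _)) _.
  by rewrite ler_pM2l//; have [] := hC coef (index_iota n m) (iota_uniq _ _).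
have [|w0 hw0 cw] := L2v_complete mO fO lw.
  apply: cauchy_wlogv => e e0; have [M hM] := small e e0; exists M => n m Mn nm.
  apply: le_trans (hM n m Mn nm).
  apply: (le_trans (curl_divB (psum_hasT _ _).1 (psum_hasT _ _).1).1).
  rewrite partialB//.
  by rewrite ler_pM2l//; have [] := hC coef (index_iota n m) (iota_uniq _ _).
have [|d0 hd0 cd] := L2_complete mO fO ld.
  apply: cauchy_wlogs => e e0; have [M hM] := small e e0; exists M => n m Mn nm.
  apply: le_trans (hM n m Mn nm).
  apply: (le_trans (curl_divB (psum_hasT _ _).1 (psum_hasT _ _).1).2).
  rewrite partialB//.
  by rewrite ler_pM2l//; have [] := hC coef (index_iota n m) (iota_uniq _ _).
have [|g0 hg0 cg] := L2v_complete mG fG lg.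
  apply: cauchy_wlogv => e e0.
  have hK1 n : (N0 <= n)%N -> absq (c n / (lambda n)%:C%C) <= 1 * absq (c n).
    by move=> /hK[_]; rewrite mul1r.
  have [M hM] := tail_sum ltr01 hK1 e0; exists M => n m Mn nm.
  have -> : gpartial m - gpartial n = \sum_(i <- index_iota n m) (c i / (lambda i)%:C%C) *: uG i.
    by apply/eqP; rewrite subr_eq addrC; apply/eqP; exact: (big_cat_nat (leq0n n) nm).
  by rewrite uGamma_sum_norm ?iota_uniq// hM.
exists u0, w0, d0, g0.
have XX := XTw_lim oOmega bOmega X hu0 hw0 hd0 cu cw cd.
have TT n : Tr (partial n) (curl Omega (partial n)) (gpartial n).
  by rewrite gpartialE; exact: Tr_psum.
have TL := Tr_lim oOmega bOmega cOmega hnu hsigma X TT XX hg0 cu cw cg.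
by split.
Qed.

Lemma pG_suml (e : nat -> cfield R) a s v : (forall n, L2vG (e n)) -> L2vG v ->
  pG (\sum_(i <- s) a i *: e i) v = \sum_(i <- s) a i * pG (e i) v.
Proof.
move=> he hv; apply: (form_suml (P := L2vG) (B := fun u v => pG u v) (L2v0 _ _) _ _ he _ _ hv).
  by move=> b u w hu hw; apply: (L2vD mG) => //; exact: L2vZ.
move=> b u w z hu hw hz.
exact: (etrans (pairDl mG (L2vZ mG b hu) hw hz) (congr1 (fun t => t + _) (pairZl mG b hu hz))).
Qed.

Lemma ccvg_frm (u w : nat -> cfield R) (d : nat -> space3 R -> R[i]) u0 w0 d0 v w' d' :
  (forall n, XTw Omega (u n) (w n) (d n)) -> XTw Omega u0 w0 d0 -> XTw Omega v w' d' ->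
  vcvg leb3 Omega u u0 -> vcvg leb3 Omega w w0 -> scvg leb3 Omega d d0 ->
  ccvg (fun n => frm Omega alpha theta (u n) (w n) (d n) v w' d')
    (frm Omega alpha theta u0 w0 d0 v w' d').
Proof.
move=> hn [[h1 h2 h3] _ _ _] [[k1 k2 k3] _ _ _] cu cw cd; rewrite /frm.
have lu n : L2vO (u n) by have [[]] := hn n.
have lw n : L2vO (w n) by have [[]] := hn n.
have ld n : L2 leb3 Omega (d n) by have [[]] := hn n.
have := ccvgD (ccvgD (ccvg_pair mO lw h2 k2 cw) (ccvgZ (- alpha%:C%C) (ccvg_pair mO lu h1 k1 cu)))
  (ccvgZ theta%:C%C (ccvg_spair mO ld h3 k3 cd)).
by rewrite mulNr; apply: ccvg_ext => n; rewrite mulNr.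
Qed.

Variable f : cfield R.
Hypothesis TL2f : TL2 Omega nu sigma f.
Hypothesis sumf : bdry_sum Omega sigma (fun n => c n *: uG n) f.

Definition fpartial N : cfield R := \sum_(0 <= n < N) c n *: uG n.

Lemma gsum_L2 a s : L2vG (\sum_(i <- s) a i *: uG i).
Proof.
apply: (closed_lincomb (P := L2vG)); [exact: L2v0| |exact: uGamma_L2].
by move=> b u v hu hv; apply: (L2vD mG) => //; exact: L2vZ.
Qed.

Lemma fpartial_cvg : vcvg sigma (bdry Omega) fpartial f.
Proof.
apply/(EFin_cvg0P (s := fun n => nG (f - fpartial n))) => [n|].
  by rewrite fine_ge0// sqL2v_ge0.
suff <- : (fun N => sqL2v sigma (bdry Omega) (f - \sum_(n < N) c n *: uG n)) =
    (fun n => (nG (f - fpartial n))%:E) by exact: sumf.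
apply/funext => n.
have lB : L2vG (f - fpartial n) by apply: (L2vB mG); [exact: TL2f.1|exact: gsum_L2].
by rewrite -(sqL2v_fineK mG lB) /fpartial big_mkord.
Qed.

(* [phi] may have no trace, in which case [pi_T phi = 0] by default: only the
   eigenvalue equations and the fact that [pi_T phi] is in L2 are used. *)
Lemma form_a_limit u0 w0 d0 phi : XTw Omega u0 w0 d0 ->
  vcvg leb3 Omega partial u0 -> vcvg leb3 Omega (fun n => curl Omega (partial n)) w0 ->
  scvg leb3 Omega (fun n => div Omega (partial n)) d0 -> XT Omega phi ->
  form_a Omega alpha theta u0 phi = - pG f (pT phi).
Proof.
move=> X0 cu cw cd xp; have Xp := XT_XTw xp; have lp := pT_L2 phi.
have X n : XTw Omega (partial n) (curl Omega (partial n)) (div Omega (partial n)).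
  exact: XT_XTw (psum_hasT _ _).1.
rewrite (form_aE oOmega bOmega alpha theta X0 Xp).
apply: (ccvg_unique (ccvg_frm X X0 Xp cu cw cd)).
have lf n : L2vG (fpartial n) by exact: gsum_L2.
rewrite -mulN1r.
apply: ccvg_ext (ccvgZ (-1) (ccvg_pair mG lf TL2f.1 lp fpartial_cvg)) => n.
rewrite -(form_aE oOmega bOmega alpha theta (X n) Xp) (form_a_psum coef _ xp) mulN1r.
congr (- _); rewrite /fpartial (pG_suml c _ uGamma_L2 lp).
apply: eq_bigr => i _; rewrite /uGamma (pairZl mG _ (pT_L2 _) lp) !mulrA; congr (_ * _).
have aux (x l y : R[i]) : l != 0 -> x * l^-1 * y * l = y * x.
  by move=> l0; rewrite mulrAC divfK// mulrC.
by rewrite /coef rmorphM fmorphV /= aux// fmorph_eq0; exact: lambda_neq0.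
Qed.

Lemma weak_solution_unique u v : ~ range lambda 0 ->
  weak_solution Omega nu sigma alpha theta f u ->
  weak_solution Omega nu sigma alpha theta f v -> nullO (u - v).
Proof.
move=> hr [xu hu] [xv hv]; apply: contrapT => /eqP h0; apply: hr.
rewrite (steklov_range hS); exists (u - v).
have xB : XT Omega (u - v).
  by have := XT_lin oOmega bOmega (-1) xv xu; rewrite scaleN1r addrC.
split=> // phi xp.
have := form_a_linl oOmega bOmega alpha theta (-1) xv xu xp.
rewrite scaleN1r [- v + u]addrC => ->.
by rewrite (hu _ xp) (hv _ xp) mulN1r opprK subrr rmorph0 mul0r oppr0.
Qed.

(** Used to pass from the constructed limit to an arbitrary solution, which agrees with it almost
    everywhere: the same curl and divergence serve both. *)
Lemma XTw_null u u0 w d : L2vO u -> nullO (u - u0) -> XTw Omega u0 w d -> XTw Omega u w d.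
Proof.
move=> lu hn [[l1 l2 l3] cw dd n0]; split; first by split.
- move=> psi sp su; rewrite (cw _ sp su); apply/esym.
  exact: (pair_null mO lu l1 (test_curl oOmega bOmega sp) hn).
- move=> phi sp su; rewrite (dd _ sp su); congr (- _); apply/esym.
  exact: (pair_null mO lu l1 (test_grad oOmega bOmega sp) hn).
- move=> phi sp; rewrite -(n0 _ sp); congr (_ + _).
  exact: (pair_null mO lu l1 (test_grad oOmega bOmega sp) hn).
Qed.

Lemma XT_sum_limit u w0 d0 : XTw Omega u w0 d0 -> vcvg leb3 Omega partial u ->
  vcvg leb3 Omega (fun n => curl Omega (partial n)) w0 ->
  scvg leb3 Omega (fun n => div Omega (partial n)) d0 ->
  XT_sum Omega (fun n => coef n *: uO n) u.
Proof.
move=> X0 cu cw cd; rewrite /XT_sum.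
have X n : XTw Omega (partial n) (curl Omega (partial n)) (div Omega (partial n)).
  exact: XT_XTw (psum_hasT _ _).1.
pose s n := nO (u - partial n) + nO (curl Omega (u - partial n)) + nOs (div Omega (u - partial n)).
have E : (fun N => sqXT Omega (u - \sum_(n < N) coef n *: uO n)) = (fun N => (s N)%:E).
  apply/funext => n; have -> : \sum_(i < n) coef i *: uO i = partial n.
    by rewrite /partial /psum big_mkord.
  have [xB _ _] := XTw_XT oOmega bOmega (XTwB X0 (X n)).
  have [[l1 l2 l3] _ _ _] := XT_XTw xB.
  rewrite /sqXT (sqL2v_fineK mO l1) (sqL2v_fineK mO l2) (sqL2_fineK mO l3).
  by rewrite -!EFinD.
rewrite E; apply/EFin_cvg0P => [n|e e0].
  by rewrite !addr_ge0// fine_ge0// ?sqL2v_ge0// sqL2_ge0.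
(* The field counts once, the curl and the divergence twice each because of the comparison with the
   selected representatives: 1 + 2 + 2 = 5. *)
have e5 : 0 < e / 5 by rewrite divr_gt0.
have [N1 h1] := cu _ e5; have [N2 h2] := cw _ e5; have [N3 h3] := cd _ e5.
exists (maxn N1 (maxn N2 N3)) => n; rewrite !geq_max => /and3P[n1 n2 n3].
have XB := XTwB X0 (X n); have [xB nc nd] := XTw_XT oOmega bOmega XB.
have [[_ l2 l3] _ _ _] := XT_XTw xB; have [[_ k2 k3] _ _ _] := XB.
have b2 := nsqv_null_le mO l2 k2 nc; have b3 := nsq_null_le mO l3 k3 nd.
rewrite /s; have := h1 n n1; have := h2 n n2; have := h3 n n3; lra.
Qed.

End SteklovExpansion.

Theorem theorem4p4 (R : realType) (Omega : set (space3 R))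
  (nu : space3 R -> 'rV[R]_3) (sigma : {measure set (mspace3 R) -> \bar R})
  (theta alpha c0 eta : R) (lambda : nat -> R) (uO : nat -> cfield R)
  (c : nat -> R[i]) (f : cfield R) :
  open Omega -> connected Omega -> bounded_set Omega -> C11_boundary Omega ->
  is_outer_normal Omega nu -> is_surface_measure Omega sigma ->
  0 < theta -> (alpha%:E < A1 Omega theta)%E ->
  0 <= c0 ->
  (forall eta', c0 <= eta' -> coercive_XT Omega nu sigma alpha theta eta') ->
  c0 <= eta ->
  steklov_system Omega nu sigma alpha theta eta lambda uO ->
  ~ range lambda 0 ->
  TL2 Omega nu sigma f -> ell2 c ->
  bdry_sum Omega sigma
    (fun n => c n *: uGamma Omega nu sigma eta lambda uO n) f ->
  [/\ exists u, weak_solution Omega nu sigma alpha theta f u,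
      forall u, weak_solution Omega nu sigma alpha theta f u ->
        XT_sum Omega
          (fun n => ((Num.sqrt `|lambda n - eta| / lambda n)%:C%C * c n)
                    *: uO n) u
    & exists g, [/\ TL2 Omega nu sigma g,
        bdry_sum Omega sigma
          (fun n => (c n / (lambda n)%:C%C)
                    *: uGamma Omega nu sigma eta lambda uO n) g &
        {ae sigma, forall x, bdry Omega x ->
           calderon Omega nu sigma alpha theta f x
           = cross (toC (nu x)) (g x)}]].
Proof.
move=> oO _ bO cO hnu hs _ _ _ hco hc0 hS hr hf hc sumf.
have mO : measurable (Omega : set (mspace3 R)) by exact: open_measurable3.
have mG : measurable (bdry Omega : set (mspace3 R)) by exact: measurable_bdry.
have l0 n : lambda n != 0 by apply/eqP => h; apply: hr; exists n.
have [u0 [w0 [d0 [g0 [X0 T0 [lg cg cu] cw cd]]]]] :=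
  expansion_limit oO bO cO hnu hs (hco _ hc0) hS l0 hc.
have [x0 _ _] := XTw_XT oO bO X0.
have ws0 : weak_solution Omega nu sigma alpha theta f u0.
  split=> // phi xp.
  exact: (form_a_limit oO bO cO hnu hs hS l0 hf sumf X0 cu cw cd xp).
have null u : weak_solution Omega nu sigma alpha theta f u ->
    sqL2v leb3 Omega (u - u0) = 0%E.
  by move=> wu; exact: (weak_solution_unique oO bO hS hr wu ws0).
have Xu u : weak_solution Omega nu sigma alpha theta f u -> XTw Omega u w0 d0.
  move=> wu; have [[lu _ _ _] _] := wu.
  exact: (XTw_null oO bO lu (null u wu) X0).
split; first by exists u0.
  move=> u wu; have X := Xu u wu.
  apply: (XT_sum_limit oO bO cO hnu hs hS X _ cw cd).
  (* Half of e, since replacing [u0] by [u] through [nsqv_null_le] doubles the bound. *)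
  move=> e e0; have [N hN] := cu _ (divr_gt0 e0 (ltr0Sn R 1)).
  exists N => n Nn; have [[lu _ _] _ _ _] := X; have [[lu0 _ _] _ _ _] := X0.
  have [[lp _ _] _ _ _] := XT_XTw
    (psum_hasT oO bO cO hnu hs hS (coef eta lambda c) (index_iota 0 n)).1.
  have h0 : sqL2v leb3 Omega ((u - partial eta lambda uO c n) -
      (u0 - partial eta lambda uO c n)) = 0%E.
    by rewrite opprB addrA subrK; exact: null.
  apply: (le_trans (nsqv_null_le mO (L2vB mO lu lp) (L2vB mO lu0 lp) h0)).
  by rewrite mulrC -ler_pdivlMr// hN.
exists g0; split; first exact: T0.1.
  rewrite /bdry_sum.
  suff -> : (fun N => sqL2v sigma (bdry Omega) (g0 - \sum_(n < N) (c n / (lambda n)%:C%C)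
      *: uGamma Omega nu sigma eta lambda uO n)) =
    (fun n => (fine (sqL2v sigma (bdry Omega)
      (g0 - gpartial Omega nu sigma eta lambda uO c n)))%:E).
    by apply/EFin_cvg0P => [n|]; [rewrite fine_ge0// sqL2v_ge0|exact: cg].
  apply/funext => n.
  have lB : L2v sigma (bdry Omega) (g0 - gpartial Omega nu sigma eta lambda uO c n).
    by apply: (L2vB mG) => //; exact: gsum_L2.
  by rewrite -(sqL2v_fineK mG lB) /gpartial big_mkord.
(* [calderon] takes the trace of one selected solution. That solution differs from [u0] by a null
   field, so [g0] is a trace of it as well, and uniqueness of traces gives equality almost
   everywhere on the boundary. *)
rewrite /calderon; set us := xget _ _.
have ws : weak_solution Omega nu sigma alpha theta f us.
  exact: (@xgetPex _ 0 [set u | weak_solution Omega nu sigma alpha theta f u]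
    (ex_intro _ u0 ws0)).
have Xs := Xu us ws; have [[_ lw0 _] _ _ _] := X0.
have Ts := Tr_null oO bO Xs X0 (null us ws) (nullO_refl oO lw0) T0.
have [_ nG] := piTP oO bO cO hnu hs Xs Ts.
have := (sqL2v_ae0 mG (L2vB mG (piT_L2 Omega nu sigma us) lg)).1 nG.
apply: aeS => x /= h bx; congr cross.
by apply/eqP; rewrite -subr_eq0; apply/eqP; exact: h.
Qed.
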